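(* Let $\Omega\subset\mathbb R^n$ be a bounded open set with $C^2$ boundary, let $L,F,G$ satisfy the assumptions below, $H$ as below, and let $(u,m)$ be a mild solution of the constrained MFG problem in $\overline\Omega$. Then $u$ is a constrained viscosity solution of $$-\partial_tu+H(x,Du)=F(x,m(t))\ \text{ in }(0,T)\times\overline\Omega,\qquad u(T,x)=G(x,m(T))\ \text{ in }\overline\Omega.$$ Moreover, $u$ is differentiable at every $(t,x)\in Q_m$ with $-\partial_tu(t,x)+H(x,Du(t,x))=F(x,m(t))$ there, while at every $(t,x)\in\partial Q_m$ the time derivative $\partial_tu(t,x)$ exists and $-\partial_tu(t,x)+H^\tau(x,D^\tau_xu(t,x))=F(x,m(t))$.
   Context: $T>0$; $U\supset\overline\Omega$ open; $\nu(x)$ outward unit normal at $x\in\partial\Omega$. $\mathcal P(\overline\Omega)$ with the Kantorovich–Rubinstein distance $d_1$. Assumptions: (D1) $|F(x,m_1)-F(x,m_2)|+|G(x,m_1)-G(x,m_2)|\le\kappa d_1(m_1,m_2)$; (D2) $F(\cdot,m),G(\cdot,m)\in C^1_b(U)$, $|D_xF|+|D_xG|\le\kappa$; (D3) $x\mapsto F(x,m)$ semiconcave with linear modulus uniformly in $m$; (L0) $L\in C^1(U\times\mathbb R^n)$, $|L(x,0)|+|D_xL(x,0)|+|D_vL(x,0)|\le M$; (L1) $D_vL$ differentiable, $I/\mu\le D^2_{vv}L\le\mu I$, $\|D^2_{vx}L(x,v)\|\le\mu(1+|v|)$; (L2) $|D_xL(x,v)-D_xL(x,w)|\le C(R)|v-w|$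 for $v,w\in B_R$; (L3) $x\mapsto L(x,v)$ semiconcave with linear modulus uniformly in $v\in B_R$. $H(x,p)=\sup_v\{-\langle p,v\rangle-L(x,v)\}$; $H^\tau(x,p)=\sup\{-\langle p,v\rangle-L(x,v):\langle v,\nu(x)\rangle=0\}$ for $x\in\partial\Omega$. $\Gamma$: absolutely continuous curves $[0,T]\to\overline\Omega$; $\Gamma_t[x]=\{\gamma:\gamma(t)=x\}$; $e_t(\gamma)=\gamma(t)$; $m^\eta(t)=e_t\sharp\eta$; $J_\eta[\gamma]=\int_0^T[L(\gamma,\dot\gamma)+F(\gamma,m^\eta(t))]dt+G(\gamma(T),m^\eta(T))$; $\Gamma^\eta[x]$ minimizers of $J_\eta$ over $\Gamma_0[x]$. Constrained MFG equilibrium for $m_0$: Borel probability $\eta$ on $\Gamma$ with $e_0\sharp\eta=m_0$ and $\mathrm{supp}\,\eta\subset\bigcup_x\Gamma^\eta[x]$. Mild solution: $(u,m)\in C([0,T]\times\overline\Omega)\times C([0,T];\mathcal P(\overline\Omega))$ with, for some equilibrium $\eta$, $m(t)=e_t\sharp\eta$ and $u(t,x)=\inf_{\gamma\in\Gamma_t[x]}\{\int_t^T[L(\gamma,\dot\gamma)+F(\gamma(s),m(s))]ds+G(\gamma(T),m(T))\}$. $Q_m=\{(t,x)\in(0,T)\times\Omega:x\in\mathrm{supp}(m(t))\}$, $\partial Q_m=\{(t,x)\in(0,T)\times\partial\Omega:x\in\mathrm{supp}(m(t))\}$. For $(t,x)\in\partial Q_m$, $D^\tau_xu(t,x)$ denotes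 the common tangential component $p-\langle p,\nu(x)\rangle\nu(x)$ of all $p$ in $D^+_xu(t,x)=\{p:\limsup_{y\to x,y\in\overline\Omega}\frac{u(t,y)-u(t,x)-\langle p,y-x\rangle}{|y-x|}\le0\}$. Constrained viscosity solution of the equation: $u$ is a subsolution in $(0,T)\times\Omega$ (whenever $\phi\in C^1(\mathbb R^{n+1})$ and $u-\phi$ has a local max relative to $(0,T)\times\Omega$ at $(t,x)\in(0,T)\times\Omega$, $-\partial_t\phi+H(x,D\phi)\le F(x,m(t))$ at $(t,x)$) and a supersolution in $(0,T)\times\overline\Omega$ (whenever $u-\phi$ has a local min relative to $(0,T)\times\overline\Omega$ at $(t,x)\in(0,T)\times\overline\Omega$, $-\partial_t\phi+H(x,D\phi)\ge F(x,m(t))$ at $(t,x)$). *)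

(* Defs.v *)
From HB Require Import structures.
From mathcomp Require Import all_boot all_order all_algebra.
From mathcomp Require Import all_classical all_reals all_analysis.
Set Implicit Arguments. Unset Strict Implicit. Unset Printing Implicit Defensive.
Import Order.TTheory GRing.Theory Num.Theory.
Import numFieldNormedType.Exports.
Local Open Scope classical_set_scope.
Local Open Scope ring_scope.

Section MFGDefs.
Variables (R : realType) (n : nat).
Local Notation V := 'rV[R]_n.

Definition dotv (u v : V) : R := \sum_(i < n) u 0 i * v 0 i.
Definition enorm (v : V) : R := Num.sqrt (dotv v v).
Definition unitv (i : 'I_n) : V := delta_mx 0 i.
Definition eball (x : V) (r : R) : set V := [set y | enorm (y - x) < r].

(* gradient of a real function on R^n (meaningful where differentiable) *)
Definition grad (f : V -> R) (x : V) : V := \row_i ('d f x (unitv i)).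

Definition C1_on (W : normedModType R) (Y : normedModType R)
    (A : set W) (f : W -> Y) : Prop :=
  forall x, A x -> differentiable f x /\
    forall v : W, {for x, continuous (fun y => 'd f y v)}.
Definition C2_on (A : set V) (f : V -> R) : Prop :=
  C1_on A f /\ forall i : 'I_n, C1_on A (fun y => 'd f y (unitv i)).
Definition C1b_on (A : set V) (f : V -> R) : Prop :=
  [/\ C1_on A f, (exists M, forall x, A x -> `|f x| <= M)
    & (exists M, forall x, A x -> enorm (grad f x) <= M)].

(* semiconcavity with linear modulus omega(r) = C r on A
   (Cannarsa--Sinestrari form, for segments contained in A) *)
Definition semiconcave_lin (A : set V) (C : R) (f : V -> R) : Prop :=
  forall x y : V, (forall l : R, 0 <= l <= 1 -> A (l *: x + (1 - l) *: y)) ->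
  forall l : R, 0 <= l <= 1 ->
    l * f x + (1 - l) * f y - f (l *: x + (1 - l) *: y)
      <= C * l * (1 - l) * (enorm (x - y)) ^+ 2.

Definition bdry (O : set V) : set V := closure O `\` O.
Definition bounded_set (O : set V) : Prop := exists M, forall x, O x -> enorm x <= M.
Definition C2_domain (O : set V) : Prop :=
  [/\ open O, bounded_set O &
    forall x0, bdry O x0 -> exists r, 0 < r /\ exists rho : V -> R,
      [/\ C2_on (ball x0 r) rho,
          (forall y, ball x0 r y -> (O y <-> rho y < 0)) &
          (forall y, ball x0 r y -> rho y = 0 -> grad rho y != 0)]].
Definition outward_normal (O : set V) (x nu : V) : Prop :=
  exists r, 0 < r /\ exists rho : V -> R,
    [/\ C1_on (ball x r) rho,
        (forall y, ball x r y -> (O y <-> rho y < 0)),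
        grad rho x != 0 &
        nu = (enorm (grad rho x))^-1 *: grad rho x].

Definition Bor := g_sigma_algebraType (@open V).
Definition Prob := probability Bor R.
Definition inP (O : set V) (mu : Prob) : Prop := mu (closure O : set Bor) = 1%E.
Definition lip1_on (A : set V) (f : V -> R) : Prop :=
  forall x y, A x -> A y -> `|f x - f y| <= enorm (x - y).
Definition d1 (O : set V) (m1 m2 : Prob) : R :=
  sup [set r | exists f : V -> R, lip1_on (closure O) f /\
     r = fine (\int[m1]_(x in (closure O : set Bor)) (f x)%:E)
       - fine (\int[m2]_(x in (closure O : set Bor)) (f x)%:E)].
Definition msupp (mu : Prob) : set V :=
  [set x | forall e, 0 < e -> (0 < mu (eball x e : set Bor))%E].

Definition abs_cont_on (a b : R) (g : R -> V) : Prop :=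
  forall e, 0 < e -> exists2 d, 0 < d &
    forall (k : nat) (s t : 'I_k -> R),
      (forall i, a <= s i /\ s i <= t i /\ t i <= b) ->
      (forall i j, i != j -> t i <= s j \/ t j <= s i) ->
      \sum_(i < k) (t i - s i) < d ->
      \sum_(i < k) enorm (g (t i) - g (s i)) < e.
(* Gamma : absolutely continuous curves [0,T] -> Omega-bar
   (values outside [0,T] are irrelevant) *)
Definition Gamma (O : set V) (T : R) (g : R -> V) : Prop :=
  abs_cont_on 0 T g /\ forall t, 0 <= t <= T -> closure O (g t).

(* sigma-algebra on curves generated by the evaluations e_t, t in [0,T];
   its trace on Gamma is the Borel sigma-algebra of Gamma (uniform topology) *)
Definition cyl (T : R) : set (set (R -> V)) :=
  [set A | exists t (B : set Bor), [/\ 0 <= t <= T, measurable B &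
                                     A = [set g | B (g t)]]].
Definition CurveSp (T : R) := g_sigma_algebraType (cyl T).

(* eta, a probability on the ambient curve space, is a Borel probability on
   Gamma: it is carried by Gamma (every measurable set missing Gamma is null) *)
Definition carried_by_Gamma (O : set V) (T : R) (eta : probability (CurveSp T) R)
  : Prop :=
  forall A : set (CurveSp T), measurable A -> A `&` Gamma O T = set0 -> eta A = 0%E.
(* eta(S) > 0 for a subset S of Gamma, via the trace measure *)
Definition trace_pos (O : set V) (T : R) (eta : probability (CurveSp T) R)
    (S : set (R -> V)) : Prop :=
  forall A : set (CurveSp T), measurable A -> A `&` Gamma O T = S `&` Gamma O T ->
    (0 < eta A)%E.
Definition in_csupp (O : set V) (T : R) (eta : probability (CurveSp T) R)
    (g : R -> V) : Prop :=
  Gamma O T g /\ forall e, 0 < e ->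
    trace_pos O eta [set g' | exists2 r, r < e &
                          forall t, 0 <= t <= T -> enorm (g' t - g t) <= r].

Definition cost (L : V -> V -> R) (F G : V -> Prob -> R) (m : R -> Prob)
    (T t : R) (g : R -> V) : \bar R :=
  (\int[lebesgue_measure]_(s in `[t, T]%classic)
      (L (g s) (derive1 g s) + F (g s) (m s))%:E + (G (g T) (m T))%:E)%E.
Definition optimal (O : set V) L F G m T (x : V) (g : R -> V) : Prop :=
  [/\ Gamma O T g, g 0 = x &
      forall g', Gamma O T g' -> g' 0 = x -> (cost L F G m T 0 g <= cost L F G m T 0 g')%E].

Definition value (O : set V) L F G m T (t : R) (x : V) : \bar R :=
  ereal_inf [set cost L F G m T t g | g in [set g | Gamma O T g /\ g t = x]].

Definition equilibrium (O : set V) L F G (T : R) (m0 : Prob) (m : R -> Prob)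
    (eta : probability (CurveSp T) R) : Prop :=
  [/\ carried_by_Gamma O eta,
      (forall B : set Bor, measurable B -> m0 B = eta [set g | B (g 0)]),
      (forall t, 0 <= t <= T -> forall B : set Bor, measurable B ->
          m t B = eta [set g | B (g t)]) &
      (forall g, in_csupp O eta g -> exists x, optimal O L F G m T x g)].

Definition mild_solution (O : set V) L F G (T : R) (m0 : Prob)
    (u : R -> V -> R) (m : R -> Prob) : Prop :=
  [/\ {within [set z : R * V | 0 <= z.1 <= T /\ closure O z.2],
        continuous (fun z : R * V => u z.1 z.2)},
      (forall t, 0 <= t <= T -> inP O (m t)),
      (forall t, 0 <= t <= T -> forall e, 0 < e -> exists2 d, 0 < d &
          forall s, 0 <= s <= T -> `|s - t| < d -> d1 O (m s) (m t) < e),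
      (exists eta : probability (CurveSp T) R, equilibrium O L F G m0 m eta) &
      (forall t x, 0 <= t <= T -> closure O x -> (u t x)%:E = value O L F G m T t x)].

Definition Ham (L : V -> V -> R) (x p : V) : R :=
  sup [set - dotv p v - L x v | v in [set: V]].
Definition Ham_tau (L : V -> V -> R) (nu : V -> V) (x p : V) : R :=
  sup [set - dotv p v - L x v | v in [set v | dotv v (nu x) = 0]].

Definition uncurry2 (f : R -> V -> R) : R * V -> R := fun z => f z.1 z.2.
Definition dt (f : R -> V -> R) (t : R) (x : V) : R := 'd (uncurry2 f) (t, x) (1, 0).
Definition dx (f : R -> V -> R) (t : R) (x : V) : V :=
  \row_i ('d (uncurry2 f) (t, x) (0, unitv i)).
Definition gradx (L : V -> V -> R) (x v : V) : V := grad (fun y => L y v) x.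
Definition gradv (L : V -> V -> R) (x v : V) : V := grad (L x) v.

Definition superdiff (O : set V) (u : R -> V -> R) (t : R) (x p : V) : Prop :=
  forall e, 0 < e -> exists2 d, 0 < d & forall y, closure O y -> enorm (y - x) < d ->
    u t y - u t x - dotv p (y - x) <= e * enorm (y - x).

Definition visc_sub (O : set V) (L : V -> V -> R) (F : V -> Prob -> R) (m : R -> Prob)
    (T : R) (u : R -> V -> R) : Prop :=
  forall phi : R -> V -> R, C1_on [set: R * V] (uncurry2 phi) ->
  forall t x, 0 < t < T -> O x ->
  (\forall z \near (t, x), (0 < z.1 < T /\ O z.2) ->
       u z.1 z.2 - phi z.1 z.2 <= u t x - phi t x) ->
  - dt phi t x + Ham L x (dx phi t x) <= F x (m t).
Definition visc_super (O : set V) (L : V -> V -> R) (F : V -> Prob -> R) (m : R -> Prob)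
    (T : R) (u : R -> V -> R) : Prop :=
  forall phi : R -> V -> R, C1_on [set: R * V] (uncurry2 phi) ->
  forall t x, 0 < t < T -> closure O x ->
  (\forall z \near (t, x), (0 < z.1 < T /\ closure O z.2) ->
       u t x - phi t x <= u z.1 z.2 - phi z.1 z.2) ->
  F x (m t) <= - dt phi t x + Ham L x (dx phi t x).

End MFGDefs.

(* Main.v *)
Require Import Defs.
From HB Require Import structures.
From mathcomp Require Import all_boot all_order all_algebra.
From mathcomp Require Import all_classical all_reals all_analysis.
From mathcomp Require Import measurable_realfun ring lra zify.
Set Implicit Arguments. Unset Strict Implicit. Unset Printing Implicit Defensive.
Import Order.TTheory GRing.Theory Num.Theory.
Import numFieldNormedType.Exports.
Local Open Scope classical_set_scope.
Local Open Scope ring_scope.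

(* The dynamic programming principle is combined with two comparisons near a point x0 of the closure: a curve
   through x0 costs at least h L(x0, w) + (1/2mu) int |g' - w|^2 up to small errors, w being its mean slope, while the C^2
   regularity of the boundary lets one join y to z inside the closure by a chord bent inwards by O(|y - z|^2), which
   costs at most h L(x0, w) up to small errors.  Along an optimal curve the two bounds force the oscillation of g' on a
   window of half-width h to be O(sqrt h) times its energy; iterating over shrinking windows shows that g has a
   derivative v at every interior time.  Replacing one end of an optimal arc by a chord ending at a nearby (t', y) then
   gives the first order expansion of u at (t, g t), valid for y in the closure, with time slope D_vL.v - L - F and
   space slope - D_vL(x, v).  At boundary points v is tangent, because g stays in the closure on both sides of t, and
   the half-space of inward directions determines the tangential part of any superdifferential.  Every point of the
   support of m(t) lies on an optimal curve, since optimal curves have uniformly bounded energy and the support of the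
   equilibrium is closed.  The viscosity inequalities come from the same two comparisons. *)

(** * Absolutely continuous curves *)

(** The usual variations of an optimal curve may leave the closure, so neither an Euler-Lagrange
    equation nor a maximum principle is available: regularity is extracted from values alone, as for
    almost minimizers of an integral functional. In both comparisons the state is frozen at x0.
    Since d is at most sqrt(h E), shrinking windows by 16 shrinks the relative excess by 4; mean
    slopes see its square root, so they move by a relative 2^-k and form a convergent series. The
    first order expansion lives at two scales. A perturbation of size eta is spread over an arc of
    duration h = K eta: the displacement then leaves a Taylor remainder in the velocity of order eta
    / K, and freezing leaves errors of order h^2. So K is first fixed large, and eta is taken small
    afterwards. Curves are merely absolutely continuous and [derive1] is only controlled almost
    everywhere, so each curve is first given an everywhere defined measurable velocity that
    integrates back to it. *)

Section AbsCont.
Context {R : realType}.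
Implicit Types (f : R -> R) (l : seq (R * R)).

Definition nonoverlap (p q : R * R) : bool := (p.2 <= q.1) || (q.2 <= p.1).
Definition disjoint_family l : bool :=
  all (fun p => p.1 <= p.2) l && pairwise nonoverlap l.
Definition length l : R := \sum_(p <- l) (p.2 - p.1).
Definition increment f l : R := \sum_(p <- l) `|f p.2 - f p.1|.
(** Families are lists, not indexed tuples, so that cutting an interval into the steps of a
    partition is a concatenation. The domain is the whole line; curves on [0, T] are extended to it
    by [clamp]. *)
Definition ac f : Prop :=
  forall e, 0 < e -> exists2 d, 0 < d & forall l, disjoint_family l ->
    length l < d -> increment f l < e.

Definition clamp (T x : R) : R := Num.max 0 (Num.min x T).

Lemma clamp_homo T : {homo clamp T : x y / x <= y}.
Proof. by move=> x y xy; rewrite /clamp /Num.max /Num.min; repeat case: ifPn; lra. Qed.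

Lemma clamp_lip T x y : x <= y -> clamp T y - clamp T x <= y - x.
Proof. by move=> xy; rewrite /clamp /Num.max /Num.min; repeat case: ifPn; lra. Qed.

Lemma clamp_itv T x : 0 <= T -> 0 <= clamp T x <= T.
Proof. by move=> T0; rewrite /clamp /Num.max /Num.min; repeat case: ifPn; lra. Qed.

Lemma clamp_id T x : 0 <= x <= T -> clamp T x = x.
Proof. by move=> xT; rewrite /clamp /Num.max /Num.min; repeat case: ifPn; lra. Qed.

Lemma increment_cat f l l' : increment f (l ++ l') = increment f l + increment f l'.
Proof. by rewrite /increment big_cat. Qed.

Lemma length_cat l l' : length (l ++ l') = length l + length l'.
Proof. by rewrite /length big_cat. Qed.

Lemma disjoint_family1 a b : a <= b -> disjoint_family [:: (a, b)].
Proof. by move=> ab; rewrite /disjoint_family /= ab. Qed.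

Lemma ac_unif f : ac f -> forall e, 0 < e -> exists2 d, 0 < d &
  forall x y, `|x - y| < d -> `|f x - f y| < e.
Proof.
move=> acf e e0; have [d d0 H] := acf e e0; exists d => // x y.
wlog xy : x y / y <= x => [W|].
  have [/W//|/ltW yx] := leP y x.
  by rewrite distrC => /(W _ _ yx); rewrite distrC.
rewrite ger0_norm ?subr_ge0// => xyd.
have := H [:: (y, x)] (disjoint_family1 xy).
by rewrite /length /increment !big_seq1 /=; apply.
Qed.

Lemma ac_continuous f : ac f -> continuous f.
Proof.
move=> acf x; apply/cvgrPdist_lt => e e0.
have [d d0 H] := ac_unif acf e0; near=> y; apply: H.
by near: y; apply: cvgr_dist_lt.
Unshelve. all: by end_near. Qed.

Definition steps (a : R) (s : seq R) : seq (R * R) := pairmap pair a s.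

Lemma steps_inside a s : path <%R a s -> all (fun p => (a <= p.1) && (p.1 <= p.2) && (p.2 <= last a s)) (steps a s).
Proof.
elim: s a => //= x s IH a /andP[ax xs].
have xl : x <= last x s.
  elim: s x xs {IH ax} => //= y s IH x /andP[xy ys].
  by rewrite (le_trans (ltW xy))// IH.
rewrite lexx (ltW ax) xl /=; apply: sub_all (IH _ xs) => p /andP[/andP[p1 p2] p3].
by rewrite p2 p3 (le_trans (ltW ax) p1).
Qed.

Lemma steps_disjoint a s : path <%R a s -> disjoint_family (steps a s).
Proof.
elim: s a => //= x s IH a /andP[ax xs]; have /andP[al pw] := IH _ xs.
rewrite /disjoint_family /= -/(steps x s) (ltW ax) al pw !andbT /=.
apply/allP => p /(allP (steps_inside xs)) /andP[/andP[p1 p2] p3].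
by rewrite /nonoverlap /= p1.
Qed.

Lemma length_steps a s : length (steps a s) = last a s - a.
Proof.
elim: s a => [|x s IH] a; first by rewrite /length big_nil subrr.
by rewrite /length /= big_cons /= -/(length _) IH; ring.
Qed.

Lemma increment_steps f a b s : itv_partition a b s ->
  increment f (steps a s) = variation a b f s.
Proof.
elim: s a => [|x s IH] a abs.
  by rewrite variation_nil /increment big_nil.
rewrite /increment /= big_cons /= -/(steps x s) -/(increment f _) IH; last first.
  exact: itv_partition_cons abs.
by rewrite {2}/variation big_nat_recl.
Qed.

Lemma disjoint_family_refine l p l' s : itv_partition p.1 p.2 s ->
  disjoint_family (l ++ p :: l') -> disjoint_family ((l ++ steps p.1 s) ++ l').
Proof.
move=> [ps /eqP ls] /andP[]; rewrite all_cat /= => /and3P[al p12 al'].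
rewrite pairwise_cat /= => /and4P[rl pl pp pl'].
have /andP[as_ ps_] := steps_disjoint ps.
have ins := steps_inside ps.
have nin q : nonoverlap p q -> all (fun r => nonoverlap r q) (steps p.1 s).
  move=> pq; apply: sub_all ins => r /andP[/andP[r1 r2] r3]; move: pq.
  by rewrite /nonoverlap; rewrite ls in r3; case/orP; [move=> ?; apply/orP; left|move=> ?; apply/orP; right]; lra.
have nin' q : nonoverlap q p -> all (fun r => nonoverlap q r) (steps p.1 s).
  move=> pq; apply: sub_all ins => r /andP[/andP[r1 r2] r3]; move: pq.
  by rewrite /nonoverlap; rewrite ls in r3; case/orP; [move=> ?; apply/orP; left|move=> ?; apply/orP; right]; lra.
rewrite /disjoint_family !all_cat al as_ al' /= !pairwise_cat pl ps_ pl' /=.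
rewrite /allrel in rl *; rewrite andbT.
have rl1 : all (fun x => all (nonoverlap x) l') l.
  by apply: sub_all rl => x /= /andP[].
have rl2 : all (fun x => all (nonoverlap x) (steps p.1 s)) l.
  by apply: sub_all rl => x /= /andP[/nin'].
apply/andP; split; last by rewrite rl2.
rewrite all_cat rl1 /=; apply/allP => r rs; apply/allP => q ql'.
by have /nin/allP := allP pp _ ql'; apply.
Qed.

(** Induction on the intervals still to be refined: cutting one of them by any partition keeps the
    family disjoint and its length unchanged, and the supremum over partitions is taken one interval
    at a time. The suprema turn the strict bound into a weak one. *)
Lemma total_variation_increment f e d : (forall l, disjoint_family l ->
    length l < d -> increment f l < e) ->
  forall l' l, disjoint_family (l ++ l') -> length (l ++ l') < d ->
  ((increment f l)%:E + \sum_(p <- l') total_variation p.1 p.2 f <= e%:E)%E.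
Proof.
move=> H; elim=> [|p l' IH] l dl ll.
  by rewrite big_nil adde0 lee_fin ltW// H // -[l]cats0.
have [_ p12 _] : [/\ true, p.1 <= p.2 & all (fun p => p.1 <= p.2) l'].
  by move: dl => /andP[]; rewrite all_cat /= => /and3P[].
have al' : {in l', forall q, q.1 <= q.2}.
  by move: dl => /andP[]; rewrite all_cat /= => /and3P[_ _ /allP].
have ge0 : (0 <= \sum_(p <- l') total_variation p.1 p.2 f)%E.
  by rewrite big_seq; apply: sume_ge0 => q /al' ?; exact: total_variation_ge0.
have lens s : itv_partition p.1 p.2 s -> length ((l ++ steps p.1 s) ++ l') = length (l ++ p :: l').
  move=> [_ /eqP ls]; rewrite !length_cat length_steps ls /length big_cons; ring.
have IHs s : itv_partition p.1 p.2 s ->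
    ((increment f l + variation p.1 p.2 f s)%:E + \sum_(p <- l') total_variation p.1 p.2 f <= e%:E)%E.
  move=> ps; rewrite -(increment_steps f ps) -increment_cat; apply: IH.
    exact: disjoint_family_refine dl.
  by rewrite lens.
have [s0 ps0] : exists s, itv_partition p.1 p.2 s.
  move: p12; rewrite le_eqVlt => /orP[/eqP ->|lt]; first by exists [::].
  by exists [:: p.2]; exact: itv_partition1.
have Sfin : (\sum_(p <- l') total_variation p.1 p.2 f)%E \is a fin_num.
  rewrite ge0_fin_numE //; apply: le_lt_trans (ltry e); apply: le_trans (IHs _ ps0).
  rewrite leeDr // lee_fin addr_ge0 ?variation_ge0 //.
  by rewrite /increment sumr_ge0.
rewrite big_cons; move: IHs; rewrite -(fineK Sfin); set S := fine _ => IHs.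
suff : (total_variation p.1 p.2 f <= (e - increment f l - S)%:E)%E.
  move=> le; rewrite addeA -leeBrDr //; rewrite -EFinB addeC -leeBrDr // -EFinB.
  by rewrite addrAC.
apply: ge_ereal_sup => _ [x [s ps <-] <-]; have := IHs _ ps.
by rewrite -EFinD !lee_fin; lra.
Qed.

(** On a piece shorter than [d] the variation is at most 1, and finitely many pieces of length
    [d / 2] cover [0, T]. *)
Lemma ac_bounded_variation f : ac f -> forall T, 0 <= T -> bounded_variation 0 T f.
Proof.
move=> acf T T0; have [d d0 H] := acf 1 ltr01.
have loc a b : a <= b -> b - a < d -> total_variation a b f \is a fin_num.
  move=> ab abd; rewrite ge0_fin_numE ?total_variation_ge0 //.
  have := total_variation_increment H (l' := [:: (a, b)]) (l := [::]) (disjoint_family1 ab).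
  rewrite /length big_seq1 /= /increment big_nil big_seq1 add0e => /(_ abd).
  by move=> /le_lt_trans; apply; exact: ltry.
have step (k : nat) : total_variation 0 (k%:R * (d / 2)) f \is a fin_num.
  elim: k => [|k IH]; first by rewrite mul0r total_variationxx.
  have k0 : 0 <= k%:R * (d / 2) by rewrite mulr_ge0//; lra.
  have kE : k.+1%:R * (d / 2) = k%:R * (d / 2) + d / 2 by rewrite -natr1; ring.
  rewrite kE (@total_variationD _ _ _ (k%:R * (d / 2))) //; last lra.
  by rewrite fin_numD IH loc //; lra.
have [k Tk] : exists k : nat, T <= k%:R * (d / 2).
  exists (Num.bound (T / (d / 2))); rewrite -ler_pdivrMr; last lra.
  by apply/ltW/archi_boundP; rewrite divr_ge0 //; lra.
by apply: (bounded_variationl T0 Tk); apply/bounded_variationP => //; exact: le_trans Tk.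
Qed.

End AbsCont.

(** * Densities of absolutely continuous functions *)

Section AbsContMeasure.
Context {R : realType}.
Implicit Types (f F : R -> R).
Local Notation lam := (@lebesgue_measure R).

(** Half-open dyadic cells: they tile ]0, T], and a Stieltjes measure charges each of them by an
    increment of its distribution function. *)
Let cell (T : R) (k i : nat) : set R := `](i%:R * (T / 2 ^+ k)), (i.+1%:R * (T / 2 ^+ k))]%classic.

Let cell_trivIset T k : 0 < T -> trivIset [set: 'I_(2 ^ k)] (fun i => cell T k i).
Proof.
move=> T0; have q0 : 0 < T / 2 ^+ k by rewrite divr_gt0 // exprn_gt0.
apply/trivIsetP => i j _ _ ij; apply/seteqP; split => // x /=.
rewrite /cell /= !in_itv /= => -[/andP[a b] /andP[c d]].
have : i%:R * (T / 2 ^+ k) < j.+1%:R * (T / 2 ^+ k) by exact: lt_le_trans d.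
have : j%:R * (T / 2 ^+ k) < i.+1%:R * (T / 2 ^+ k) by exact: lt_le_trans b.
rewrite !ltr_pM2r // !ltr_nat !ltnS => ji ij'.
by move: ij; rewrite -val_eqE /= eqn_leq ij' ji.
Qed.

Let cell_ex T k (x : R) : 0 < T -> 0 < x <= T -> exists2 i, (i < 2 ^ k)%N & cell T k i x.
Proof.
move=> T0 /andP[x0 xT]; set q := T / 2 ^+ k.
have q0 : 0 < q by rewrite divr_gt0 // exprn_gt0.
have ex : exists i : nat, x <= i.+1%:R * q.
  exists (Num.bound (x / q)); rewrite -ler_pdivrMr // (le_trans (ltW (archi_boundP _)))//.
    by rewrite divr_ge0 // ltW.
  by rewrite ler_nat.
case: (ex_minnP ex) => i xi mi.
have lo : i%:R * q < x.
  case: i xi mi => [|i] xi mi; first by rewrite mul0r.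
  by rewrite ltNge; apply/negP => /mi; rewrite ltnn.
exists i; last by rewrite /cell /= in_itv /= lo xi.
have : i%:R * q < T by exact: lt_le_trans xT.
rewrite -ltr_pdivlMr // /q invf_div mulrCA divff ?gt_eqF // mulr1.
by rewrite -natrX ltr_nat.
Qed.

Let cell_refine T k i x : 0 < T -> (i < 2 ^ k)%N -> cell T k i x ->
  exists j, [/\ (j < 2 ^ k.+1)%N, cell T k.+1 j x & cell T k.+1 j `<=` cell T k i].
Proof.
move=> T0 ik; rewrite /cell /= in_itv /= => /andP[a b].
have q0 : 0 < T / 2 ^+ k.+1 by rewrite divr_gt0 // exprn_gt0.
have qE : T / 2 ^+ k = 2 * (T / 2 ^+ k.+1).
  by rewrite exprS invfM mulrCA (mulrA 2) divff // mul1r.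
move: a b; rewrite qE; set q := T / _ in q0 *; rewrite -!natr1 => a b.
have E : (2 * i)%:R = 2 * i%:R :> R by rewrite natrM.
have [le|lt] := leP x ((2 * i).+1%:R * q).
- exists (2 * i)%N; split.
  + by rewrite expnS ltn_pmul2l.
  + by rewrite in_itv /= le E; nra.
  + by move=> y /=; rewrite !in_itv /= -!natr1 E => /andP[? ?]; apply/andP; split; nra.
- exists (2 * i).+1; split.
  + by rewrite expnS; lia.
  + by rewrite in_itv /= lt /= -!natr1 E; nra.
  + by move=> y /=; rewrite !in_itv /= -!natr1 E => /andP[? ?]; apply/andP; split; nra.
Qed.

(** A null set is enclosed in an open [U] of measure below [d]. The cells of generation [k] inside
    [U] form a disjoint family shorter than [d], so [nu] gives their union at most [e]; these unions
    increase to a cover of the part of the null set in ]0, T]. *)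
Lemma ac_dominates F T (nu : {finite_measure set (measurableTypeR R) -> \bar R}) :
  0 < T -> ac F ->
  (forall a b, 0 <= a -> a <= b -> b <= T -> nu `]a, b]%classic = (F b - F a)%:E) ->
  nu (~` `]0, T]%classic) = 0%E -> nu `<< lam.
Proof.
move=> T0 acF nuF nu0 A lA B mB BA; have {}lA : lam B = 0%E by exact: lA.
apply/eqP; rewrite eq_le measure_ge0 andbT; apply/lee_addgt0Pr => e e0; rewrite add0e.
have [d d0 Hd] := acF e e0.
have lB : (lam B < +oo)%E by rewrite lA.
have [U [oU BU lU]] := lebesgue_regularity_outer mB lB d0.
have lUd : (lam U < d%:E)%E.
  apply: le_lt_trans lU.
  rewrite -[X in (lam X <= _)%E](setDUK BU) (le_trans (measureU2 _ mB _))//.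
    by apply: measurableD => //; exact: open_measurable.
  by rewrite -[leRHS]add0e leeD2r // -lA.
pose P k (i : 'I_(2 ^ k)) := `[< cell T k i `<=` U >].
pose W k := \big[setU/set0]_(i < 2 ^ k | P k i) cell T k i.
have mcell k i : measurable (cell T k i) by exact: measurable_itv.
have mW k : measurable (W k) by apply: bigsetU_measurable => i _; exact: mcell.
have WE k x : W k x <-> exists i : 'I_(2 ^ k), P k i /\ cell T k i x.
  rewrite /W -bigcup_seq_cond; split.
    by move=> [i /= /andP[_ Pi] cx]; exists i.
  by move=> [i [Pi cx]]; exists i => //=; rewrite mem_index_enum.
have WU k : W k `<=` U by move=> x /WE[i [/asboolP h /h]].
have q0 k : 0 < T / 2 ^+ k by rewrite divr_gt0 // exprn_gt0.
have cT k (i : 'I_(2 ^ k)) : i.+1%:R * (T / 2 ^+ k) <= T.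
  by rewrite mulrA ler_pdivrMr ?exprn_gt0 // mulrC ler_pM2l // -natrX ler_nat.
have nuW k : (nu (W k) <= e%:E)%E.
  pose l := [seq (i%:R * (T / 2 ^+ k), i.+1%:R * (T / 2 ^+ k)) | i : 'I_(2 ^ k) <- index_enum 'I_(2 ^ k) & P k i].
  have dl : disjoint_family l.
    apply/andP; split.
      by apply/allP => p /mapP[i _ ->] /=; rewrite ler_pM2r // ler_nat.
    rewrite pairwise_map.
    have : uniq [seq i <- index_enum 'I_(2 ^ k) | P k i] by rewrite filter_uniq // index_enum_uniq.
    rewrite uniq_pairwise; apply: sub_pairwise => i j /= ij.
    rewrite /nonoverlap /= !ler_pM2r // !ler_nat; move: ij; rewrite -val_eqE /=.
    by rewrite neq_ltn.
  have lW : lam (W k) = (length l)%:E.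
    rewrite /W measure_bigsetU_ord; [|by move=> i; exact: mcell|exact: cell_trivIset].
    rewrite /length big_map big_filter -sumEFin; apply: eq_bigr => i _ /=.
    by rewrite /cell lebesgue_measure_itv /= lte_fin ltr_pM2r // ltr_nat ltnSn.
  have : length l < d.
    rewrite -lte_fin -lW; apply: le_lt_trans lUd; apply: le_measure; last exact: WU.
      by rewrite inE; exact: mW.
    by rewrite inE; exact: open_measurable.
  move=> /(Hd _ dl) /ltW ile; rewrite /W measure_bigsetU_ord; [|by move=> i; exact: mcell|exact: cell_trivIset].
  apply: (@le_trans _ _ (increment F l)%:E); last by rewrite lee_fin.
  rewrite /increment big_map big_filter -sumEFin; apply: lee_sum => i _ /=.
  rewrite nuF ?lee_fin ?ler_norm // ?mulr_ge0 // ?ler_pM2r ?ler_nat //.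
  exact: ltW.
have ndW : nondecreasing_seq W.
  apply/nondecreasing_seqP => k; apply/subsetPset => x /WE[i [/asboolP iU cx]].
  have [j [jk jx jsub]] := cell_refine T0 (ltn_ord i) cx.
  by apply/WE; exists (Ordinal jk); split => //; apply/asboolP; exact: subset_trans iU.
have BW : B `&` `]0, T]%classic `<=` \bigcup_k W k.
  move=> x [Bx /=]; rewrite in_itv /= => xT.
  have /BU Ux := Bx.
  have /nbhs_ballP[r /= r0 rU] : nbhs x U by exact: open_nbhs_nbhs.
  have [k Tk] : exists k : nat, T / 2 ^+ k < r.
    exists (Num.bound (T / r)); rewrite ltr_pdivrMr ?exprn_gt0 // mulrC -ltr_pdivrMr //.
    apply: lt_le_trans (archi_boundP _) _; first by rewrite divr_ge0 // ltW.
    by rewrite -natrX ler_nat ltnW // ltn_expl.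
  have [i ik cx] := cell_ex k T0 xT; exists k => //; apply/WE; exists (Ordinal ik); split => //.
  apply/asboolP => y; move: cx; rewrite /cell /= !in_itv /= -natr1 => /andP[xl xu] /andP[yl yu].
  by apply: rU; rewrite /ball /= ltr_norml; apply/andP; split; lra.
have mWU : measurable (\bigcup_k W k) by exact: bigcupT_measurable.
have cvgW : (nu \o W) @ \oo --> nu (\bigcup_n W n) by exact: nondecreasing_cvg_mu.
apply: (@le_trans _ _ (nu (\bigcup_k W k))); last first.
  by apply: cvge_le cvgW; near=> k; exact: nuW.
have mI : measurable (`]0, T]%classic : set (measurableTypeR R)) by exact: measurable_itv.
have mBI : measurable (B `&` `]0, T]%classic : set (measurableTypeR R)) by exact: measurableI.
have mBD : measurable (B `\` `]0, T]%classic : set (measurableTypeR R)) by exact: measurableD.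
have nuD : nu (B `\` `]0, T]%classic) = 0%E.
  apply/eqP; rewrite eq_le measure_ge0 andbT -nu0; apply: le_measure.
  - by rewrite inE.
  - by rewrite inE; exact: measurableC.
  - by move=> x [].
rewrite -(setUIDK B `]0, T]%classic) (le_trans (measureU2 _ mBI mBD)) //.
rewrite -[leRHS]adde0 leeD //; last by rewrite -nuD.
by apply: le_measure; rewrite ?inE.
Unshelve. all: by end_near. Qed.

Lemma lebesgue_stieltjes_itvoc (Fc : cumulative R R) a b : a <= b ->
  lebesgue_stieltjes_measure Fc `]a, b]%classic = (Fc b - Fc a)%:E.
Proof.
move=> ab; rewrite /lebesgue_stieltjes_measure /measure_extension.
by rewrite measurable_mu_extE; [exact: wlength_itv_bnd|exact: is_ocitv].
Qed.

(** Radon-Nikodym for the Stieltjes measure of [F], restricted to ]0, T] to make it finite. *)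
Lemma ac_nondecreasing_density F T : 0 < T -> ac F -> {homo F : x y / x <= y} ->
  exists h : R -> R, lam.-integrable [set: R] (EFin \o h) /\
    forall a b, 0 <= a -> a <= b -> b <= T ->
      F b - F a = \int[lam]_(x in `]a, b]%classic) h x.
Proof.
move=> T0 acF ndF.
pose Fc : cumulative R R := HB.pack F
  (isCumulative.Build R _ R F ndF (right_continuousW (ac_continuous acF))).
pose nu0 := lebesgue_stieltjes_measure Fc.
have nu0E a b : a <= b -> nu0 `]a, b]%classic = (F b - F a)%:E.
  exact: lebesgue_stieltjes_itvoc.
have mI : measurable (`]0, T]%classic : set (measurableTypeR R)) by exact: measurable_itv.
have nuoo : (nu0 `]0%R, T]%classic < +oo)%E by rewrite nu0E ?ltry // ltW.
pose nu : {finite_measure set (measurableTypeR R) -> \bar R} := mfrestr mI nuoo.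
have nuE a b : 0 <= a -> a <= b -> b <= T -> nu `]a, b]%classic = (F b - F a)%:E.
  move=> a0 ab bT; rewrite /nu /= /mfrestr /mrestr setIidl; first exact: nu0E.
  by move=> x /=; rewrite !in_itv /= => /andP[? ?]; apply/andP; split; lra.
have dom : nu `<< lam.
  apply: (ac_dominates T0 acF nuE); rewrite /nu /= /mfrestr /mrestr setICl.
  exact: measure0.
have [h [h0 hfin inth hE]] := radon_nikodym_sigma_finite dom.
have hK : EFin \o (fine \o h) = h by apply/funext => x /=; rewrite fineK.
exists (fine \o h); rewrite hK; split => // a b a0 ab bT.
rewrite /Rintegral (_ : (fun x => _) = h) // -hE; last exact: measurable_itv.
by rewrite nuE.
Qed.

Definition variation_fun f T (x : R) : R := fine (total_variation 0 (clamp T x) f).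

Section Variation.
Variables (f : R -> R) (T : R).
Hypotheses (T0 : 0 < T) (acf : ac f) (fconst : forall x, f x = f (clamp T x)).
Let TVfin a b : 0 <= a -> a <= b -> b <= T -> total_variation a b f \is a fin_num.
Proof.
move=> a0 ab bT; apply/bounded_variationP => //.
apply: (@bounded_variationr _ 0) => //; apply: (@bounded_variationl _ 0 b T) => //.
  exact: le_trans ab.
by apply: ac_bounded_variation => //; exact: ltW.
Qed.

Let VD x y : x <= y -> variation_fun f T y - variation_fun f T x =
  fine (total_variation (clamp T x) (clamp T y) f).
Proof.
move=> xy; have := clamp_homo T xy.
have /andP[x0 xT] := clamp_itv x (ltW T0); have /andP[y0 yT] := clamp_itv y (ltW T0).
rewrite /variation_fun; move: (clamp T x) (clamp T y) x0 xT y0 yT => a b a0 aT b0 bT ab.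
by rewrite (@total_variationD _ 0 b a) // fineD ?TVfin //; ring.
Qed.

Lemma variation_fun_ge x y : x <= y -> `|f y - f x| <= variation_fun f T y - variation_fun f T x.
Proof.
move=> xy; rewrite VD // (fconst x) (fconst y); have := clamp_homo T xy.
have /andP[x0 xT] := clamp_itv x (ltW T0); have /andP[y0 yT] := clamp_itv y (ltW T0).
move=> ab; rewrite -lee_fin fineK ?TVfin //; exact: total_variation_ge.
Qed.

(** Increments of the variation function are total variations over the clamped intervals, so the
    estimate on refined families applies; [e / 2] restores the strict inequality. *)
Lemma variation_fun_ac : ac (variation_fun f T).
Proof.
move=> e e0; have [d d0 H] := acf (e := e / 2) ltac:(lra); exists d => // l /andP[al pl] ll.
pose l' := [seq (clamp T p.1, clamp T p.2) | p <- l].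
have dl' : disjoint_family l'.
  apply/andP; split.
    by rewrite all_map; apply: sub_all al => p /= ?; exact: clamp_homo.
  rewrite pairwise_map; apply: sub_pairwise pl => p q /=.
  by rewrite /nonoverlap /= => /orP[h|h]; apply/orP; [left|right]; exact: clamp_homo.
have ll' : length l' < d.
  apply: le_lt_trans ll; rewrite /length big_map big_seq [leRHS]big_seq.
  by apply: ler_sum => p /(allP al) /=; exact: clamp_lip.
have := total_variation_increment H (l' := l') (l := [::]) dl' ll'.
rewrite /increment big_nil add0e big_map big_seq => le.
suff : \sum_(p <- l) `|variation_fun f T p.2 - variation_fun f T p.1| <= e / 2 by lra.
rewrite -lee_fin; apply: le_trans le; rewrite -sumEFin big_seq; apply: lee_sum => p /(allP al) p12.
rewrite VD // ger0_norm.
  by rewrite fineK // TVfin ?clamp_homo //; [case/andP: (clamp_itv p.1 (ltW T0))|case/andP: (clamp_itv p.2 (ltW T0))].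
by apply: fine_ge0; apply: total_variation_ge0; exact: clamp_homo.
Qed.

End Variation.

(** Jordan decomposition: [f] is the difference of its variation function [V] and of [V - f], both
    nondecreasing and absolutely continuous. *)
Lemma ac_density f T : 0 < T -> ac f -> (forall x, f x = f (clamp T x)) ->
  exists h : R -> R, lam.-integrable [set: R] (EFin \o h) /\
    forall a b, 0 <= a -> a <= b -> b <= T ->
      f b - f a = \int[lam]_(x in `]a, b]%classic) h x.
Proof.
move=> T0 acf fc; set V := variation_fun f T.
have acV : ac V by exact: variation_fun_ac.
have Vge x y : x <= y -> `|f y - f x| <= V y - V x by exact: variation_fun_ge.
have ndV : {homo V : x y / x <= y}.
  by move=> x y /Vge h; have := normr_ge0 (f y - f x); lra.
pose W x := V x - f x.
have ndW : {homo W : x y / x <= y}.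
  by move=> x y /Vge; rewrite /W ler_norml => /andP[]; lra.
have acW : ac W.
  move=> e e0; have [d1 d10 H1] := acV (e / 2) ltac:(lra); have [d2 d20 H2] := acf (e / 2) ltac:(lra).
  exists (Num.min d1 d2); first by rewrite lt_min d10.
  move=> l dl; rewrite lt_min => /andP[/(H1 _ dl) h1 /(H2 _ dl) h2].
  rewrite (splitr e); apply: le_lt_trans (ltrD h1 h2).
  rewrite /increment -big_split /=; apply: ler_sum => p _; rewrite /W.
  by rewrite (_ : _ - _ = (V p.2 - V p.1) - (f p.2 - f p.1)) ?ler_normB //; ring.
have [h1 [i1 E1]] := ac_nondecreasing_density T0 acV ndV.
have [h2 [i2 E2]] := ac_nondecreasing_density T0 acW ndW.
exists (fun x => h1 x - h2 x); split.
  by rewrite (_ : EFin \o _ = (EFin \o h1) \- (EFin \o h2))%E //; exact: integrableB.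
move=> a b a0 ab bT.
rewrite RintegralB; [|exact: measurable_itv|by apply: integrableS i1|by apply: integrableS i2].
by rewrite -E1 // -E2 // /W; ring.
Qed.

End AbsContMeasure.

Lemma cvg_to_pair (S : Type) (U W : topologicalType) (F : set_system S) (FF : Filter F)
    (f : S -> U) (g : S -> W) (x : U) (y : W) :
  f @ F --> x -> g @ F --> y -> (fun s => (f s, g s)) @ F --> (x, y).
Proof. exact: cvg_pair. Qed.

Lemma continuous_pair (S U W : topologicalType) (f : S -> U) (g : S -> W) s :
  {for s, continuous f} -> {for s, continuous g} ->
  {for s, continuous (fun x => (f x, g x))}.
Proof. exact: cvg_to_pair. Qed.

(** * Euclidean inner product and norm on row vectors *)

Section Euclid.
Context {R : realType} {n : nat}.
Local Notation V := 'rV[R]_n.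
Implicit Types (u v w p : V) (c : R).

Lemma dotvC u v : dotv u v = dotv v u.
Proof. by apply: eq_bigr => i _; rewrite mulrC. Qed.

Lemma dotvDr u v w : dotv u (v + w) = dotv u v + dotv u w.
Proof. by rewrite /dotv -big_split; apply: eq_bigr => i _; rewrite mxE mulrDr. Qed.

Lemma dotvZr c u v : dotv u (c *: v) = c * dotv u v.
Proof. by rewrite /dotv mulr_sumr; apply: eq_bigr => i _; rewrite mxE mulrCA. Qed.

Lemma dotvNr u v : dotv u (- v) = - dotv u v.
Proof. by rewrite -scaleN1r dotvZr mulN1r. Qed.

Lemma dotvBr u v w : dotv u (v - w) = dotv u v - dotv u w.
Proof. by rewrite dotvDr dotvNr. Qed.

Lemma dotvDl u v w : dotv (v + w) u = dotv v u + dotv w u.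
Proof. by rewrite dotvC dotvDr !(dotvC u). Qed.

Lemma dotvZl c u v : dotv (c *: v) u = c * dotv v u.
Proof. by rewrite dotvC dotvZr (dotvC u). Qed.

Lemma dotvNl u v : dotv (- v) u = - dotv v u.
Proof. by rewrite dotvC dotvNr (dotvC u). Qed.

Lemma dotvBl u v w : dotv (v - w) u = dotv v u - dotv w u.
Proof. by rewrite dotvDl dotvNl. Qed.

Lemma dotv0r u : dotv u 0 = 0.
Proof. by rewrite -(scale0r 0) dotvZr mul0r. Qed.

Lemma dotv_ge0 v : 0 <= dotv v v.
Proof. by rewrite sumr_ge0 // => i _; rewrite -expr2 sqr_ge0. Qed.

Lemma enorm_ge0 v : 0 <= enorm v. Proof. exact: sqrtr_ge0. Qed.
Hint Resolve enorm_ge0 : core.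

Lemma enorm_sqr v : enorm v ^+ 2 = dotv v v.
Proof. by rewrite sqr_sqrtr ?dotv_ge0. Qed.

Lemma enorm0 : enorm (0 : V) = 0.
Proof. by rewrite /enorm dotv0r sqrtr0. Qed.

Lemma enormZ c v : enorm (c *: v) = `|c| * enorm v.
Proof. by rewrite /enorm dotvZl dotvZr mulrA -expr2 sqrtrM ?sqr_ge0 // sqrtr_sqr. Qed.

Lemma enormN v : enorm (- v) = enorm v.
Proof. by rewrite -scaleN1r enormZ normrN1 mul1r. Qed.

Lemma enormBC u v : enorm (u - v) = enorm (v - u).
Proof. by rewrite -enormN opprB. Qed.

Lemma coord_le_enorm v i : `|v 0 i| <= enorm v.
Proof.
rewrite -sqrtr_sqr ler_sqrt ?dotv_ge0 // /dotv (bigD1 i) //= -expr2 lerDl.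
by rewrite sumr_ge0 // => j _; rewrite -expr2 sqr_ge0.
Qed.

Lemma enorm_eq0 v : (enorm v == 0) = (v == 0).
Proof.
apply/eqP/eqP => [v0|->]; last exact: enorm0.
apply/rowP => i; rewrite mxE; apply/eqP; rewrite -normr_le0 -v0.
exact: coord_le_enorm.
Qed.

Lemma enorm_gt0 v : v != 0 -> 0 < enorm v.
Proof. by move=> v0; rewrite lt_def enorm_ge0 enorm_eq0 v0. Qed.

Lemma dotv_cauchy u v : `|dotv u v| <= enorm u * enorm v.
Proof.
have [->|v0] := eqVneq v 0; first by rewrite dotv0r normr0 enorm0 mulr0.
have vv : 0 < dotv v v by rewrite -enorm_sqr exprn_gt0 // enorm_gt0.
rewrite -(@ler_pXn2r _ 2) ?nnegrE ?mulr_ge0 // real_normK ?num_real // exprMn !enorm_sqr.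
have := dotv_ge0 (dotv v v *: u - dotv u v *: v).
rewrite dotvBl !dotvBr !dotvZl !dotvZr (dotvC v u) => h.
by rewrite -(ler_pM2r vv) -subr_ge0; apply: le_trans h _; rewrite le_eqVlt; apply/orP; left; apply/eqP; ring.
Qed.

Lemma dotv_le u v : dotv u v <= enorm u * enorm v.
Proof. exact: le_trans (ler_norm _) (dotv_cauchy u v). Qed.

Lemma enormD u v : enorm (u + v) <= enorm u + enorm v.
Proof.
rewrite -(@ler_pXn2r _ 2) ?nnegrE ?addr_ge0 // enorm_sqr dotvDl !dotvDr sqrrD !enorm_sqr (dotvC v u).
by have := dotv_le u v; lra.
Qed.

Lemma enormB u v : enorm (u - v) <= enorm u + enorm v.
Proof. by rewrite -[X in _ <= _ + X]enormN enormD. Qed.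

Lemma enorm_dist v u w : enorm (u - w) <= enorm (u - v) + enorm (v - w).
Proof. by rewrite -(subrKA v) enormD. Qed.

Lemma enorm_subN u v : `|enorm u - enorm v| <= enorm (u - v).
Proof.
rewrite ler_norml; apply/andP; split.
  by have := enormD (v - u) u; rewrite subrK enormBC; lra.
by have := enormD (u - v) v; rewrite subrK; lra.
Qed.

Lemma norm_le_enorm v : `|v| <= enorm v.
Proof.
rewrite /Num.Def.normr /= mx_normrE; apply: bigmax_le => // -[i j] _ /=.
by rewrite ord1 coord_le_enorm.
Qed.

Lemma norm_le_coord v c : 0 <= c -> (forall i, `|v 0 i| <= c) -> `|v| <= c.
Proof.
move=> c0 vc; rewrite /Num.Def.normr /= mx_normrE; apply: bigmax_le => // -[i j] _ /=.
by rewrite ord1 vc.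
Qed.

Lemma coord_le_norm v i : `|v 0 i| <= `|v|.
Proof. by rewrite {2}/Num.Def.normr /= mx_normrE; exact: (le_bigmax _ _ (0, i)). Qed.

Lemma enorm_le_norm v : enorm v <= n%:R * `|v|.
Proof.
have nv : 0 <= n%:R * `|v| by rewrite mulr_ge0.
rewrite -(@ler_pXn2r _ 2) ?nnegrE // enorm_sqr.
have : dotv v v <= \sum_(i < n) `|v| ^+ 2.
  apply: ler_sum => i _; rewrite -expr2 -real_normK ?num_real //.
  by rewrite ler_pXn2r ?nnegrE // coord_le_norm.
rewrite sumr_const card_ord -[_ *+ n]mulr_natl => /le_trans; apply.
have n1 : n%:R <= n%:R ^+ 2 :> R by rewrite -natrX ler_nat; case: (n) => // k; rewrite leq_pmulr.
by rewrite exprMn ler_wpM2r // sqr_ge0.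
Qed.

Lemma nbhs_enormP (x : V) (A : set V) :
  nbhs x A <-> exists2 e, 0 < e & forall y, enorm (y - x) < e -> A y.
Proof.
split=> [/nbhs_ballP[e /= e0 eA]|[e e0 eA]].
  exists e => // y ye; apply: eA; rewrite -ball_normE /= distrC.
  exact: le_lt_trans (norm_le_enorm _) ye.
apply/nbhs_ballP; exists (e / n.+1%:R) => /=; first by rewrite divr_gt0.
move=> y; rewrite -ball_normE /= => yx; apply: eA; rewrite enormBC.
apply: le_lt_trans (enorm_le_norm _) _.
move: yx; rewrite ltr_pdivlMr // -natr1 mulrDr mulr1 => h.
by have := normr_ge0 (x - y); lra.
Qed.

Lemma closure_enormP (A : set V) x :
  closure A x <-> forall e, 0 < e -> exists2 y, A y & enorm (y - x) < e.
Proof.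
split=> [cx e e0|H B /nbhs_enormP[e e0 eB]].
  have [y [Ay ye]] := cx [set y | enorm (y - x) < e] ltac:(by apply/nbhs_enormP; exists e).
  by exists y.
by have [y Ay /eB By] := H e e0; exists y.
Qed.

Lemma continuous_dotv p : continuous (dotv p : V -> R).
Proof.
move=> x; apply/(@cvgrPdist_lt _ _ _ (nbhs x)) => e e0; apply/nbhs_enormP.
exists (e / (enorm p + 1)) => [|y yx]; first by rewrite divr_gt0 // ltr_wpDl.
rewrite -dotvBr; apply: le_lt_trans (dotv_cauchy _ _) _.
rewrite enormBC; move: yx; rewrite ltr_pdivlMr ?ltr_wpDl // mulrC; apply: le_lt_trans.
by rewrite ler_wpM2r // lerDl.
Qed.

Lemma continuous_enorm : continuous (@enorm R n).
Proof.
move=> x; apply/(@cvgrPdist_lt _ _ _ (nbhs x)) => e e0; apply/nbhs_enormP; exists e => // y yx.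
by apply: le_lt_trans (enorm_subN _ _) _; rewrite enormBC.
Qed.

Lemma row_unitvE v : v = \sum_(i < n) v 0 i *: unitv R i.
Proof. by rewrite {1}(row_sum_delta v). Qed.

Lemma dotv_unitv v i : dotv v (unitv R i) = v 0 i.
Proof.
rewrite /dotv (bigD1 i) //= big1 => [|j ji]; rewrite mxE !eqxx ?mulr1 ?addr0 //.
by rewrite (negbTE ji) mulr0.
Qed.

Lemma linear_dotv (f : {linear V -> R}) v : f v = dotv (\row_i f (unitv R i)) v.
Proof.
rewrite {1}(row_unitvE v) linear_sum /dotv; apply: eq_bigr => i _.
by rewrite linearZ mxE mulrC.
Qed.

Lemma linear_le (f : {linear V -> R}) v : `|f v| <= (\sum_i `|f (unitv R i)|) * enorm v.
Proof.
rewrite linear_dotv /dotv mulr_suml; apply: le_trans (ler_norm_sum _ _ _) _.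
by apply: ler_sum => i _; rewrite mxE normrM ler_wpM2l // coord_le_enorm.
Qed.

Lemma diff_grad (f : V -> R) x v : differentiable f x -> 'd f x v = dotv (grad f x) v.
Proof. by move=> df; rewrite (linear_dotv ('d f x)). Qed.

End Euclid.
#[global] Hint Extern 0 (is_true (0 <= enorm _)) => apply: enorm_ge0 : core.

(** * Integrals of functions that agree off a null set *)

Section NullSets.
Context d (T : measurableType d) (R : realType) (mu : {measure set T -> \bar R}).
Local Open Scope ereal_scope.
Import HBNNSimple.

(** The integral of a nonnegative function, measurable or not, is a supremum over the simple
    functions below it, and each of these may be cut to 0 on [N] without changing its integral. *)
Let ge0_le_integral_null (N : set T) (f g : T -> \bar R) : measurable N -> mu N = 0 ->
  (forall x, 0 <= f x) -> (forall x, 0 <= g x) -> (forall x, ~ N x -> f x = g x) ->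
  \int[mu]_x f x <= \int[mu]_x g x.
Proof.
move=> mN N0 f0 g0 fg; rewrite !ge0_integralE // !patch_setT.
apply: ge_ereal_sup => _ [h /= hf <-].
pose h' : {nnsfun T >-> R} := proj_nnsfun h (measurableC mN).
have h'E x : (h' x = h x * (x \in ~` N)%:R)%R by [].
have -> : sintegral mu h = sintegral mu h'.
  rewrite -!integralT_nnsfun; apply: ae_eq_integral => //;
    [exact/measurable_EFinP|exact/measurable_EFinP|].
  exists N; split => // x /= xN; apply: contrapT => Nx; apply: xN => _.
  by have := h'E x; rewrite mem_set // mulr1 => h'x; exact: (congr1 EFin (esym h'x)).
apply: ereal_sup_ubound; exists h' => // x; rewrite h'E; case: (pselect (N x)) => Nx.
  by rewrite memNset ?mulr0 //= => /(_ Nx).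
by rewrite mem_set // mulr1 -fg.
Qed.

Lemma integral_eq_off_null (D N : set T) (f g : T -> \bar R) : measurable N -> mu N = 0 ->
  (forall x, D x -> ~ N x -> f x = g x) ->
  \int[mu]_(x in D) f x = \int[mu]_(x in D) g x.
Proof.
move=> mN N0 fg; rewrite integralE [RHS]integralE.
have E (a b : T -> \bar R) : (forall x, 0 <= a x) -> (forall x, 0 <= b x) ->
    (forall x, D x -> ~ N x -> a x = b x) -> \int[mu]_(x in D) a x = \int[mu]_(x in D) b x.
  move=> a0 b0 ab; rewrite integral_mkcond [RHS]integral_mkcond.
  have p0 (c : T -> \bar R) : (forall x, 0 <= c x) -> forall x, 0 <= (c \_ D) x.
    by move=> c0 x; rewrite patchE; case: ifP.
  have pE x : ~ N x -> (a \_ D) x = (b \_ D) x.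
    by move=> Nx; rewrite !patchE; case: ifPn => // /set_mem Dx; exact: ab.
  apply/eqP; rewrite eq_le; apply/andP; split; apply: (ge0_le_integral_null mN N0); auto.
  by move=> x /pE.
congr (_ - _); apply: E => // x Dx Nx; by rewrite !(funeposE, funenegE) fg.
Qed.

End NullSets.

Lemma is_derive_shift (R : realType) (k : R -> R) (c s l : R) :
  is_derive s 1 (fun x => k x - c) l -> is_derive s 1 k l.
Proof.
move=> D; have -> : k = (fun x => k x - c) + cst c by apply/funext => x; rewrite fctE /= subrK.
by rewrite -[l]addr0; exact: is_deriveD D (is_derive_cst c s 1).
Qed.

(** * Velocities of absolutely continuous curves *)

Section Velocity.
Context {R : realType} {n : nat}.
Local Notation V := 'rV[R]_n.
Local Notation lam := (@lebesgue_measure R).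

Lemma abs_cont_ac T (g : R -> V) i : 0 <= T -> abs_cont_on 0 T g -> ac (fun s => g (clamp T s) 0 i).
Proof.
move=> T0 ag e e0; have [d d0 H] := ag e e0; exists d => // l /andP[/(all_nthP (0, 0)) al pl] ll.
pose s (j : 'I_(size l)) := clamp T (nth (0, 0) l j).1.
pose t (j : 'I_(size l)) := clamp T (nth (0, 0) l j).2.
apply: (@le_lt_trans _ _ (\sum_(j < size l) enorm (g (t j) - g (s j)))).
  rewrite /increment (big_nth (0, 0)) big_mkord; apply: ler_sum => j _.
  by have := coord_le_enorm (g (t j) - g (s j)) i; rewrite !mxE.
apply: H.
- move=> j; have /= := al j (ltn_ord j); rewrite /s /t => h; split.
    by case/andP: (clamp_itv (nth (0, 0) l j).1 T0).
  by split; [exact: clamp_homo|case/andP: (clamp_itv (nth (0, 0) l j).2 T0)].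
- move=> j k jk; have no : nonoverlap (nth (0, 0) l j) (nth (0, 0) l k).
    move: jk; rewrite -val_eqE neq_ltn => /orP[jk|kj].
      by have /(pairwiseP (0, 0)) := pl; apply; rewrite ?inE ?ltn_ord.
    rewrite /nonoverlap orbC; have /(pairwiseP (0, 0)) := pl => /(_ k j).
    by apply; rewrite ?inE ?ltn_ord.
  by case/orP: no => h; [left|right]; exact: clamp_homo.
- apply: le_lt_trans ll; rewrite /length (big_nth (0, 0)) big_mkord.
  by apply: ler_sum => j _; apply: clamp_lip; exact: (al j (ltn_ord j)).
Qed.

(** A representative of the derivative defined everywhere: 0 outside ]0, T[ and on an exceptional
    null set, the true derivative elsewhere. It is integrable and integrates back to [g]. *)
Definition velocity T (g f : R -> V) : Prop :=
  [/\ forall i, lam.-integrable [set: R] (EFin \o (fun s => f s 0 i)),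
      forall i a b, 0 <= a -> a <= b -> b <= T ->
        g b 0 i - g a 0 i = \int[lam]_(s in `[a, b]%classic) f s 0 i,
      (forall s, ~ (0 < s < T) -> f s = 0) &
      exists N : set R, [/\ measurable N, lam N = 0%E,
        forall s, N s -> f s = 0 &
        forall s, ~ N s -> 0 < s < T -> derivable g s 1 /\ derive1 g s = f s]].

(** Each coordinate has a density, which Lebesgue differentiation identifies almost everywhere with
    the derivative; the null sets of the finitely many coordinates are then merged. *)
Lemma abs_cont_velocity T (g : R -> V) : 0 < T -> abs_cont_on 0 T g -> exists f, velocity T g f.
Proof.
move=> T0 ag; have T0' := ltW T0.
have H i : exists h : R -> R, [/\ lam.-integrable [set: R] (EFin \o h),
     forall a b, 0 <= a -> a <= b -> b <= T ->
       g b 0 i - g a 0 i = \int[lam]_(x in `[a, b]%classic) h x &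
     {ae lam, forall s, 0 < s < T -> derivable (fun s => g s 0 i) s 1 /\ derive1 (fun s => g s 0 i) s = h s}].
  have [|h [ih hE]] := ac_density T0 (abs_cont_ac i T0' ag).
    by move=> x; rewrite (clamp_id (clamp_itv _ T0')).
  have E a b : 0 <= a -> a <= b -> b <= T ->
       g b 0 i - g a 0 i = \int[lam]_(x in `[a, b]%classic) h x.
    move=> a0 ab bT; have := hE a b a0 ab bT.
    rewrite !clamp_id ?a0 ?bT ?(le_trans a0 ab) ?(le_trans ab bT) // => ->.
    by rewrite -Rintegral_itv_obnd_cbnd //; apply: integrableS ih.
  exists h; split => //.
  have loc : locally_integrable [set: R] h by exact: open_integrable_locally openT ih.
  have iy y : lam.-integrable [set` Interval (BRight 0) (BRight y)] (EFin \o h).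
    by apply: integrableS ih.
  have := FTC1 iy loc; apply: (@filterS _ _ (ae_filter_ringOfSetsType lam)) => s Fs /andP[s0 sT].
  have [|Fd FE] := Fs; first exact: s0.
  have near_eq : {near s, (fun x => g x 0 i - g 0 0 i) =1
      (fun x => \int[lam]_(t in [set` Interval (BRight 0) (BRight x)]) h t)}.
    near=> x; rewrite Rintegral_itv_obnd_cbnd // -E //; apply: ltW; near: x.
    - exact: lt_nbhsr.
    - exact: lt_nbhsl.
  have d1 : derivable (fun x => g x 0 i - g 0 0 i) s 1.
    by apply: near_eq_derivable Fd => //; apply: filterS near_eq.
  have [d2 dE] : is_derive s 1 (fun x => g x 0 i) (h s).
    apply: (@is_derive_shift _ _ (g 0 0 i)); apply: DeriveDef => //.
    rewrite -FE derive1E; exact: (@near_eq_derive R R R _ _ s 1 near_eq).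
  by split => //; rewrite derive1E.
have [h hP] : exists h : 'I_n -> R -> R, forall i, [/\ lam.-integrable [set: R] (EFin \o h i),
     forall a b, 0 <= a -> a <= b -> b <= T ->
       g b 0 i - g a 0 i = \int[lam]_(x in `[a, b]%classic) h i x &
     {ae lam, forall s, 0 < s < T -> derivable (fun s => g s 0 i) s 1 /\ derive1 (fun s => g s 0 i) s = h i s}].
  by have [h hP] := choice H; exists h.
have [N [mN N0 NP]] : {ae lam, forall s, 0 < s < T -> forall i, derivable (fun s => g s 0 i) s 1 /\ derive1 (fun s => g s 0 i) s = h i s}.
  have : {ae lam, forall s, forall i, 0 < s < T -> derivable (fun s => g s 0 i) s 1 /\ derive1 (fun s => g s 0 i) s = h i s}.
    by apply: (@filter_forall _ _ _ _ (ae_filter_ringOfSetsType lam)) => i; case: (hP i).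
  by apply: (@filterS _ _ (ae_filter_ringOfSetsType lam)) => s hs sT i; exact: hs.
pose f s : V := if (0 < s < T) && (s \notin N) then \row_i h i s else 0.
(* The end points are added because [f] is set to 0 there. *)
pose M := N `|` [set 0; T].
have mM : measurable M.
  by apply: measurableU => //; apply: measurableU; exact: measurable_set1.
have M0 : lam M = 0%E.
  apply: null_set_setU => //; first by apply: measurableU; exact: measurable_set1.
  by apply: null_set_setU; [exact: measurable_set1|exact: measurable_set1|exact: lebesgue_measure_set1|exact: lebesgue_measure_set1].
have fE i s : 0 < s < T -> ~ N s -> f s 0 i = h i s.
  by move=> sT Ns; rewrite /f sT memNset //= mxE.
exists f; split.
- move=> i; have [ih _ _] := hP i.
  have -> : EFin \o (fun s => f s 0 i) = (EFin \o h i) \_ (`]0, T[%classic `\` N).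
    apply/funext => s; rewrite patchE in_setD mem_setE /f /= in_itv /=.
    by case: ifP => _; rewrite mxE.
  have mD : measurable (`]0, T[%classic `\` N : set R) by apply: measurableD => //; exact: measurable_itv.
  by rewrite -integrable_mkcond //; apply: integrableS ih.
- move=> i a b a0 ab bT; have [_ -> // _] := hP i.
  congr fine; apply: (@integral_eq_off_null _ _ _ _ _ M) => // s /=; rewrite in_itv /= => /andP[sa sb] nM.
  rewrite fE //; last by move=> Ns; apply: nM; left.
  rewrite !lt_neqAle (le_trans a0 sa) (le_trans sb bT) !andbT; apply/andP; split; apply/eqP => sE.
    by apply: nM; right; left.
  by apply: nM; right; right.
- by move=> s /negP sT; rewrite /f (negbTE sT).
- exists N; split => //; first by move=> s Ns; rewrite /f (mem_set Ns) andbF.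
  move=> s Ns sT.
  have Hs i : derivable (fun s => g s 0 i) s 1 /\ derive1 (fun s => g s 0 i) s = h i s.
    apply: contrapT => nH; apply: Ns; apply: NP => /= /(_ sT) /(_ i) //.
  have dg : derivable g s 1.
    by apply/derivable_mxP => i j; rewrite ord1; case: (Hs j).
  split => //; rewrite derive1E derive_mx //; apply/rowP => i; rewrite mxE fE //.
  by have [_ <-] := Hs i; rewrite derive1E.
Unshelve. all: by end_near. Qed.

End Velocity.

Section CurveMeasurability.
Context {R : realType} {n : nat}.
Local Notation V := 'rV[R]_n.
Local Notation lam := (@lebesgue_measure R).

Lemma abs_cont_unif T (g : R -> V) : abs_cont_on 0 T g -> forall e, 0 < e ->
  exists2 d, 0 < d & forall s t, 0 <= s <= T -> 0 <= t <= T -> `|s - t| < d -> enorm (g s - g t) < e.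
Proof.
move=> ag e e0; have [d d0 H] := ag e e0; exists d => // s t.
wlog st : s t / t <= s => [W sT tT|/andP[s0 sT] /andP[t0 tT]].
  have [/W|/ltW ts] := leP t s; first exact.
  by rewrite distrC enormBC; exact: W.
rewrite ger0_norm ?subr_ge0 // => std.
have := H 1%N (fun=> t) (fun=> s); rewrite !big_ord1; apply => //.
by move=> i j; rewrite !ord1 eqxx.
Qed.

Lemma continuous_enormP (h : R -> V) s :
  {for s, continuous h} <-> forall e, 0 < e -> exists2 d, 0 < d & forall t, `|t - s| < d -> enorm (h t - h s) < e.
Proof.
split=> [ch e e0|H].
  have : \forall t \near s, enorm (h t - h s) < e.
    by apply: (ch [set y | enorm (y - h s) < e]); apply/nbhs_enormP; exists e.
  move=> /nbhs_ballP[d /= d0 dH]; exists d => // t ts; apply: dH.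
  by rewrite /ball /= distrC.
move=> A /nbhs_enormP[e e0 eA]; have [d d0 dH] := H e e0.
apply/nbhs_ballP; exists d => //= t; rewrite /ball /= distrC => ts.
by apply: eA; exact: dH.
Qed.

Lemma abs_cont_clamp_continuous T (g : R -> V) : 0 <= T -> abs_cont_on 0 T g ->
  continuous (fun s => g (clamp T s)).
Proof.
move=> T0 ag s; apply/continuous_enormP => e e0; have [d d0 H] := abs_cont_unif ag e0.
exists d => // t ts; apply: H; rewrite ?clamp_itv //; apply: le_lt_trans ts.
have [st|/ltW ts] := leP s t.
  by rewrite !ger0_norm ?subr_ge0 ?clamp_homo // clamp_lip.
by rewrite distrC [leRHS]distrC !ger0_norm ?subr_ge0 ?clamp_homo // clamp_lip.
Qed.

Let cvg_quotient (g : R -> V) s : derivable g s 1 ->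
  (k.+1%:R *: (g (k.+1%:R^-1 + s) - g s)) @[k --> \oo] --> derive1 g s.
Proof.
move=> dg; have cv : (h^-1 *: (g (h + s) - g s)) @[h --> 0^'] --> derive1 g s.
  have -> : (fun h : R => h^-1 *: (g (h + s) - g s)) = (fun h : R => h^-1 *: (g (h *: 1 + s) - g s)).
    by apply/funext => h; rewrite [h *: 1]mulr1.
  by rewrite derive1E; exact: dg.
have inv : (k.+1%:R^-1 : R) @[k --> \oo] --> (0 : R)^'.
  move=> A [e /= e0 eA]; suff : \forall k \near \oo, A k.+1%:R^-1 by [].
  near=> k; apply: eA => /=; last by rewrite invr_eq0 pnatr_eq0.
  rewrite sub0r normrN ger0_norm //; near: k; exact: near_infty_natSinv_lt (PosNum e0).
have -> : (fun k : nat => k.+1%:R *: (g (k.+1%:R^-1 + s) - g s)) =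
   (fun h : R => h^-1 *: (g (h + s) - g s)) \o (fun k => k.+1%:R^-1).
  by apply/funext => k /=; rewrite invrK.
exact: cvg_comp inv cv.
Unshelve. all: by end_near. Qed.

(** Off the null set the velocity is the limit of the difference quotients with step 1/(k + 1),
    which are continuous in [s], and continuity of [K] carries the limit over. Elsewhere the
    velocity is 0. *)
Lemma velocity_measurable T (g f : R -> V) (K : V * V -> R) : 0 < T -> abs_cont_on 0 T g ->
  velocity T g f -> (forall s w, {for (g (clamp T s), w), continuous K}) ->
  measurable_fun [set: R] (fun s => K (g (clamp T s), f s)).
Proof.
move=> T0 ag [_ _ f0 [N [mN _ fN fE]]] cK.
have cg := abs_cont_clamp_continuous (ltW T0) ag.
set gc := fun s => g (clamp T s) in cg cK *.
pose D : set R := `]0, T[%classic `\` N.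
have mD : measurable D by apply: measurableD => //; exact: measurable_itv.
have -> : [set: R] = D `|` ~` D by rewrite setUv.
apply/measurable_funU => //; first exact: measurableC.
split; last first.
  have m0 : measurable_fun [set: R] (fun s => K (gc s, 0)).
    apply: continuous_measurable_fun => s.
    apply: (@continuous_comp _ _ _ (fun s => (gc s, 0 : V)) K); last exact: cK.
    by apply: continuous_pair; [exact: cg|exact: cvg_cst].
  apply: (eq_measurable_fun (fun s => K (gc s, 0))); last exact: measurable_funTS.
  move=> s /set_mem nD; have [Ns|Ns] := pselect (N s); first by rewrite fN.
  rewrite f0 // => sT; apply: nD; split => //; by rewrite /= in_itv.
pose q (k : nat) s := k.+1%:R *: (gc (k.+1%:R^-1 + s) - gc s).
have cq k : continuous (q k).
  move=> s; have c1 : {for s, continuous (fun x : R => gc (k.+1%:R^-1 + x))}.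
    apply: (@continuous_comp _ _ _ (fun x : R => k.+1%:R^-1 + x) gc); last exact: cg.
    by apply: cvgD; [exact: cvg_cst|exact: cvg_id].
  exact: cvgZr (cvgB c1 (cg s)).
apply: (@measurable_fun_cvg _ _ _ D (fun k s => K (gc s, q k s))) => [k|s [sT Ns]].
  apply: measurable_funTS; apply: continuous_measurable_fun => s.
  apply: (@continuous_comp _ _ _ (fun s => (gc s, q k s)) K); last exact: cK.
  by apply: continuous_pair; [exact: cg|exact: cq].
have /= := sT; rewrite in_itv /= => sT'.
have Ts : 0 < T - s by rewrite subr_gt0; case/andP: sT'.
have [dg <-] := fE s Ns sT'.
apply: (@cvg_comp _ _ _ (fun k => (gc s, q k s)) K); last exact: cK.
apply: cvg_to_pair; first exact: cvg_cst.
have := cvg_quotient dg; apply: cvg_trans; apply: near_eq_cvg; near=> k.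
rewrite /q /gc !clamp_id //; first by case/andP: sT' => /ltW -> /ltW ->.
have k0 : 0 < k.+1%:R^-1 :> R by rewrite invr_gt0.
suff : k.+1%:R^-1 < T - s by move: k0 sT'; set i := _^-1 => k0 /andP[? ?] ?; apply/andP; split; lra.
by near: k; exact: (near_infty_natSinv_lt (PosNum Ts)).
Unshelve. all: by end_near. Qed.

End CurveMeasurability.

(** * Mean value inequalities along segments *)

Section LineDerivatives.
Context {R : realType}.

Lemma is_derive_line (W Y : normedModType R) (f : W -> Y) (x xi : W) (s : R) :
  differentiable f (x + s *: xi) ->
  is_derive s (1 : R) (fun s => f (x + s *: xi)) ('d f (x + s *: xi) xi).
Proof.
move=> df; have E : (fun h : R => h^-1 *: ((fun s : R => f (x + s *: xi)) (h *: 1 + s) - f (x + s *: xi))) =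
   (fun h : R => h^-1 *: (f (h *: xi + (x + s *: xi)) - f (x + s *: xi))).
  by apply/funext => h; rewrite [h *: 1]mulr1 scalerDl addrCA.
split.
  by rewrite /derivable E; exact: diff_derivable.
by rewrite -(deriveE xi df) /derive E.
Qed.

(** The primitive of the affine bound is subtracted before the mean value theorem is applied, which
    keeps the factor 1/2 of a second order Taylor bound. *)
Lemma mvt_quadratic (f df : R -> R) (a b y0 y1 : R) : f 0 = y0 -> f 1 = y1 ->
  (forall s : R, 0 <= s <= 1 -> is_derive s 1 f (df s)) ->
  (forall s : R, 0 <= s <= 1 -> df s <= a + b * s) -> y1 - y0 <= a + b / 2.
Proof.
move=> <- <- Df le.
pose g s := f s - (a * s + b / 2 * s ^+ 2).
have Dg (s : R) : 0 <= s <= 1 -> is_derive s 1 g (df s - (a + b * s)).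
  move=> s01; have Ds := Df s s01.
  have -> : g = f - (a *: (id : R -> R) + (b / 2) *: ((id : R -> R) ^+ 2)).
    by apply/funext => x; rewrite /g !fctE.
  have Di : is_derive s (1 : R) (id : R -> R) 1 := is_derive_id s 1.
  apply: (is_derive_eq (is_deriveB Ds (is_deriveD (is_deriveZ a Di) (is_deriveZ (b / 2) (is_deriveX 2 Di))))).
  by rewrite /GRing.scale /= !mulr1 expr1; field.
have cg : {within `[0, 1], continuous g}.
  apply: derivable_within_continuous => s; rewrite in_itv /= => s01.
  by have [] := Dg s s01.
have [|c /itvP c01] := @MVT R g (fun s => df s - (a + b * s)) 0 1 ltr01 _ cg.
  by move=> s /itvP s01; apply: Dg; rewrite !s01.
rewrite /g subr0 mulr1 !expr2 => E; have := le c; rewrite !c01 => /(_ isT); lra.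
Qed.

Lemma mvt_le (f df : R -> R) (C y0 y1 : R) : f 0 = y0 -> f 1 = y1 ->
  (forall s : R, 0 <= s <= 1 -> is_derive s 1 f (df s)) ->
  (forall s : R, 0 <= s <= 1 -> df s <= C) -> y1 - y0 <= C.
Proof.
move=> f0 f1 Df le; have := mvt_quadratic (a := C) (b := 0) f0 f1 Df; rewrite mul0r addr0; apply.
by move=> s /le; rewrite mul0r addr0.
Qed.

Lemma line0 (W : lmodType R) (x xi : W) : x + (0 : R) *: xi = x.
Proof. by rewrite scale0r addr0. Qed.

Lemma line1 (W : lmodType R) (x y : W) : x + (1 : R) *: (y - x) = y.
Proof. by rewrite scale1r addrC subrK. Qed.

End LineDerivatives.

Section DotLinear.
Context {R : realType} {n : nat}.
Local Notation V := 'rV[R]_n.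

Lemma dotv_linear (p : V) : linear (dotv p).
Proof. by move=> c u v; rewrite dotvDr dotvZr. Qed.
HB.instance Definition _ (p : V) := GRing.isLinear.Build R V R *%R (dotv p) (dotv_linear p).

Lemma differentiable_dotv (p : V) x : differentiable (dotv p) x.
Proof. by apply: linear_differentiable; exact: continuous_dotv. Qed.

Lemma diff_dotv_comp (W : normedModType R) (f : W -> V) (p : V) x : differentiable f x ->
  differentiable (fun y => dotv p (f y)) x /\
  forall xi, 'd (fun y => dotv p (f y)) x xi = dotv p ('d f x xi).
Proof.
move=> df; have dd : differentiable (dotv p) (f x) by exact: differentiable_dotv.
split; first by apply: (differentiable_comp df dd).
move=> xi; rewrite (_ : (fun y => _) = dotv p \o f) // diff_comp //= diff_lin //.
exact: continuous_dotv.
Qed.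

End DotLinear.

(** * Lagrangian and domain *)

Opaque gradv diff.

Section Lagrangian.
Context {R : realType} {n : nat}.
Local Notation V := 'rV[R]_n.
Variables (U : set V) (L : V -> V -> R) (M mu : R).
Hypothesis LC1 : C1_on [set z : V * V | U z.1] (fun z => L z.1 z.2).
Hypothesis L0 : forall x, U x -> `|L x 0| + enorm (gradx L x 0) + enorm (gradv L x 0) <= M.
Hypothesis mu0 : 0 < mu.
Hypothesis L1 : forall x v, U x ->
     differentiable (fun z : V * V => gradv L z.1 z.2) (x, v) /\
     forall xi : V,
       [/\ enorm xi ^+ 2 / mu <= dotv xi ('d (gradv L x) v xi),
           dotv xi ('d (gradv L x) v xi) <= mu * enorm xi ^+ 2 &
           enorm ('d (fun y => gradv L y v) x xi) <= mu * (1 + enorm v) * enorm xi].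

Let differentiable_fix1 (Y : normedModType R) (f : V * V -> Y) x v :
  differentiable f (x, v) -> differentiable (fun w => f (x, w)) v.
Proof.
by move=> df; apply: (@differentiable_comp _ _ _ _ (fun w => (x, w)) f).
Qed.

Let differentiable_fix2 (Y : normedModType R) (f : V * V -> Y) x v :
  differentiable f (x, v) -> differentiable (fun y => f (y, v)) x.
Proof.
by move=> df; apply: (@differentiable_comp _ _ _ _ (fun y => (y, v)) f).
Qed.

Let L_diff_v x v : U x -> differentiable (L x) v.
Proof. by move=> Ux; have [+ _] := LC1 (x := (x, v)) Ux; move=> /differentiable_fix1. Qed.

Let L_diff_x x v : U x -> differentiable (fun y => L y v) x.
Proof. by move=> Ux; have [+ _] := LC1 (x := (x, v)) Ux; move=> /differentiable_fix2. Qed.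

Lemma L_continuous x v : U x -> {for (x, v), continuous (fun z : V * V => L z.1 z.2)}.
Proof. by move=> Ux; apply: differentiable_continuous; have [] := LC1 (x := (x, v)) Ux. Qed.

Let gradv_line x v xi p s : U x ->
  is_derive s (1 : R) (fun s => dotv p (gradv L x (v + s *: xi)))
    (dotv p ('d (gradv L x) (v + s *: xi) xi)).
Proof.
move=> Ux; have [d _] := L1 (v + s *: xi) Ux.
have d1 := @differentiable_fix1 _ (fun z => gradv L z.1 z.2) _ _ d.
have [d2 E] := diff_dotv_comp p d1; rewrite -[X in is_derive _ _ _ X]E.
exact: (@is_derive_line _ _ _ (fun w => dotv p (gradv L x w))).
Qed.

Let L_line x v xi s : U x ->
  is_derive s (1 : R) (fun s => L x (v + s *: xi)) (dotv (gradv L x (v + s *: xi)) xi).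
Proof.
by move=> Ux; rewrite -diff_grad; [apply: is_derive_line|]; exact: L_diff_v.
Qed.

Let opp_sub_le (a b c : R) : - a - - b <= - c -> b + c <= a.
Proof. lra. Qed.

Let opp_sub_le2 (a b c e : R) : - a - - b <= - c + - e / 2 -> b + c + e / 2 <= a.
Proof. lra. Qed.

Let opp_add_le (a b e s : R) : a + e * s <= b -> - b <= - a + - e * s.
Proof. lra. Qed.

(** The bounds on the second derivative in v are integrated once along the segment. Keeping the
    result linear in [s] lets a second integration give the constants 1/(2 mu) and mu/2. *)
Let gradv_mono x v xi s : U x -> 0 <= s <= 1 ->
  dotv (gradv L x v) xi + enorm xi ^+ 2 / mu * s <= dotv (gradv L x (v + s *: xi)) xi
  <= dotv (gradv L x v) xi + mu * enorm xi ^+ 2 * s.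
Proof.
move=> Ux /andP[s0 s1].
have D t := @gradv_line x v (s *: xi) xi t Ux.
have sc t : dotv xi ('d (gradv L x) (v + t *: (s *: xi)) (s *: xi)) =
    s * dotv xi ('d (gradv L x) (v + t *: (s *: xi)) xi).
  by rewrite linearZ dotvZr.
have B t := (L1 (v + t *: (s *: xi)) Ux).2 xi.
have E0 : dotv xi (gradv L x (v + 0 *: (s *: xi))) = dotv (gradv L x v) xi by rewrite line0 dotvC.
have E1 : dotv xi (gradv L x (v + 1 *: (s *: xi))) = dotv (gradv L x (v + s *: xi)) xi.
  rewrite scale1r dotvC; reflexivity.
apply/andP; split.
- have := mvt_le (f := fun t => - dotv xi (gradv L x (v + t *: (s *: xi)))) (C := - (enorm xi ^+ 2 / mu * s))
    (congr1 -%R E0) (congr1 -%R E1) (fun t _ => is_deriveN (D t)).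
  move=> le; apply: opp_sub_le; apply: le.
  by move=> t _; rewrite sc lerN2 mulrC ler_wpM2l //; have [] := B t.
- rewrite -lerBlDl; apply: (mvt_le E0 E1 (fun t _ => D t)) => t _.
  by rewrite sc mulrC ler_wpM2r //; have [] := B t.
Qed.

Lemma L_taylor_lb x v w : U x ->
  L x v + dotv (gradv L x v) (w - v) + enorm (w - v) ^+ 2 / (2 * mu) <= L x w.
Proof.
move=> Ux; have D t := @L_line x v (w - v) t Ux.
have -> : enorm (w - v) ^+ 2 / (2 * mu) = enorm (w - v) ^+ 2 / mu / 2.
  by rewrite invfM mulrCA mulrC.
apply: opp_sub_le2.
apply: (mvt_quadratic (congr1 (fun z => - L x z) (line0 v (w - v)))
  (congr1 (fun z => - L x z) (line1 v w)) (fun t _ => is_deriveN (D t))) => s s01.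
by have /andP[h _] := gradv_mono v (w - v) Ux s01; exact: opp_add_le.
Qed.

Lemma L_taylor_ub x v w : U x ->
  L x w <= L x v + dotv (gradv L x v) (w - v) + mu / 2 * enorm (w - v) ^+ 2.
Proof.
move=> Ux; have D t := @L_line x v (w - v) t Ux.
have le : L x w - L x v <= dotv (gradv L x v) (w - v) + mu * enorm (w - v) ^+ 2 / 2.
  apply: (mvt_quadratic (congr1 (L x) (line0 v (w - v))) (congr1 (L x) (line1 v w)) (fun t _ => D t)).
  by move=> s s01; have /andP[_ h] := gradv_mono v (w - v) Ux s01.
by move: le; rewrite lerBlDl addrA mulrAC.
Qed.

Let sum3_le (a b c d : R) : 0 <= a -> 0 <= b -> 0 <= c -> a + b + c <= d ->
  [/\ a <= d, b <= d & c <= d].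
Proof. by move=> *; split; lra. Qed.

Let M_ge x : U x -> [/\ `|L x 0| <= M, enorm (gradx L x 0) <= M & enorm (gradv L x 0) <= M].
Proof.
by move=> /L0; apply: sum3_le; [exact: normr_ge0|exact: enorm_ge0|exact: enorm_ge0].
Qed.

Lemma L_coercive x v : U x -> enorm v ^+ 2 / (4 * mu) - (M + M ^+ 2 * mu) <= L x v.
Proof.
move=> Ux; have := L_taylor_lb 0 v Ux; rewrite subr0; apply: le_trans.
have [h1 _ h2] := M_ge Ux.
have h3 : - (M * enorm v) <= dotv (gradv L x 0) v.
  have := dotv_le (gradv L x 0) (- v); rewrite dotvNr enormN => h.
  by rewrite lerNl; apply: le_trans h _; rewrite ler_wpM2r.
move: h1; rewrite ler_norml => /andP[h1 _].
have -> : enorm v ^+ 2 / (2 * mu) = enorm v ^+ 2 / (4 * mu) + enorm v ^+ 2 / (4 * mu) by field; rewrite gt_eqF.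
(* Half of the quadratic term absorbs the linear one; completing the square fixes the additive
   constant. *)
have h4 : M * enorm v <= enorm v ^+ 2 / (4 * mu) + M ^+ 2 * mu.
  rewrite -subr_ge0 (_ : _ - _ = (enorm v / 2 - M * mu) ^+ 2 / mu); last by field; rewrite gt_eqF.
  by rewrite divr_ge0 ?sqr_ge0 // ltW.
lra.
Qed.

Lemma L_upper x v : U x -> L x v <= (2 * M + mu) * (1 + enorm v ^+ 2).
Proof.
move=> Ux; have := L_taylor_ub 0 v Ux; rewrite subr0; move=> /le_trans; apply.
have [h1 _ h2] := M_ge Ux; have v0 := enorm_ge0 v.
have h3 : dotv (gradv L x 0) v <= M * enorm v.
  by apply: le_trans (dotv_le _ _) _; rewrite ler_wpM2r.
have M0 : 0 <= M by apply: le_trans h2.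
have := ler_norm (L x 0); have := sqr_ge0 (enorm v - 1); have := sqr_ge0 (enorm v).
move: mu0 => mu0' *; nra.
Qed.

Definition segment_in (A : set V) (x y : V) := forall l : R, 0 <= l <= 1 -> A (x + l *: (y - x)).

(** Testing against the difference [p] itself reduces a vector-valued increment to the scalar mean
    value inequality. *)
Let gradv_lip x y w : segment_in U x y ->
  enorm (gradv L y w - gradv L x w) <= mu * (1 + enorm w) * enorm (y - x).
Proof.
move=> seg; set p := gradv L y w - gradv L x w.
have [->|p0] := eqVneq p 0; first by rewrite enorm0 !mulr_ge0 ?addr_ge0 // ltW.
rewrite -(ler_pM2l (enorm_gt0 p0)) -expr2 enorm_sqr {2}/p dotvBr.
apply: (mvt_le (f := fun s => dotv p (gradv L (x + s *: (y - x)) w))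
  (df := fun s => dotv p ('d (fun z => gradv L z w) (x + s *: (y - x)) (y - x)))).
- by rewrite line0.
- by rewrite line1.
- move=> s /seg Us; have [d _] := L1 w Us.
  have d1 := @differentiable_fix2 _ (fun z => gradv L z.1 z.2) _ _ d.
  have [d2 E] := diff_dotv_comp p d1; rewrite -[X in is_derive _ _ _ X]E.
  exact: (@is_derive_line _ _ _ (fun z => dotv p (gradv L z w))).
- move=> s /seg Us; apply: le_trans (dotv_le _ _) _; rewrite ler_wpM2l //.
  by have [_ /(_ (y - x)) []] := L1 w Us.
Qed.

(** The x-derivative at velocity 0 bounds the increment of L(., 0). The remainder is recovered by
    integrating in v the increment of D_vL, which the mixed derivative controls; this makes the
    growth in v explicit and quadratic. *)
Let L_lip_x1 x y v : segment_in U x y ->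
  L y v - L x v <= (M + 2 * mu) * (1 + enorm v ^+ 2) * enorm (y - x).
Proof.
move=> seg; have Ux : U x by have := seg 0; rewrite scale0r addr0; apply; rewrite lexx ler01.
have Uy : U y by have := seg 1; rewrite scale1r addrC subrK; apply; rewrite lexx ler01.
have h1 : L y 0 - L x 0 <= M * enorm (y - x).
  apply: (mvt_le (f := fun s => L (x + s *: (y - x)) 0)
    (df := fun s => 'd (fun z => L z 0) (x + s *: (y - x)) (y - x))).
  - by rewrite line0.
  - by rewrite line1.
    by move=> s /seg Us; apply: (@is_derive_line _ _ _ (fun z => L z 0)); exact: L_diff_x.
  move=> s /seg Us; rewrite diff_grad; last exact: L_diff_x.
  apply: le_trans (dotv_le _ _) _; rewrite ler_wpM2r //.
  have [_ h _] := M_ge Us; exact: h.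
have h2 : (L y v - L x v) - (L y 0 - L x 0) <= mu * (1 + enorm v) * enorm (y - x) * enorm v.
  apply: (mvt_le (f := fun s => L y (0 + s *: v) - L x (0 + s *: v))
    (df := fun s => dotv (gradv L y (0 + s *: v)) v - dotv (gradv L x (0 + s *: v)) v)).
  - by rewrite !line0.
  - by rewrite !scale1r !add0r.
    by move=> s _; apply: is_deriveB; exact: L_line.
  move=> s /andP[s0 s1]; rewrite add0r -dotvBl; apply: le_trans (dotv_le _ _) _.
  rewrite ler_wpM2r //; apply: le_trans (gradv_lip _ seg) _.
  rewrite ler_wpM2r // ler_wpM2l ?(ltW mu0) // lerD2l enormZ ger0_norm //.
  by rewrite ler_piMl.
have M0 : 0 <= M by case: (M_ge Ux) => h _ _; exact: le_trans h.
have := enorm_ge0 (y - x); have := enorm_ge0 v; have := sqr_ge0 (enorm v - 1); move: mu0 => mu0'.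
move: (enorm (y - x)) (enorm v) h1 h2 => d e h1 h2 e1 e0 d0.
have : mu * (1 + e) * d * e <= 2 * mu * (1 + e ^+ 2) * d.
  rewrite -subr_ge0 (_ : _ - _ = mu * d * (2 * (1 + e ^+ 2) - (1 + e) * e)); last by ring.
  rewrite mulr_ge0 ?mulr_ge0 ?(ltW mu0) //; nra.
have : M * d <= M * (1 + e ^+ 2) * d by rewrite ler_wpM2r // ler_peMr // lerDl sqr_ge0.
lra.
Qed.

Lemma L_lip_x x y v : segment_in U x y ->
  `|L y v - L x v| <= (M + 2 * mu) * (1 + enorm v ^+ 2) * enorm (y - x).
Proof.
move=> seg; rewrite ler_norml; apply/andP; split; last exact: L_lip_x1.
rewrite lerNl opprB enormBC; apply: L_lip_x1 => l /andP[l0 l1].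
have := seg (1 - l); rewrite (_ : x + _ = y + l *: (x - y)).
  by apply; apply/andP; split; lra.
by apply/rowP => i; rewrite !mxE; ring.
Qed.

Lemma M_ge0 : U !=set0 -> 0 <= M.
Proof. by move=> [x /M_ge[h _ _]]; exact: le_trans h. Qed.

Lemma Ham_ge x p v : U x -> - dotv p v - L x v <= Ham L x p.
Proof.
move=> Ux; apply: ub_le_sup; last by exists v.
exists ((M + M ^+ 2 * mu) + enorm p ^+ 2 * mu) => _ [w _ <-].
have h1 := L_coercive w Ux.
have h2 : - dotv p w <= enorm w ^+ 2 / (4 * mu) + enorm p ^+ 2 * mu.
  rewrite -dotvNl; apply: le_trans (dotv_le _ _) _; rewrite enormN.
  rewrite -subr_ge0 (_ : _ - _ = (enorm w / 2 - enorm p * mu) ^+ 2 / mu); last by field; rewrite gt_eqF.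
  by rewrite divr_ge0 ?sqr_ge0 // ltW.
lra.
Qed.

(** By convexity the tangent of L(x, .) at [v] lies below the graph, so [v] attains the supremum. *)
Lemma Ham_gradv x v : U x -> Ham L x (- gradv L x v) = dotv (gradv L x v) v - L x v.
Proof.
move=> Ux; apply/eqP; rewrite eq_le; apply/andP; split.
  apply: ge_sup; first by exists (- dotv (- gradv L x v) v - L x v), v.
  move=> _ [w _ <-]; have := L_taylor_lb v w Ux.
  have : 0 <= enorm (w - v) ^+ 2 / (2 * mu) by rewrite divr_ge0 ?sqr_ge0 // mulr_ge0 // ltW.
  by rewrite dotvNl opprK dotvBr; lra.
by apply: le_trans (Ham_ge _ v Ux); rewrite dotvNl opprK.
Qed.

(** The unconstrained maximizer for [- gradv L x v] is [v], which is tangent here, so restricting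
    the supremum to tangent vectors does not lower it. *)
Lemma Ham_tau_gradv (nu : V -> V) x v q : U x -> dotv v (nu x) = 0 ->
  (forall w, dotv w (nu x) = 0 -> dotv q w = dotv (- gradv L x v) w) ->
  Ham_tau L nu x q = dotv (gradv L x v) v - L x v.
Proof.
move=> Ux vnu qE; apply/eqP; rewrite eq_le; apply/andP; split.
  apply: ge_sup; first by exists (- dotv q v - L x v), v.
  move=> _ [w /= wnu <-]; rewrite qE //.
  have := Ham_ge (- gradv L x v) w Ux; rewrite Ham_gradv //.
apply: ub_le_sup; last by exists v => //; rewrite qE // dotvNl opprK.
exists (Ham L x (- gradv L x v)) => _ [w /= wnu <-]; rewrite qE //.
exact: Ham_ge.
Qed.

End Lagrangian.

(* Bent chords in a C^2 domain *)
Opaque diff.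

Section Chords.
Context {R : realType} {n : nat}.
Local Notation V := 'rV[R]_n.
Implicit Types (O : set V) (x y z w e : V) (rho : V -> R).

(** The bump vanishes at both ends and has the parabolic profile of the interpolation error of a C^2
    function along the segment. *)
Definition bent_chord y z e (l : R) : V :=
  y + l *: (z - y) + (l * (1 - l) * enorm (z - y) ^+ 2) *: e.

Definition chord_at O x (r : R) e : Prop :=
  forall y z (l : R), closure O y -> closure O z -> enorm (y - x) < r -> enorm (z - x) < r ->
    0 <= l <= 1 -> closure O (bent_chord y z e l).

Let half_le (a b : R) : a - b <= a / 2 -> a / 2 <= b.
Proof. lra. Qed.

Let taylor_rearrange (rp rw d e : R) : - rp - - rw <= - d + e / 2 -> rw + d - e / 2 <= rp.
Proof. lra. Qed.

Let slope_rearrange (a b c e : R) : b - a <= c -> c <= e -> - a <= - b + e.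
Proof. lra. Qed.

Lemma segment_eball x (r : R) y z (l : R) : enorm (y - x) < r -> enorm (z - x) < r -> 0 <= l <= 1 ->
  enorm (y + l *: (z - y) - x) < r.
Proof.
move=> yr zr /andP[l0 l1].
have -> : y + l *: (z - y) - x = (1 - l) *: (y - x) + l *: (z - x).
  by apply/rowP => i; rewrite !mxE; ring.
apply: le_lt_trans (enormD _ _) _; rewrite !enormZ !ger0_norm ?subr_ge0 //.
have [->|ln1] := eqVneq l 1; first by rewrite subrr mul0r add0r mul1r.
have l1' : l < 1 by rewrite lt_neqAle ln1.
have h1 : (1 - l) * enorm (y - x) < (1 - l) * r by rewrite ltr_pM2l // subr_gt0.
have h2 : l * enorm (z - x) <= l * r by rewrite ler_wpM2l // ltW.
lra.
Qed.

Lemma eball_ball x (r : R) y : enorm (y - x) < r -> ball x r y.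
Proof. by move=> h; rewrite -ball_normE /= distrC (le_lt_trans (norm_le_enorm _)). Qed.

Lemma defining_le0 O rho x (r : R) : (forall y, ball x r y -> {for y, continuous rho}) ->
  (forall y, ball x r y -> (O y <-> rho y < 0)) ->
  forall y, closure O y -> enorm (y - x) < r -> rho y <= 0.
Proof.
move=> cr rP y cy yr; rewrite leNgt; apply/negP => ry.
have yb := eball_ball yr.
have n1 : nbhs y [set w | 0 < rho w] by exact: (cr y yb [set t | 0 < t] (lt_nbhsr ry)).
have n2 : nbhs y (ball x r) by apply: open_nbhs_nbhs; split => //; apply: ball_open; exact: le_lt_trans (enorm_ge0 _) yr.
have [w [Ow [/= w1 w2]]] := cy _ (filterI n1 n2).
by have /rP/iffLR/(_ Ow) := w2; rewrite ltNge ltW.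
Qed.

(** Continuity of the second derivatives at the centre bounds them on a smaller ball by their
    central values plus 1; the mean value inequality does the rest. *)
Lemma C2_grad_lip rho x (r : R) : 0 < r -> C2_on (ball x r) rho ->
  exists r' K, [/\ 0 < r', r' <= r, 0 <= K & forall y z, enorm (y - x) < r' -> enorm (z - x) < r' ->
    enorm (grad rho z - grad rho y) <= K * enorm (z - y)].
Proof.
move=> r0 [C1 C2].
have bx : ball x r x by exact: ballxx.
pose B (i j : 'I_n) := `|'d (fun y => 'd rho y (unitv R i)) x (unitv R j)| + 1.
have near_bound : \forall y \near x, forall i j : 'I_n, `|'d (fun y => 'd rho y (unitv R i)) y (unitv R j)| <= B i j.
  apply: (@filter_forall _ _ _ _ (nbhs_filter x)) => i; apply: (@filter_forall _ _ _ _ (nbhs_filter x)) => j.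
  have [_ /(_ (unitv R j)) c] := C2 i x bx.
  have /(@cvgrPdist_lt _ _ _ (nbhs x)) /(_ 1 ltr01) := c; apply: (@filterS _ _ (nbhs_filter x)) => y h.
  rewrite /B; apply: le_trans (_ : _ <= `|'d (fun y => 'd rho y (unitv R i)) x (unitv R j)| + 1) _ => //.
  have := ler_dist_dist ('d (fun y => 'd rho y (unitv R i)) y (unitv R j)) ('d (fun y => 'd rho y (unitv R i)) x (unitv R j)).
  rewrite distrC in h; move=> /le_lt_trans/(_ h); rewrite ltr_norml => /andP[_].
  by rewrite ltrBlDl => /ltW.
have [r1 r10 H] := (nbhs_enormP x _).1 near_bound.
pose K0 := \sum_i \sum_j B i j.
have B0 i j : 0 <= B i j by rewrite /B addr_ge0.
have K00 : 0 <= K0 by rewrite sumr_ge0 // => i _; rewrite sumr_ge0.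
exists (Num.min r1 r), (n%:R * K0); split.
- by rewrite lt_min r10.
- by rewrite ge_min lexx orbT.
- by rewrite mulr_ge0.
move=> y z; rewrite !lt_min => /andP[y1 y2] /andP[z1 z2].
apply: le_trans (enorm_le_norm _) _; rewrite -mulrA ler_wpM2l //.
apply: norm_le_coord => [|i]; first exact: mulr_ge0 K00 (enorm_ge0 _).
rewrite !mxE.
have D (s : R) : 0 <= s <= 1 -> is_derive s (1 : R) (fun s => 'd rho (y + s *: (z - y)) (unitv R i))
    ('d (fun y => 'd rho y (unitv R i)) (y + s *: (z - y)) (z - y)).
  move=> s01; apply: (@is_derive_line _ _ _ (fun y => 'd rho y (unitv R i))).
  by apply: (C2 i _ _).1; apply: eball_ball; exact: segment_eball.
have bd s : 0 <= s <= 1 -> `|'d (fun y => 'd rho y (unitv R i)) (y + s *: (z - y)) (z - y)| <= K0 * enorm (z - y).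
  move=> s01; apply: le_trans (linear_le _ _) _.
  apply: (@le_trans _ _ ((\sum_j B i j) * enorm (z - y))).
    by rewrite ler_wpM2r //; apply: ler_sum => j _; apply: H; exact: segment_eball.
  rewrite ler_wpM2r // /K0 [leRHS](bigD1 i) //= lerDl sumr_ge0 // => k _.
  by rewrite sumr_ge0.
rewrite ler_norml; apply/andP; split.
- rewrite lerNl opprB -[X in X - _]opprK addrC.
  apply: (mvt_le (congr1 (fun p => - 'd rho p (unitv R i)) (line0 y (z - y)))
    (congr1 (fun p => - 'd rho p (unitv R i)) (line1 y z)) (fun s h => is_deriveN (D s h))).
  by move=> s /bd; rewrite ler_norml => /andP[h _]; rewrite lerNl.
- apply: (mvt_le (congr1 (fun p => 'd rho p (unitv R i)) (line0 y (z - y)))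
    (congr1 (fun p => 'd rho p (unitv R i)) (line1 y z)) D).
  by move=> s /bd; rewrite ler_norml => /andP[].
Qed.

Lemma C1_grad_line rho x (r : R) y z : C1_on (ball x r) rho -> enorm (y - x) < r -> enorm (z - x) < r ->
  forall s : R, 0 <= s <= 1 -> is_derive s (1 : R) (fun s => rho (y + s *: (z - y))) (dotv (grad rho (y + s *: (z - y))) (z - y)).
Proof.
move=> C1 yr zr s s01; have [d _] := C1 _ (eball_ball (segment_eball yr zr s01)).
by rewrite -diff_grad //; exact: is_derive_line.
Qed.

(* The correction [e] is a multiple of an inner normal; the second order Taylor bound of the defining function
   shows that a bump of size |y - z|^2 is enough. *)
Lemma local_chord O x : C2_domain O -> closure O x -> exists r e, 0 < r /\ chord_at O x r e.
Proof.
move=> [oO _ bP] cx; have [Ox|nOx] := pselect (O x).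
  have [r r0 rO] := (nbhs_enormP x O).1 (open_nbhs_nbhs (conj oO Ox)).
  exists r, 0; split => // y z l _ _ yr zr l01; apply: subset_closure; apply: rO.
  by rewrite /bent_chord scaler0 addr0; exact: segment_eball.
have [r1 [r10 [rho [C2 rP gr]]]] := bP x (conj cx nOx).
have [r2 [K [r20 r21 K0 lip]]] := C2_grad_lip r10 C2.
have C1 := C2.1.
have le0 : forall y, closure O y -> enorm (y - x) < r1 -> rho y <= 0.
  by apply: (defining_le0 _ rP) => y /C1[d _]; exact: differentiable_continuous.
have bx : ball x r1 x by exact: ballxx.
have xx0 : enorm (x - x) = 0 by rewrite subrr enorm0.
have rx : rho x = 0.
  apply/eqP; rewrite eq_le le0 ?xx0 //= leNgt; apply/negP => /(rP x bx).2 //.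
pose a := grad rho x; have a0 : a != 0 by exact: gr.
pose A := dotv a a; have A0 : 0 < A by rewrite /A -enorm_sqr exprn_gt0 // enorm_gt0.
have na0 := enorm_gt0 a0.
(* In this ball the derivative of [rho] in the direction [a] keeps at least half of its value [A] at
   [x]. *)
pose r3 := Num.min r2 (A / (2 * (K * enorm a + 1))).
have Ka : 0 <= K * enorm a by rewrite mulr_ge0.
have r30 : 0 < r3 by rewrite lt_min r20 divr_gt0 // mulr_gt0 // ltr_wpDl.
have slope y : enorm (y - x) < r3 -> A / 2 <= dotv (grad rho y) a.
  rewrite lt_min => /andP[y2 yA].
  have : dotv (grad rho x - grad rho y) a <= A / 2.
    apply: le_trans (dotv_le _ _) _.
    have := lip y x y2; rewrite xx0 r20 => /(_ isT) h.
    have : enorm (grad rho x - grad rho y) * enorm a <= K * enorm (x - y) * enorm a by rewrite ler_wpM2r.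
    move/le_trans; apply; rewrite enormBC.
    move: yA; rewrite ltr_pdivlMr ?mulr_gt0 ?ltr_wpDl // => yA.
    have := enorm_ge0 (y - x); nra.
  by rewrite dotvBl; exact: half_le.
(* On the straight chord [rho] is at most [K / 2 * q]; with this [c] the bump lowers it by at least
   [q * (K + 1)]. *)
pose c := (2 * K + 2) / A.
have c0 : 0 < c by rewrite divr_gt0 // ltr_wpDl // mulr_ge0.
(* The second bound makes the bump at most [r4] long, so that the bent point stays in the ball of
   radius [r3]. *)
pose r4 := Num.min (r3 / 2) (c * enorm a + 1)^-1.
have ca : 0 <= c * enorm a by rewrite mulr_ge0 // ltW.
have r40 : 0 < r4 by rewrite lt_min divr_gt0 //= invr_gt0 ltr_wpDl.
exists r4, (- c *: a); split => // y z l cy cz yr zr l01; have /andP[l0 l1] := l01.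
set q := l * (1 - l) * enorm (z - y) ^+ 2.
have ll : 0 <= l * (1 - l) by rewrite mulr_ge0 // subr_ge0.
have q0 : 0 <= q by rewrite mulr_ge0 ?sqr_ge0.
have r43 : r4 <= r3 / 2 by rewrite /r4 ge_min lexx.
have r4c : r4 * (c * enorm a) <= 1.
  have : r4 <= (c * enorm a + 1)^-1 by rewrite /r4 ge_min lexx orbT.
  move=> h; have : r4 * (c * enorm a + 1) <= 1 by rewrite -ler_pdivlMr ?ltr_wpDl // div1r.
  by rewrite mulrDr mulr1; apply: le_trans; rewrite lerDl ltW.
have r32 : r3 <= r2 by rewrite /r3 ge_min lexx.
have wr := segment_eball yr zr l01; set w := y + l *: (z - y) in wr.
have yz : enorm (z - y) <= 2 * r4.
  by apply: le_trans (enorm_dist x _ _) _; rewrite (enormBC x); lra.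
have q4 : q * c * enorm a <= r4.
  have l4 : l * (1 - l) <= 1 / 4 by have := sqr_ge0 (2 * l - 1); nra.
  have : q <= r4 ^+ 2.
    rewrite /q; apply: (@le_trans _ _ (1 / 4 * (2 * r4) ^+ 2)).
      by apply: ler_pM => //; rewrite ?sqr_ge0 // ler_pXn2r ?nnegrE // ?mulr_ge0 // ltW.
    by rewrite exprMn; lra.
  move=> h; rewrite -mulrA; apply: le_trans (ler_wpM2r ca h) _.
  by rewrite expr2 -mulrA ger_pMr.
(* Without a bump the point is [y] or [z], possibly on the boundary, where the strict sign obtained
   below would fail. *)
have [q0'|qn0] := eqVneq q 0.
  rewrite /bent_chord -/q q0' scale0r addr0 -/w.
  move: q0' => /eqP; rewrite /q mulf_eq0 mulf_eq0 sqrf_eq0 enorm_eq0 => /orP[/orP[|]|].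
  - by move=> /eqP l00; rewrite /w l00 scale0r addr0.
  - by rewrite subr_eq0 => /eqP l1E; rewrite /w -l1E scale1r addrC subrK.
  - by rewrite subr_eq0 => /eqP zy; rewrite /w zy subrr scaler0 addr0.
have qp : 0 < q by rewrite lt_def qn0.
apply: subset_closure; rewrite /bent_chord -/q -/w.
have E : w + q *: (- c *: a) = w - (q * c) *: a by rewrite scalerA mulrN scaleNr.
have qc0 : 0 <= q * c by apply: mulr_ge0 => //; exact: ltW.
have vr : enorm (w - (q * c) *: a - x) < r3.
  rewrite addrAC; apply: le_lt_trans (enormB _ _) _; rewrite enormZ (ger0_norm qc0).
  by clear -wr q4 r43; move: (enorm _) (enorm _) wr q4 => A1 A2; lra.
rewrite E; have vb := eball_ball (lt_le_trans vr (le_trans r32 r21)); apply: (rP _ vb).2.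
have small p : enorm (p - x) < r4 -> enorm (p - x) < r2.
  by move=> h; apply: lt_le_trans h _; clear -r43 r32 r30; lra.
have r41 p : enorm (p - x) < r4 -> enorm (p - x) < r1.
  by move=> /small h; exact: lt_le_trans r21.
have tay p : enorm (p - x) < r4 -> rho w + dotv (grad rho w) (p - w) - K * enorm (p - w) ^+ 2 / 2 <= rho p.
  move=> pr; have D := C1_grad_line C1 (y := w) (z := p) (r41 _ wr) (r41 _ pr).
  apply: taylor_rearrange.
  apply: (mvt_quadratic (congr1 (fun p => - rho p) (line0 w (p - w)))
    (congr1 (fun p => - rho p) (line1 w p)) (fun s h => is_deriveN (D s h))) => s s01.
  have /andP[s0 s1] := s01; have sb := segment_eball wr pr s01.
  have h : enorm (grad rho (w + s *: (p - w)) - grad rho w) <= K * (s * enorm (p - w)).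
    apply: le_trans (lip _ _ (small _ wr) (small _ sb)) _.
    by rewrite (addrAC w) subrr add0r enormZ ger0_norm.
  have h2 := dotv_le (grad rho w - grad rho (w + s *: (p - w))) (p - w).
  rewrite dotvBl enormBC in h2; apply: slope_rearrange h2 _.
  apply: le_trans (ler_wpM2r (enorm_ge0 _) h) _.
  by rewrite le_eqVlt; apply/orP; left; apply/eqP; ring.
have ty := tay y yr; have tz := tay z zr.
have Ey : y - w = - l *: (z - y) by rewrite /w; apply/rowP => i; rewrite !mxE; ring.
have Ez : z - w = (1 - l) *: (z - y) by rewrite /w; apply/rowP => i; rewrite !mxE; ring.
move: ty tz; rewrite Ey Ez !dotvZr !enormZ !exprMn !real_normK ?num_real // sqrrN => ty tz.
have ry : rho y <= 0 by apply: le0 => //; exact: r41.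
have rz : rho z <= 0 by apply: le0 => //; exact: r41.
(* Convex combination of the Taylor bounds at [y] and [z]: the first order terms cancel. *)
have rw : rho w <= K / 2 * q.
  rewrite /q; move: (dotv _ _) (enorm (z - y) ^+ 2) ty tz => D E2 ty tz.
  have h1 : (1 - l) * (rho w + - l * D - K * (l ^+ 2 * E2) / 2) <= 0.
    by apply: mulr_ge0_le0; rewrite ?subr_ge0 //; exact: le_trans ty ry.
  have h2 : l * (rho w + (1 - l) * D - K * ((1 - l) ^+ 2 * E2) / 2) <= 0.
    by apply: mulr_ge0_le0 => //; exact: le_trans tz rz.
  rewrite -subr_le0 (_ : _ - _ = (1 - l) * (rho w + - l * D - K * (l ^+ 2 * E2) / 2) +
    l * (rho w + (1 - l) * D - K * ((1 - l) ^+ 2 * E2) / 2)); last by field.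
  by rewrite -(addr0 0) lerD.
have D := C1_grad_line C1 (y := w) (z := w - (q * c) *: a) (r41 _ wr) (lt_le_trans vr (le_trans r32 r21)).
have wr3 : enorm (w - x) < r3 by clear -wr r43 r30; lra.
have le : rho (w - (q * c) *: a) - rho w <= - (q * c) * (A / 2).
  apply: (mvt_le (congr1 rho (line0 w (w - (q * c) *: a - w))) (congr1 rho (line1 w (w - (q * c) *: a))) D) => s s01.
  have sb := segment_eball (x := x) (r := r3) (y := w) (z := w - (q * c) *: a) wr3 vr s01.
  have := slope _ sb; rewrite (addrAC w _ (- w)) subrr add0r dotvNr dotvZr => h.
  by rewrite mulNr lerN2 ler_wpM2l // mulr_ge0 // ltW.
have cA : c * A = 2 * K + 2 by rewrite /c mulfVK // gt_eqF.
have E3 : - (q * c) * (A / 2) = - (q * (K + 1)) by rewrite (_ : - (q * c) * (A / 2) = - (q * (c * A) / 2)); [rewrite cA; field|ring].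
rewrite E3 in le; clear -le rw qp K0; move: (rho _) (rho _) le rw => r1 r2 le rw.
nra.
Qed.

End Chords.

(** * Lebesgue integrals over compact intervals *)

Section RealIntegrals.
Context {R : realType}.
Local Notation lam := (@lebesgue_measure R).
Implicit Types (f g : R -> R) (a b c : R).

Definition intble (a b : R) (f : R -> R) : Prop := lam.-integrable `[a, b]%classic (EFin \o f).
Definition rint (a b : R) (f : R -> R) : R := \int[lam]_(s in `[a, b]%classic) f s.

Let mitv a b : measurable (`[a, b]%classic : set R). Proof. exact: measurable_itv. Qed.
Hint Resolve mitv : core.

Lemma intbleS a b a' b' f : a' <= a -> b <= b' -> intble a' b' f -> intble a b f.
Proof.
move=> aa bb; apply: integrableS => // s /=; rewrite !in_itv /= => /andP[? ?].
by apply/andP; split; lra.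
Qed.

Lemma intble_continuous a b f : continuous f -> intble a b f.
Proof.
move=> cf; apply: continuous_compact_integrable; first exact: segment_compact.
exact: continuous_subspaceT.
Qed.

Lemma intble_cst a b c : intble a b (fun=> c).
Proof. by apply: intble_continuous => s; exact: cvg_cst. Qed.

Lemma intbleD a b f g : intble a b f -> intble a b g -> intble a b (fun s => f s + g s).
Proof. by move=> f1 g1; rewrite /intble (_ : EFin \o _ = (EFin \o f) \+ (EFin \o g))%E //; exact: integrableD. Qed.

Lemma intbleZ a b c f : intble a b f -> intble a b (fun s => c * f s).
Proof. by move=> f1; rewrite /intble (_ : EFin \o _ = (fun x => c%:E * (EFin \o f) x))%E //; exact: integrableZl. Qed.

Lemma intbleN a b f : intble a b f -> intble a b (fun s => - f s).
Proof. by move=> /(intbleZ (-1)); under eq_fun do rewrite mulN1r. Qed.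

Lemma intble_le a b f g : measurable_fun [set: R] f -> intble a b g ->
  (forall s, a <= s <= b -> `|f s| <= g s) -> intble a b f.
Proof.
move=> mf ig fg; apply: le_integrable ig => //.
  by apply/measurable_EFinP; exact: measurable_funTS.
move=> s /=; rewrite in_itv /= => sab; rewrite lee_fin (le_trans (fg s sab)) //.
exact: ler_norm.
Qed.

Lemma rintD a b f g : intble a b f -> intble a b g -> rint a b (fun s => f s + g s) = rint a b f + rint a b g.
Proof. by move=> f1 g1; exact: RintegralD. Qed.

Lemma rintZ a b c f : intble a b f -> rint a b (fun s => c * f s) = c * rint a b f.
Proof. by move=> f1; exact: RintegralZl. Qed.

Lemma rintB a b f g : intble a b f -> intble a b g -> rint a b (fun s => f s - g s) = rint a b f - rint a b g.
Proof. by move=> f1 g1; exact: RintegralB. Qed.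

Lemma rint_cst a b c : a <= b -> rint a b (fun=> c) = (b - a) * c.
Proof.
move=> ab; transitivity (c * fine (lam `[a, b]%classic)); first exact: Rintegral_cst.
rewrite lebesgue_measure_itv /= lte_fin mulrC.
by case: ltgtP ab => //= -> _; rewrite subrr !mul0r.
Qed.

Lemma rint_le a b f g : intble a b f -> intble a b g -> (forall s, a <= s <= b -> f s <= g s) ->
  rint a b f <= rint a b g.
Proof. by move=> f1 g1 fg; apply: le_Rintegral => // s /=; rewrite in_itv /=; exact: fg. Qed.

Lemma rint_ge0 a b f : (forall s, a <= s <= b -> 0 <= f s) -> 0 <= rint a b f.
Proof. by move=> fg; apply: Rintegral_ge0 => // s /=; rewrite in_itv /=; exact: fg. Qed.

Lemma rint_split a b c f : a <= b -> b <= c -> intble a c f -> rint a c f = rint a b f + rint b c f.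
Proof.
move=> ab bc fi.
have ibc : lam.-integrable `]b, c]%classic (EFin \o f).
  move: fi; rewrite /intble; apply: integrableS => //.
  by move=> s /=; rewrite !in_itv /= => /andP[? ?]; apply/andP; split; lra.
have := @Rintegral_itvB _ f (BLeft a) (BRight c) b fi.
rewrite !bnd_simp => /(_ ab bc); rewrite (Rintegral_itv_obnd_cbnd ibc) => E.
by rewrite -[rint b c f]E /rint; ring.
Qed.

Lemma rint_sub a b a' b' f : a' <= a -> a <= b -> b <= b' -> intble a' b' f ->
  (forall s, a' <= s <= b' -> 0 <= f s) -> rint a b f <= rint a' b' f.
Proof.
move=> aa ab bb fi f0; rewrite (@rint_split a' a b') //; last exact: le_trans bb.
rewrite (@rint_split a b b') //; last exact: intbleS fi.
have h1 : 0 <= rint a' a f by apply: rint_ge0 => s /andP[? ?]; apply: f0; apply/andP; split; lra.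
have h2 : 0 <= rint b b' f by apply: rint_ge0 => s /andP[? ?]; apply: f0; apply/andP; split; lra.
lra.
Qed.

Lemma intble_glue a b c f : a <= b -> b <= c -> measurable_fun [set: R] f ->
  intble a b f -> intble b c f -> intble a c f.
Proof.
move=> ab bc mf /integrableP[_ f1] /integrableP[_ f2]; apply/integrableP; split.
  by apply/measurable_EFinP; exact: measurable_funTS.
have -> : `[a, c]%classic = `[a, b]%classic `|` `]b, c]%classic :> set R.
  apply/seteqP; split => s /=; rewrite !in_itv /=.
    by move=> /andP[sa sc]; have [sb|bs] := leP s b; [left; rewrite sa|right].
  by case=> /andP[? ?]; apply/andP; split; lra.
have mf' D : measurable_fun D (fun x => `|(EFin \o f) x|)%E.
  apply/measurable_funTS; apply: measurableT_comp => //; exact/measurable_EFinP.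
rewrite ge0_integral_setU //=.
- apply: le_lt_trans (lte_add_pinfty f1 f2); rewrite leeD2l //.
  apply: ge0_subset_integral => //; first exact: mf'.
  by move=> s /=; rewrite !in_itv /= => /andP[? ?]; apply/andP; split; lra.
- exact: mf'.
- apply/disj_setPS => s [/=]; rewrite !in_itv /= => /andP[_ h] /andP[h' _].
  by move: (le_lt_trans h h'); rewrite ltxx.
Qed.

(* Needs no measurability: [derive1] of a curve is only defined almost everywhere. *)
Lemma intble_off_null a b f g N : measurable N -> lam N = 0%E -> measurable_fun [set: R] g ->
  (forall s, a <= s <= b -> ~ N s -> f s = g s) -> intble a b f -> intble a b g.
Proof.
move=> mN N0 mg fg /integrableP[_ fi]; apply/integrableP; split.
  by apply/measurable_EFinP; exact: measurable_funTS.
rewrite (@integral_eq_off_null _ _ _ _ _ N _ (fun s => `|(EFin \o f) s|%E)) // => s /=.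
by rewrite in_itv /= => sab Ns; rewrite fg.
Qed.

Lemma rint_off_null a b f g N : measurable N -> lam N = 0%E ->
  (forall s, a <= s <= b -> ~ N s -> f s = g s) -> rint a b f = rint a b g.
Proof.
move=> mN N0 fg; congr fine; apply: (integral_eq_off_null mN N0) => s /=.
by rewrite in_itv /= => sab Ns; rewrite fg.
Qed.

Lemma rint_le_off_null a b f g N : measurable N -> lam N = 0%E -> intble a b f -> intble a b g ->
  (forall s, a <= s <= b -> ~ N s -> f s <= g s) -> rint a b f <= rint a b g.
Proof.
move=> mN N0 fi gi fg; rewrite -subr_ge0 -rintB //.
rewrite (@rint_off_null a b _ (fun s => `|g s - f s|) N) //; first by apply: rint_ge0 => s _; exact: normr_ge0.
by move=> s sab Ns; rewrite ger0_norm // subr_ge0; exact: fg.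
Qed.

(** The negative part is dominated by a constant. Were the integral of the positive part infinite,
    the difference would be [+oo], against the hypothesis. *)
Lemma intble_pos_part a b f C : measurable_fun [set: R] f -> (forall s, a <= s <= b -> - C <= f s) ->
  (\int[lam]_(s in `[a, b]%classic) (f s)%:E < +oo)%E -> intble a b f.
Proof.
move=> mf fC foo.
have mE D : measurable_fun D (EFin \o f) by apply/measurable_EFinP; exact: measurable_funTS.
have negle : (\int[lam]_(s in `[a, b]%classic) ((EFin \o f)^\- s) < +oo)%E.
  have /integrableP[_ Coo] := intble_cst a b C.
  apply: le_lt_trans Coo; apply: ge0_le_integral => //; first by apply: measurable_funeneg; exact: mE.
  move=> s /=; rewrite in_itv /= => sab; rewrite funenegE ge_max.
  by apply/andP; split; rewrite lee_fin //; have := fC s sab; have := ler_norm C; lra.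
apply/integrableP; split; first exact: mE.
have posle : (\int[lam]_(s in `[a, b]%classic) ((EFin \o f)^\+ s) < +oo)%E.
  rewrite ltey; apply/eqP => pE; move: foo; rewrite integralE /= -[X in (X - _)%E]/(\int[lam]_(s in `[a, b]%classic) ((EFin \o f)^\+ s))%E pE.
  rewrite -[X in (_ - X)%E]/(\int[lam]_(s in `[a, b]%classic) ((EFin \o f)^\- s))%E.
  have : (\int[lam]_(s in `[a, b]%classic) ((EFin \o f)^\- s))%E \is a fin_num.
    by rewrite ge0_fin_numE //; apply: integral_ge0.
  by move=> /fineK <-.
apply: (@le_lt_trans _ _ (\int[lam]_(s in `[a, b]%classic) ((EFin \o f)^\+ s + (EFin \o f)^\- s)%E)%E).
  rewrite le_eqVlt; apply/orP; left; apply/eqP; apply: eq_integral => s _.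
  by have /(congr1 (fun h => h s)) := fune_abse (EFin \o f).
rewrite ge0_integralD //; first exact: lte_add_pinfty.
- by apply: measurable_funepos; exact: mE.
- by apply: measurable_funeneg; exact: mE.
Qed.

End RealIntegrals.

(** * Dynamic programming *)

Record setting (R : realType) (n : nat) (O U : set 'rV[R]_n) (T : R)
    (L : 'rV[R]_n -> 'rV[R]_n -> R) (F G : 'rV[R]_n -> Prob R n -> R)
    (kappa M mu : R) (u : R -> 'rV[R]_n -> R) (m : R -> Prob R n) : Prop := Setting {
  T_gt0 : 0 < T;
  domO : C2_domain O;
  openU : open U;
  OU : closure O `<=` U;
  F_d1 : forall x, U x -> forall m1 m2, inP O m1 -> inP O m2 ->
     `|F x m1 - F x m2| <= kappa * d1 O m1 m2;
  F_C1 : forall m1, inP O m1 -> C1b_on U (fun x => F x m1) /\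
     forall x, U x -> enorm (grad (fun y => F y m1) x) <= kappa;
  G_bnd : exists C, forall x, U x -> `|G x (m T)| <= C;
  L_C1 : C1_on [set z : 'rV[R]_n * 'rV[R]_n | U z.1] (fun z => L z.1 z.2);
  L_0 : forall x, U x -> `|L x 0| + enorm (gradx L x 0) + enorm (gradv L x 0) <= M;
  mu_gt0 : 0 < mu;
  L_1 : forall x v, U x ->
     differentiable (fun z : 'rV[R]_n * 'rV[R]_n => gradv L z.1 z.2) (x, v) /\
     forall xi : 'rV[R]_n,
       [/\ enorm xi ^+ 2 / mu <= dotv xi ('d (gradv L x) v xi),
           dotv xi ('d (gradv L x) v xi) <= mu * enorm xi ^+ 2 &
           enorm ('d (fun y => gradv L y v) x xi) <= mu * (1 + enorm v) * enorm xi];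
  u_cont : {within [set z : R * 'rV[R]_n | 0 <= z.1 <= T /\ closure O z.2],
        continuous (fun z : R * 'rV[R]_n => u z.1 z.2)};
  m_inP : forall t, 0 <= t <= T -> inP O (m t);
  m_cont : forall t, 0 <= t <= T -> forall e, 0 < e -> exists2 d, 0 < d &
          forall s, 0 <= s <= T -> `|s - t| < d -> d1 O (m s) (m t) < e;
  u_value : forall t x, 0 <= t <= T -> closure O x -> (u t x)%:E = value O L F G m T t x }.

Section Coupling.
Context {R : realType} {n : nat}.
Local Notation V := 'rV[R]_n.
Variables (O U : set V) (T : R) (L : V -> V -> R) (F G : V -> Prob R n -> R)
  (kappa M mu : R) (u : R -> V -> R) (m : R -> Prob R n).
Hypothesis S : setting O U T L F G kappa M mu u m.

Lemma closure_nonempty : closure O !=set0.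
Proof.
have h0 : 0 <= (0 : R) <= T by rewrite lexx (ltW (T_gt0 S)).
apply/set0P/eqP => c0; have := m_inP S h0; rewrite /inP c0 measure0 => /eqP.
by rewrite eq_sym onee_eq0.
Qed.

Lemma kappa_ge0 : 0 <= kappa.
Proof.
have [x cx] := closure_nonempty; have h0 : 0 <= (0 : R) <= T by rewrite lexx (ltW (T_gt0 S)).
have [_ h] := F_C1 S (m_inP S h0); exact: le_trans (enorm_ge0 _) (h x (OU S cx)).
Qed.

Lemma F_lip x y t : 0 <= t <= T -> segment_in U x y ->
  `|F y (m t) - F x (m t)| <= kappa * enorm (y - x).
Proof.
move=> tT seg; have [[C1 _ _] gb] := F_C1 S (m_inP S tT).
have D s : 0 <= s <= 1 -> is_derive (s : R) (1 : R) (fun s => F (x + s *: (y - x)) (m t))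
   (dotv (grad (fun z => F z (m t)) (x + s *: (y - x))) (y - x)).
  move=> /seg Us; have [d _] := C1 _ Us; rewrite -diff_grad //.
  exact: (@is_derive_line _ _ _ (fun z => F z (m t))).
rewrite ler_norml; apply/andP; split.
- rewrite lerNl opprB -[X in X - _]opprK addrC.
  apply: (mvt_le (congr1 (fun p => - F p (m t)) (line0 x (y - x)))
    (congr1 (fun p => - F p (m t)) (line1 x y)) (fun s h => is_deriveN (D s h))) => s /seg Us.
  rewrite -dotvNr; apply: le_trans (dotv_le _ _) _; rewrite enormN ler_wpM2r //.
  exact: gb.
- apply: (mvt_le (congr1 (fun p => F p (m t)) (line0 x (y - x)))
    (congr1 (fun p => F p (m t)) (line1 x y)) D) => s /seg Us.
  by apply: le_trans (dotv_le _ _) _; rewrite ler_wpM2r //; exact: gb.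
Qed.

Lemma F_time t : 0 <= t <= T -> forall e, 0 < e -> exists2 d, 0 < d &
  forall s x, 0 <= s <= T -> `|s - t| < d -> U x -> `|F x (m s) - F x (m t)| < e.
Proof.
move=> tT e e0; have k1 : 0 < kappa + 1 by rewrite ltr_wpDl // kappa_ge0.
have [d d0 H] := m_cont S tT (divr_gt0 e0 k1); exists d => // s x sT st Ux.
have := F_d1 S Ux (m_inP S sT) (m_inP S tT) => /le_lt_trans; apply.
have := H s sT st; rewrite ltr_pdivlMr // => h; apply: le_lt_trans h.
(* The defining set contains 0. If it has no supremum, [sup] takes its default value 0, so [d1] is
   nonnegative in either case. *)
have d1ge : 0 <= d1 O (m s) (m t).
  have := normr_ge0 (F x (m s) - F x (m t)) => h1.
  rewrite /d1; set A := [set r | _].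
  have A0 : A 0.
    exists (fun=> 0); split; first by move=> *; rewrite subrr normr0.
    by rewrite !integral0 subrr.
  have [sA|nsA] := pselect (has_sup A); first exact: ub_le_sup sA.2 _ A0.
  by rewrite sup_out.
by rewrite mulrDr mulr1 mulrC lerDl.
Qed.

(** At each time F is bounded in x, and continuity in time propagates the bound to nearby times;
    compactness of [0, T] selects one bound for all. *)
Lemma F_bound : exists C, forall x t, closure O x -> 0 <= t <= T -> `|F x (m t)| <= C.
Proof.
have h0 : 0 <= (0 : R) <= T by rewrite lexx (ltW (T_gt0 S)).
have [[_ [C0 HC0] _] _] := F_C1 S (m_inP S h0).
pose P (B s : R) := 0 <= s <= T -> forall x, closure O x -> `|F x (m s)| <= B.
have cT : compact (`[0, T]%classic : set R) by exact: segment_compact.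
have ev : \forall B \near +oo, `[0, T]%classic `<=` P B.
  apply: ((compact_near_coveringP _).1 cT) => s /=; rewrite in_itv /= => sT.
  have [d d0 Hd] := F_time sT ltr01.
  have [[_ [C HC] _] _] := F_C1 S (m_inP S sT).
  exists (ball s d, [set B | C + 1 <= B]) => /=.
    by split; [exact: nbhsx_ballx|exact: nbhs_pinfty_ge (num_real _)].
  move=> [s' B] /= [s's CB] s'T x cx; have Ux := OU S cx.
  have := Hd s' x s'T; rewrite distrC => /(_ s's Ux) h.
  have hC := HC x Ux; have tr := ler_normD (F x (m s') - F x (m s)) (F x (m s)).
  rewrite subrK in tr; apply: le_trans tr _; apply: le_trans CB.
  by rewrite addrC lerD // ltW.
near (pinfty_nbhs R) => B.
have /= H : `[0, T]%classic `<=` P B by near: B.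
by exists B => x t cx tT; apply: H => //=; rewrite in_itv.
Unshelve. all: by end_near. Qed.

Lemma closure_ball_U x : closure O x -> exists2 r, 0 < r & forall y, enorm (y - x) < r -> U y.
Proof.
move=> cx; apply/nbhs_enormP; apply: open_nbhs_nbhs; split; first exact: openU S.
exact: OU S _ cx.
Qed.

Lemma segment_in_eball (x : V) r y z : (forall y, enorm (y - x) < r -> U y) ->
  enorm (y - x) < r -> enorm (z - x) < r -> segment_in U y z.
Proof. by move=> H yr zr l l01; apply: H; exact: segment_eball. Qed.

(** State and measure are varied one after the other: first the state, along a short segment inside
    [U], then the measure, with a modulus uniform in the state. *)
Lemma F_curve_continuous g : Gamma O T g ->
  continuous (fun s => F (g (clamp T s)) (m (clamp T s))).
Proof.
move=> [ag cg] s; have T0 := ltW (T_gt0 S).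
have cs := clamp_itv s T0; have csx := cg _ cs.
have [r r0 rU] := closure_ball_U csx.
apply/cvgrPdist_lt => e e0.
have k1 : 0 < kappa + 1 by rewrite ltr_wpDl // kappa_ge0.
have e2 : 0 < e / 2 by rewrite divr_gt0.
have [d3 d30 H1] := F_time cs e2.
have rr : 0 < Num.min r (e / 2 / (kappa + 1)) by rewrite lt_min r0 divr_gt0.
have cgs : {for s, continuous (fun s => g (clamp T s))} by apply: (abs_cont_clamp_continuous T0 ag).
have [d2 d20 H2] := (continuous_enormP _ _).1 cgs _ rr.
near=> t; have ct := clamp_itv t T0.
have clip : `|clamp T t - clamp T s| <= `|t - s|.
  have [st|/ltW ts] := leP s t.
    by rewrite !ger0_norm ?subr_ge0 ?clamp_homo // clamp_lip.
  by rewrite distrC [leRHS]distrC !ger0_norm ?subr_ge0 ?clamp_homo // clamp_lip.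
have td1 : `|t - s| < d3 by near: t; apply/nbhs_ballP; exists d3 => //= t; rewrite /ball /= distrC.
have td2 : `|t - s| < d2 by near: t; apply/nbhs_ballP; exists d2 => //= t; rewrite /ball /= distrC.
have := H2 t td2; rewrite lt_min => /andP[h1 h2].
have seg : segment_in U (g (clamp T s)) (g (clamp T t)).
  by apply: (segment_in_eball rU) => //; rewrite subrr enorm0.
have a1 := F_lip ct seg.
have a2 := H1 _ (g (clamp T s)) ct (le_lt_trans clip td1) (OU S csx).
rewrite distrC -(subrKA (F (g (clamp T s)) (m (clamp T t)))) (splitr e).
apply: le_lt_trans (ler_normD _ _) _; apply: ler_ltD a2.
apply: le_trans a1 _; move: h2; rewrite ltr_pdivlMr // mulrDr mulr1 => h2.
apply: le_trans (ltW h2); rewrite mulrC lerDl //.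
Unshelve. all: by end_near. Qed.

End Coupling.

(** * Running cost, concatenation of curves and optimality *)

Section DynamicProgramming.
Context {R : realType} {n : nat}.
Local Notation V := 'rV[R]_n.
Local Notation lam := (@lebesgue_measure R).
Variables (O U : set V) (T : R) (L : V -> V -> R) (F G : V -> Prob R n -> R)
  (kappa M mu : R) (u : R -> V -> R) (m : R -> Prob R n).
Hypothesis S : setting O U T L F G kappa M mu u m.
Let T0 := T_gt0 S.
Let T0' := ltW (T_gt0 S).

(** The running cost made total: [clamp] and the everywhere defined velocity turn it into a function
    on the whole line, measurable when [g] is in [Gamma] and [f] is its velocity. *)
Definition run (g f : R -> V) (s : R) : R :=
  L (g (clamp T s)) (f s) + F (g (clamp T s)) (m (clamp T s)).

Lemma Gamma_clamp g s : Gamma O T g -> closure O (g (clamp T s)).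
Proof. by move=> [_ cg]; apply: cg; exact: clamp_itv. Qed.

Lemma run_measurable g f : Gamma O T g -> velocity T g f -> measurable_fun [set: R] (run g f).
Proof.
move=> Gg vf; have [ag cg] := Gg; apply: measurable_funD.
  apply: (@velocity_measurable _ _ T g f (fun z : V * V => L z.1 z.2)) => // s w.
  exact: (L_continuous (L_C1 S) (OU S (@Gamma_clamp g s Gg))).
apply: continuous_measurable_fun; exact: (F_curve_continuous S Gg).
Qed.

Lemma cost_run g f t : Gamma O T g -> velocity T g f -> 0 <= t ->
  cost L F G m T t g =
  (\int[lam]_(s in `[t, T]%classic) (run g f s)%:E + (G (g T) (m T))%:E)%E.
Proof.
move=> _ [_ _ _ [N [mN N0 _ fE]]] t0; congr (_ + _)%E.
pose N' := N `|` [set 0; T].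
have mN' : measurable N'.
  by apply: measurableU => //; apply: measurableU; exact: measurable_set1.
have N'0 : lam N' = 0%E.
  apply: null_set_setU => //; first by apply: measurableU; exact: measurable_set1.
  by apply: null_set_setU; [exact: measurable_set1|exact: measurable_set1|exact: lebesgue_measure_set1|exact: lebesgue_measure_set1].
apply: (@integral_eq_off_null _ _ _ lam _ N') => // s /=; rewrite in_itv /= => /andP[ts sT] nN.
have s0 : 0 <= s by exact: le_trans ts.
have s0T : 0 < s < T.
  by rewrite !lt_neqAle s0 sT !andbT; apply/andP; split; apply/eqP => sE; apply: nN; right; [left|right].
have [_ dE] := fE s (fun h => nN (or_introl h)) s0T.
by rewrite /run clamp_id ?s0 ?sT // dE.
Qed.

(** Bounded below, the running cost of a curve of finite cost is integrable; the quadratic term then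
    controls its energy. *)
Lemma run_lb : exists2 C, 0 <= C & forall g f s, Gamma O T g ->
  enorm (f s) ^+ 2 / (4 * mu) - C <= run g f s.
Proof.
have [CF HF] := F_bound S.
have M0 : 0 <= M by apply: (M_ge0 (L_0 S)); have [x /(OU S) Ux] := closure_nonempty S; exists x.
have CF0 : 0 <= CF.
  have [x cx] := closure_nonempty S.
  by apply: le_trans (HF x 0 cx _) => //; rewrite lexx.
exists (M + M ^+ 2 * mu + CF).
  by rewrite !addr_ge0 // mulr_ge0 ?sqr_ge0 // ltW // (mu_gt0 S).
move=> g f s Gg; have cx := @Gamma_clamp g s Gg.
have h1 := L_coercive (L_C1 S) (L_0 S) (mu_gt0 S) (L_1 S) (f s) (OU S cx).
have := HF _ _ cx (clamp_itv s T0'); rewrite ler_norml => /andP[h2 _].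
rewrite /run opprD addrA; exact: lerD.
Qed.

Lemma run_bounded_intble g f K a b : Gamma O T g -> velocity T g f ->
  (forall s, enorm (f s) <= K) -> intble a b (run g f).
Proof.
move=> Gg vf fK; have [CF HF] := F_bound S; have [C C0 HC] := run_lb.
have M0 : 0 <= M by apply: (M_ge0 (L_0 S)); have [x /(OU S) Ux] := closure_nonempty S; exists x.
have K0 : 0 <= K by exact: le_trans (fK 0).
pose B := (2 * M + mu) * (1 + K ^+ 2) + CF.
have mu0 := ltW (mu_gt0 S).
have CF0 : 0 <= CF.
  have [x cx] := closure_nonempty S.
  by apply: le_trans (HF x 0 cx _) => //; rewrite lexx.
have B0 : 0 <= B by rewrite /B addr_ge0 // mulr_ge0 // ?addr_ge0 ?mulr_ge0 ?sqr_ge0.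
apply: (@intble_le _ _ _ _ (fun=> B + C)); [exact: run_measurable|exact: intble_cst|].
move=> s _; rewrite ler_norml; apply/andP; split.
  apply: le_trans (HC g f s Gg); rewrite opprD lerD2r.
  by rewrite (@le_trans _ _ 0) ?oppr_le0 // divr_ge0 ?sqr_ge0 // mulr_ge0.
have cx := @Gamma_clamp g s Gg.
have h1 := L_upper (L_C1 S) (L_0 S) (mu_gt0 S) (L_1 S) (f s) (OU S cx).
have h2 := le_trans (ler_norm _) (HF _ _ cx (clamp_itv s T0')).
apply: (@le_trans _ _ B); last by rewrite lerDl.
rewrite /run /B lerD //; apply: le_trans h1 _; rewrite ler_wpM2l ?addr_ge0 ?mulr_ge0 //.
by rewrite lerD2l ler_pXn2r ?nnegrE.
Qed.

Lemma cost_lt_intble g f t : Gamma O T g -> velocity T g f -> 0 <= t ->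
  (cost L F G m T t g < +oo)%E -> intble t T (run g f).
Proof.
move=> Gg vf t0; rewrite (cost_run Gg vf t0) => coo; have [C C0 HC] := run_lb.
apply: (@intble_pos_part _ _ _ _ C); first exact: run_measurable.
  move=> s _; apply: le_trans (HC g f s Gg); rewrite lerBrDr addrC subrr.
  by rewrite divr_ge0 ?sqr_ge0 // mulr_ge0 // ltW // (mu_gt0 S).
by move: coo; case: (integral _ _ _) => [r _||_] //; rewrite ?ltry.
Qed.

Lemma cost_rint g f t : Gamma O T g -> velocity T g f -> 0 <= t -> intble t T (run g f) ->
  cost L F G m T t g = (rint t T (run g f) + G (g T) (m T))%:E.
Proof.
move=> Gg vf t0 ir; rewrite (cost_run Gg vf t0) EFinD; congr (_ + _)%E.
by rewrite /rint /Rintegral fineK //; apply: integrable_fin_num ir; exact: measurable_itv.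
Qed.

Lemma u_le_cost g t : Gamma O T g -> 0 <= t <= T -> ((u t (g t))%:E <= cost L F G m T t g)%E.
Proof.
move=> Gg tT; rewrite (u_value S tT); last by have [_ cg] := Gg; exact: cg.
by apply: ereal_inf_lbound; exists g.
Qed.

(** Curves optimal up to [e] come from the infimum, which is finite because [u] is real-valued;
    their cost is then a genuine integral. *)
Lemma u_near t x e : 0 <= t <= T -> closure O x -> 0 < e -> exists g f,
  [/\ Gamma O T g, velocity T g f, g t = x, intble t T (run g f) &
      rint t T (run g f) + G (g T) (m T) <= u t x + e].
Proof.
move=> tT cx e0; have uE := u_value S tT cx.
have fin : value O L F G m T t x \is a fin_num by rewrite -uE.
have [_ [g [Gg gx] <-] lt] := lb_ereal_inf_adherent e0 fin.
have [f vf] := abs_cont_velocity T0 Gg.1.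
have t0 : 0 <= t by case/andP: tT.
have ir : intble t T (run g f).
  by apply: cost_lt_intble => //; apply: lt_trans lt _; rewrite -/(value O L F G m T t x) -uE -EFinD ltry.
exists g, f; split => //.
move: lt; rewrite (cost_rint Gg vf t0 ir) -/(value O L F G m T t x) -uE -EFinD lte_fin.
exact: ltW.
Qed.

Lemma Gamma_cst x : closure O x -> Gamma O T (fun=> x).
Proof.
move=> cx; split=> // e e0; exists 1 => // k s t _ _ _.
by rewrite big1 // => i _; rewrite subrr enorm0.
Qed.

Lemma u_T x : closure O x -> u T x = G x (m T).
Proof.
move=> cx; have TT : 0 <= T <= T by rewrite lexx T0'.
have i0 g f : intble T T (run g f) -> rint T T (run g f) = 0.
  by move=> _; rewrite /rint set_itv1 Rintegral_set1.
apply/eqP; rewrite eq_le; apply/andP; split.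
  have Gc := Gamma_cst cx; have [f vf] := abs_cont_velocity T0 Gc.1.
  have := u_le_cost Gc TT; rewrite (cost_run Gc vf T0') set_itv1 integral_set1 add0e.
  by rewrite lee_fin.
apply/ler_addgt0Pr => e e0; have [g [f [Gg vf gx ir le]]] := u_near TT cx e0.
by move: le; rewrite i0 // add0r gx.
Qed.

Definition glue (t : R) (g1 g2 : R -> V) (s : R) : V := if s <= t then g1 s else g2 s.

Lemma glue_Gamma t g1 g2 : 0 <= t <= T -> Gamma O T g1 -> Gamma O T g2 -> g1 t = g2 t ->
  Gamma O T (glue t g1 g2).
Proof.
move=> /andP[t0 tT] [a1 c1] [a2 c2] E; split; last first.
  by move=> s sT; rewrite /glue; case: ifP => _; [exact: c1|exact: c2].
move=> e e0; have e2 : 0 < e / 2 by rewrite divr_gt0.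
have [d1 d10 H1] := a1 _ e2; have [d2 d20 H2] := a2 _ e2.
exists (Num.min d1 d2); first by rewrite lt_min d10.
move=> k a b ab disj; rewrite lt_min => /andP[l1 l2].
pose mn (x : R) := Num.min x t; pose mx (x : R) := Num.max x t.
have mnh x y : x <= y -> mn x <= mn y by move=> xy; rewrite /mn /Num.min; repeat case: ifPn; lra.
have mxh x y : x <= y -> mx x <= mx y by move=> xy; rewrite /mx /Num.max; repeat case: ifPn; lra.
have mnl x y : x <= y -> mn y - mn x <= y - x by move=> xy; rewrite /mn /Num.min; repeat case: ifPn; lra.
have mxl x y : x <= y -> mx y - mx x <= y - x by move=> xy; rewrite /mx /Num.max; repeat case: ifPn; lra.
have mnT x : 0 <= x -> 0 <= mn x by move=> x0; rewrite /mn le_min x0.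
have mxT x : x <= T -> mx x <= T by move=> x0; rewrite /mx ge_max x0.
have mnT' x : mn x <= T by rewrite /mn ge_min tT orbT.
have mxT' x : 0 <= mx x by rewrite /mx le_max t0 orbT.
(* Truncating every interval at [t] by min and max reduces increments of the joined curve to
   increments of the two given ones. *)
have gE x : glue t g1 g2 x = g1 (mn x) + g2 (mx x) - g1 t.
  rewrite /glue /mn /mx; have [xt|xt] := leP x t; first by rewrite -E addrK.
  by rewrite addrAC subrr add0r.
have h1 := H1 k (mn \o a) (mn \o b) _ _ _; have h2 := H2 k (mx \o a) (mx \o b) _ _ _.
have lt1 : \sum_(i < k) enorm (g1 ((mn \o b) i) - g1 ((mn \o a) i)) < e / 2.
  apply: h1 => [i|i j ij|].
  - have [q1 [q2 q3]] := ab i; split; first exact: mnT.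
    by split; [exact: mnh|exact: mnT'].
  - by case: (disj i j ij) => /mnh; [left|right].
  - apply: le_lt_trans l1; apply: ler_sum => i _; apply: mnl; by have [_ []] := ab i.
have lt2 : \sum_(i < k) enorm (g2 ((mx \o b) i) - g2 ((mx \o a) i)) < e / 2.
  apply: h2 => [i|i j ij|].
  - have [q1 [q2 q3]] := ab i; split; first exact: mxT'.
    by split; [exact: mxh|exact: mxT].
  - by case: (disj i j ij) => /mxh; [left|right].
  - apply: le_lt_trans l2; apply: ler_sum => i _; apply: mxl; by have [_ []] := ab i.
rewrite (splitr e); apply: le_lt_trans (ltrD lt1 lt2); rewrite -big_split /=.
apply: ler_sum => i _; rewrite !gE.
have -> : g1 (mn (b i)) + g2 (mx (b i)) - g1 t - (g1 (mn (a i)) + g2 (mx (a i)) - g1 t) =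
   (g1 (mn (b i)) - g1 (mn (a i))) + (g2 (mx (b i)) - g2 (mx (a i))).
  by apply/rowP => j; rewrite !mxE; ring.
exact: enormD.
Qed.

(** The arc of [g] on [t, t1] is continued by a curve starting at [g t1] that is optimal up to
    [e]. *)
Lemma u_dpp g f t t1 : Gamma O T g -> velocity T g f -> 0 <= t -> t <= t1 -> t1 <= T ->
  intble t t1 (run g f) -> u t (g t) <= rint t t1 (run g f) + u t1 (g t1).
Proof.
move=> Gg vf t0 tt1 t1T ir; apply/ler_addgt0Pr => e e0.
have t10 : 0 <= t1 by exact: le_trans tt1.
have t1T' : 0 <= t1 <= T by rewrite t10.
have tT : 0 <= t <= T by rewrite t0 (le_trans tt1).
have cg1 : closure O (g t1) by have [_ cg] := Gg; exact: cg.
have [g2 [f2 [Gg2 vf2 g2E ir2 le2]]] := u_near t1T' cg1 e0.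
set g3 := glue t1 g g2.
have Gg3 : Gamma O T g3 by exact: glue_Gamma.
have [f3 vf3] := abs_cont_velocity T0 Gg3.1.
have [_ _ _ [N [mN N0 _ fE]]] := vf; have [_ _ _ [N2 [mN2 N20 _ fE2]]] := vf2.
have [_ _ _ [N3 [mN3 N30 _ fE3]]] := vf3.
have [_ _ Z _] := vf; have [_ _ Z2 _] := vf2; have [_ _ Z3 _] := vf3.
(* At [t1] the one-sided derivatives of the joined curve may differ. *)
pose N' := N `|` N2 `|` N3 `|` [set t1].
have mN' : measurable N' by repeat apply: measurableU => //; exact: measurable_set1.
have N'0 : lam N' = 0%E.
  apply: null_set_setU; [| |apply: null_set_setU => //|exact: lebesgue_measure_set1].
  - by repeat apply: measurableU.
  - exact: measurable_set1.
  - exact: measurableU.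
  - exact: null_set_setU.
have f3l s : s < t1 -> ~ N' s -> f3 s = f s.
  move=> st nN; have [s0T|ns] := pselect (0 < s < T); last by rewrite Z ?Z3.
  have [_ <-] := fE s (fun h => nN (or_introl (or_introl (or_introl h)))) s0T.
  have [_ <-] := fE3 s (fun h => nN (or_introl (or_intror h))) s0T.
  rewrite !derive1E; apply: near_eq_derive; near=> x.
  by rewrite /g3 /glue ltW //; near: x; exact: lt_nbhsl.
have f3r s : t1 < s -> ~ N' s -> f3 s = f2 s.
  move=> st nN; have [s0T|ns] := pselect (0 < s < T); last by rewrite Z2 ?Z3.
  have [_ <-] := fE2 s (fun h => nN (or_introl (or_introl (or_intror h)))) s0T.
  have [_ <-] := fE3 s (fun h => nN (or_introl (or_intror h))) s0T.
  rewrite !derive1E; apply: near_eq_derive; near=> x.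
  by rewrite /g3 /glue leNgt ifN // negbK; near: x; exact: lt_nbhsr.
have r3l s : t <= s <= t1 -> ~ N' s -> run g f s = run g3 f3 s.
  move=> /andP[ts st1] nN; rewrite /run clamp_id ?(le_trans t0 ts) ?(le_trans st1 t1T) //.
  rewrite /g3 /glue st1 f3l // lt_neqAle st1 andbT; apply/eqP => sE; apply: nN.
  by right.
have r3r s : t1 <= s <= T -> ~ N' s -> run g2 f2 s = run g3 f3 s.
  move=> /andP[ts sT] nN; have st : t1 < s.
    by rewrite lt_neqAle ts andbT; apply/eqP => sE; apply: nN; right.
  rewrite /run clamp_id ?(le_trans t10 ts) ?sT //.
  by rewrite /g3 /glue leNgt st /= f3r.
have m3 := run_measurable Gg3 vf3.
have i3l : intble t t1 (run g3 f3) by exact: intble_off_null mN' N'0 m3 r3l ir.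
have i3r : intble t1 T (run g3 f3) by exact: intble_off_null mN' N'0 m3 r3r ir2.
have i3 : intble t T (run g3 f3) by exact: intble_glue i3l i3r.
have g3t : g3 t = g t by rewrite /g3 /glue tt1.
have g3T : g3 T = g2 T.
  rewrite /g3 /glue; case: leP => // Tt1.
  by have -> : T = t1 by apply/eqP; rewrite eq_le Tt1.
have := u_le_cost Gg3 tT; rewrite (cost_rint Gg3 vf3 t0 i3) lee_fin g3t g3T.
rewrite (rint_split tt1 t1T i3) -(rint_off_null mN' N'0 r3l) -(rint_off_null mN' N'0 r3r) => h.
by apply: le_trans h _; rewrite -!addrA lerD2l.
Unshelve. all: by end_near. Qed.

Lemma u_near_dpp t t1 x e : 0 <= t -> t <= t1 -> t1 <= T -> closure O x -> 0 < e -> exists g f,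
  [/\ Gamma O T g, velocity T g f, g t = x, intble t T (run g f) &
      rint t t1 (run g f) + u t1 (g t1) <= u t x + e].
Proof.
move=> t0 tt1 t1T cx e0; have tT : 0 <= t <= T by rewrite t0 (le_trans tt1).
have [g [f [Gg vf gx ir le]]] := u_near tT cx e0; exists g, f; split => //.
have t10 : 0 <= t1 by exact: le_trans tt1.
apply: le_trans le; rewrite (rint_split tt1 t1T ir) -addrA lerD2l.
have ir1 : intble t1 T (run g f) by apply: intbleS ir.
have := u_dpp Gg vf t10 t1T (lexx T) ir1; rewrite u_T //.
by have [_ cg] := Gg; apply: cg; rewrite lexx T0'.
Qed.

Let sandwich (r1 r2 r3 u1 u2 u3 u4 : R) : u1 <= r1 + u2 -> u2 <= r2 + u3 -> u3 <= r3 + u4 ->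
  r1 + (r2 + r3) + u4 <= u1 -> r2 = u2 - u3.
Proof. by move=> h1 h2 h3 h4; apply/eqP; rewrite eq_le; apply/andP; split; lra. Qed.

(** Optimality reverses the dynamic programming inequality on all of [0, T]. Adding the inequalities
    on the three pieces cut by [a] and [b] leaves no slack, so each is an equality. *)
Lemma optimal_run g x : optimal O L F G m T x g -> exists f,
  [/\ velocity T g f, intble 0 T (run g f) &
      forall a b, 0 <= a -> a <= b -> b <= T -> rint a b (run g f) = u a (g a) - u b (g b)].
Proof.
move=> [Gg gx opt]; have h0 : 0 <= (0 : R) <= T by rewrite lexx.
have cx : closure O x by rewrite -gx; have [_ cg] := Gg; exact: cg.
have [f vf] := abs_cont_velocity T0 Gg.1; exists f.
have ir : intble 0 T (run g f).
  have [g' [f' [Gg' vf' gx' ir' le]]] := u_near h0 cx ltr01.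
  apply: cost_lt_intble => //; apply: le_lt_trans (opt g' Gg' gx') _.
  by rewrite (cost_rint Gg' vf' (lexx 0) ir') ltry.
have tot : rint 0 T (run g f) + u T (g T) <= u 0 (g 0).
  apply/ler_addgt0Pr => e e0; have [g' [f' [Gg' vf' gx' ir' le]]] := u_near h0 cx e0.
  have := opt g' Gg' gx'; rewrite (cost_rint Gg' vf' (lexx 0) ir') (cost_rint Gg vf (lexx 0) ir) lee_fin.
  rewrite gx u_T; last by have [_ cg] := Gg; apply: cg; rewrite lexx T0'.
  by move=> h; exact: le_trans h le.
split => // a b a0 ab bT.
have b0 : 0 <= b by exact: le_trans ab.
have aT : a <= T by exact: le_trans bT.
have i1 : intble 0 a (run g f) by apply: intbleS ir.
have i2 : intble a b (run g f) by apply: intbleS ir.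
have i3 : intble b T (run g f) by apply: intbleS ir.
have i4 : intble a T (run g f) by apply: intbleS ir.
have e1 := u_dpp Gg vf (lexx 0) a0 aT i1.
have e2 := u_dpp Gg vf a0 ab bT i2.
have e3 := u_dpp Gg vf b0 bT (lexx T) i3.
move: tot; rewrite (rint_split a0 aT ir) (rint_split ab bT i4).
exact: sandwich e1 e2 e3.
Qed.

End DynamicProgramming.

(** * Energy, mean velocity and variance *)

Section Energy.
Context {R : realType} {n : nat}.
Local Notation V := 'rV[R]_n.
Local Notation lam := (@lebesgue_measure R).
Implicit Types (g f : R -> V) (p w : V) (a b T : R).

Lemma intble_sum (I : Type) (r : seq I) a b (h : I -> R -> R) :
  (forall i, intble a b (h i)) ->
  intble a b (fun s => \sum_(i <- r) h i s) /\
  rint a b (fun s => \sum_(i <- r) h i s) = \sum_(i <- r) rint a b (h i).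
Proof.
move=> hi; elim: r => [|i r [IH1 IH2]].
  rewrite big_nil; under eq_fun do rewrite big_nil; split; first exact: intble_cst.
  by rewrite /rint (_ : (fun=> 0) = cst 0) // /Rintegral integral0.
rewrite big_cons; under eq_fun do rewrite big_cons; split; first exact: intbleD.
by rewrite rintD // IH2.
Qed.

Lemma velocity_dot T g f p a b : velocity T g f -> 0 <= a -> a <= b -> b <= T ->
  intble a b (fun s => dotv p (f s)) /\ rint a b (fun s => dotv p (f s)) = dotv p (g b - g a).
Proof.
move=> [fi fE _ _] a0 ab bT.
have ii i : intble a b (fun s => p 0 i * f s 0 i).
  by apply: intbleZ; apply: integrableS (fi i) => //; exact: measurable_itv.
have [h1 h2] := intble_sum (index_enum 'I_n) ii; split => //.
rewrite /dotv h2; apply: eq_bigr => i _; rewrite rintZ; last first.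
  by apply: integrableS (fi i) => //; exact: measurable_itv.
by rewrite -[rint _ _ _](fE i a b) // !mxE.
Qed.

Lemma sq_sub p w : enorm (p - w) ^+ 2 = enorm p ^+ 2 + (- 2 * dotv w p + enorm w ^+ 2).
Proof. by rewrite !enorm_sqr dotvBl !dotvBr (dotvC p w); ring. Qed.

Lemma velocity_variance T g f w a b : velocity T g f -> 0 <= a -> a <= b -> b <= T ->
  intble a b (fun s => enorm (f s) ^+ 2) ->
  intble a b (fun s => enorm (f s - w) ^+ 2) /\
  rint a b (fun s => enorm (f s - w) ^+ 2) =
    rint a b (fun s => enorm (f s) ^+ 2) - 2 * dotv w (g b - g a) + (b - a) * enorm w ^+ 2.
Proof.
move=> vf a0 ab bT ie; have [id iE] := velocity_dot w vf a0 ab bT.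
under eq_fun do rewrite sq_sub.
have i1 : intble a b (fun s => - 2 * dotv w (f s)) by exact: intbleZ.
have i2 : intble a b (fun s => - 2 * dotv w (f s) + enorm w ^+ 2).
  by apply: intbleD => //; exact: intble_cst.
split; first exact: intbleD.
rewrite rintD // rintD //; last exact: intble_cst.
by rewrite rintZ // rint_cst // iE addrA mulNr.
Qed.

(** Cauchy-Schwarz, read off from the nonnegativity of the variance of the velocity about the mean
    slope. *)
Lemma velocity_holder T g f a b : velocity T g f -> 0 <= a -> a <= b -> b <= T ->
  intble a b (fun s => enorm (f s) ^+ 2) ->
  enorm (g b - g a) ^+ 2 <= (b - a) * rint a b (fun s => enorm (f s) ^+ 2).
Proof.
move=> vf a0 ab bT ie; move: (ab); rewrite le_eqVlt => /orP[/eqP <-|ab'].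
  by rewrite !subrr enorm0 expr0n mul0r.
have h0 : 0 < b - a by rewrite subr_gt0.
have [_ E] := velocity_variance ((b - a)^-1 *: (g b - g a)) vf a0 ab bT ie.
have : 0 <= rint a b (fun s => enorm (f s - (b - a)^-1 *: (g b - g a)) ^+ 2).
  by apply: rint_ge0 => s _; exact: sqr_ge0.
rewrite E dotvZl -enorm_sqr enormZ exprMn real_normK ?num_real //.
move: (enorm _) (rint _ _ _) => D I h.
suff : 0 <= (b - a) * (I - 2 * ((b - a)^-1 * D ^+ 2) + (b - a) * ((b - a)^-1 ^+ 2 * D ^+ 2)).
  rewrite (_ : (b - a) * _ = (b - a) * I - D ^+ 2); last by field; rewrite gt_eqF.
  by rewrite subr_ge0.
by rewrite mulr_ge0 // ltW.
Qed.

Lemma lip_derive g (s : R) w (B : R) : derivable g s 1 ->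
  (\forall t \near s, enorm (g t - g s - (t - s) *: w) <= B * `|t - s|) ->
  enorm (derive1 g s - w) <= B.
Proof.
move=> dg lip; apply/ler_addgt0Pr => e e0.
have cv : (h^-1 *: (g (h + s) - g s)) @[h --> (0 : R)^'] --> derive1 g s.
  have -> : (fun h : R => h^-1 *: (g (h + s) - g s)) = (fun h : R => h^-1 *: (g (h *: 1 + s) - g s)).
    by apply/funext => h; rewrite [h *: 1]mulr1.
  by rewrite derive1E; exact: dg.
have n1 : \forall h \near (0 : R)^', enorm (h^-1 *: (g (h + s) - g s) - derive1 g s) < e.
  by apply: (cv [set y | enorm (y - derive1 g s) < e]); apply/nbhs_enormP; exists e.
have n2 : \forall h \near (0 : R)^', enorm (g (h + s) - g s - h *: w) <= B * `|h|.
  have [d /= d0 dl] := (nbhs_ballP _ _).1 lip.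
  near=> h; have := dl (h + s); rewrite /ball /= opprD addrCA subrr addr0 normrN addrK.
  by apply; near: h; exact: dnbhs0_lt.
near (0 : R)^' => h.
have h1 : enorm (h^-1 *: (g (h + s) - g s) - derive1 g s) < e by near: h.
have h2 : enorm (g (h + s) - g s - h *: w) <= B * `|h| by near: h.
have h0 : h != 0 by near: h; exact: nbhs_dnbhs_neq.
apply: le_trans (enorm_dist (h^-1 *: (g (h + s) - g s)) _ _) _.
rewrite enormBC addrC; apply: lerD (ltW h1).
have -> : h^-1 *: (g (h + s) - g s) - w = h^-1 *: (g (h + s) - g s - h *: w).
  by rewrite [RHS]scalerBr scalerA mulVf // scale1r.
by rewrite enormZ normfV ler_pdivrMl ?normr_gt0 // mulrC.
Unshelve. all: by end_near. Qed.

Lemma lipschitz_abs_cont T g (K : R) : 0 <= K ->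
  (forall s t, enorm (g t - g s) <= K * `|t - s|) -> abs_cont_on 0 T g.
Proof.
move=> K0 lip e e0; exists (e / (K + 1)); first by rewrite divr_gt0 // ltr_wpDl.
move=> k s t st _; rewrite ltr_pdivlMr ?ltr_wpDl // => lt; apply: le_lt_trans lt.
apply: (@le_trans _ _ (\sum_(i < k) K * (t i - s i))).
  apply: ler_sum => i _; apply: le_trans (lip _ _) _.
  by have [_ [h _]] := st i; rewrite ger0_norm // subr_ge0.
rewrite -mulr_sumr mulrC ler_wpM2l ?lerDl //.
by apply: sumr_ge0 => i _; have [_ [h _]] := st i; rewrite subr_ge0.
Qed.

End Energy.

(** * Bent chords as curves *)

Section ChordCurve.
Context {R : realType} {n : nat}.
Local Notation V := 'rV[R]_n.
Variables (y z e : V) (a b : R).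
Hypothesis ab : a < b.
Let h := b - a.
Let h0 : 0 < h. Proof. by rewrite subr_gt0. Qed.
(** [clamp] holds the curve at rest before [a] and after [b], which makes it Lipschitz on the whole
    line. *)
Definition chord_curve (s : R) : V := bent_chord y z e (clamp 1 ((s - a) / (b - a))).

Lemma chord_curve_a : chord_curve a = y.
Proof. by rewrite /chord_curve subrr mul0r clamp_id ?lexx ?ler01 // /bent_chord !mul0r !scale0r !addr0. Qed.

Lemma chord_curve_b : chord_curve b = z.
Proof.
rewrite /chord_curve divff ?gt_eqF // clamp_id ?lexx ?ler01 // /bent_chord subrr mulr0 mul0r scale0r addr0.
by rewrite scale1r addrC subrK.
Qed.

Let bent_diff (l l' : R) : bent_chord y z e l - bent_chord y z e l' =
  (l - l') *: (z - y) + ((l - l') * (1 - l - l') * enorm (z - y) ^+ 2) *: e.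
Proof.
rewrite /bent_chord; move: (enorm _ ^+ 2) => E.
by apply/rowP => i; rewrite !mxE; ring.
Qed.

Let bump_le (l l' : R) : 0 <= l <= 1 -> 0 <= l' <= 1 ->
  enorm (((l - l') * (1 - l - l') * enorm (z - y) ^+ 2) *: e) <= `|l - l'| * (enorm (z - y) ^+ 2 * enorm e).
Proof.
move=> /andP[l0 l1] /andP[l0' l1']; have := sqr_ge0 (enorm (z - y)); move: (_ ^+ 2) => E E0.
rewrite enormZ !normrM (ger0_norm E0) -!mulrA ler_wpM2l // ler_piMl ?mulr_ge0 //.
by rewrite ler_norml; apply/andP; split; lra.
Qed.

Let arg_lip (s t : R) : `|clamp 1 ((t - a) / (b - a)) - clamp 1 ((s - a) / (b - a))| <= `|t - s| / h.
Proof.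
have E : (t - a) / (b - a) - (s - a) / (b - a) = (t - s) / h by rewrite -mulrBl /h; congr (_ / _); ring.
have -> : `|t - s| / h = `|(t - s) / h| by rewrite normrM (gtr0_norm (x := h^-1)) // invr_gt0.
rewrite -E; set p := (t - a) / _; set q := (s - a) / _.
have [pq|/ltW qp] := leP q p; first by rewrite !ger0_norm ?subr_ge0 ?clamp_homo // clamp_lip.
by rewrite distrC [leRHS]distrC !ger0_norm ?subr_ge0 ?clamp_homo // clamp_lip.
Qed.

Lemma chord_curve_lip s t : enorm (chord_curve t - chord_curve s) <=
  (enorm (z - y) + enorm (z - y) ^+ 2 * enorm e) / h * `|t - s|.
Proof.
rewrite /chord_curve; have ci := clamp_itv ((t - a) / (b - a)) ler01; have ci' := clamp_itv ((s - a) / (b - a)) ler01.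
rewrite bent_diff; apply: le_trans (enormD _ _) _.
apply: le_trans (lerD (lexx _) (bump_le ci ci')) _; rewrite enormZ -mulrDr.
rewrite [leRHS](_ : _ = `|t - s| / h * (enorm (z - y) + enorm (z - y) ^+ 2 * enorm e)); last by ring.
by rewrite ler_wpM2r ?arg_lip // addr_ge0 // mulr_ge0 // sqr_ge0.
Qed.

(** Only the bump departs from uniform motion, and its rate is quadratic in |z - y|: relative to the
    speed of the chord it is small with the length. *)
Lemma chord_curve_bump s t : a <= s <= b -> a <= t <= b ->
  enorm (chord_curve t - chord_curve s - (t - s) *: (h^-1 *: (z - y))) <=
  enorm (z - y) ^+ 2 * enorm e / h * `|t - s|.
Proof.
move=> /andP[as_ sb] /andP[at_ tb].
have cl x : a <= x -> x <= b -> clamp 1 ((x - a) / (b - a)) = (x - a) / h.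
  by move=> ax xb; rewrite clamp_id // divr_ge0 ?subr_ge0 ?(ltW ab) //= ler_pdivrMr // mul1r lerD2r.
have ci := clamp_itv ((t - a) / (b - a)) ler01; have ci' := clamp_itv ((s - a) / (b - a)) ler01.
rewrite /chord_curve bent_diff.
have E : clamp 1 ((t - a) / (b - a)) - clamp 1 ((s - a) / (b - a)) = (t - s) / h.
  by rewrite !cl // -mulrBl; congr (_ / _); ring.
rewrite {1}E scalerA addrAC subrr add0r; apply: le_trans (bump_le ci ci') _.
rewrite [leRHS](_ : _ = `|t - s| / h * (enorm (z - y) ^+ 2 * enorm e)); last by ring.
by rewrite ler_wpM2r ?arg_lip // mulr_ge0 // sqr_ge0.
Qed.

Lemma chord_curve_dist x0 (d : R) s : 0 <= d -> d <= 1 -> enorm (y - x0) <= d -> enorm (z - x0) <= d ->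
  enorm (chord_curve s - x0) <= d * (1 + enorm e).
Proof.
move=> d0 d1 yd zd; have /andP[l0 l1] := clamp_itv ((s - a) / (b - a)) ler01.
rewrite /chord_curve /bent_chord; move: (clamp _ _) l0 l1 => l l0 l1.
have zy : enorm (z - y) <= 2 * d.
  apply: le_trans (enorm_dist x0 _ _) _; rewrite (enormBC x0).
  by apply: le_trans (lerD zd yd) _; rewrite -mulr2n mulr_natl.
have -> : y + l *: (z - y) + (l * (1 - l) * enorm (z - y) ^+ 2) *: e - x0 =
  ((1 - l) *: (y - x0) + l *: (z - x0)) + (l * (1 - l) * enorm (z - y) ^+ 2) *: e.
  by move: (enorm _ ^+ 2) => E; apply/rowP => i; rewrite !mxE; ring.
apply: le_trans (enormD _ _) _; rewrite [leRHS]mulrDr [d * 1]mulr1; apply: lerD.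
  apply: le_trans (enormD _ _) _; rewrite !enormZ !ger0_norm ?subr_ge0 //.
  have -> : d = (1 - l) * d + l * d by ring.
  by apply: lerD; rewrite ler_wpM2l ?subr_ge0.
rewrite enormZ ger0_norm ?mulr_ge0 ?subr_ge0 ?sqr_ge0 // ler_wpM2r //.
have l4 : l * (1 - l) <= 1 / 4.
  by have := sqr_ge0 (2 * l - 1); rewrite expr2; lra.
apply: (@le_trans _ _ (1 / 4 * (2 * d) ^+ 2)).
  by apply: ler_pM; rewrite ?mulr_ge0 ?subr_ge0 ?sqr_ge0 // ler_pXn2r ?nnegrE // mulr_ge0.
rewrite exprMn (_ : _ * _ = d * d); last by field.
by rewrite ler_piMl.
Qed.

End ChordCurve.

(** * Action bounds and regularity of optimal curves *)

Section ActionBounds.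
Context {R : realType} {n : nat}.
Local Notation V := 'rV[R]_n.
Local Notation lam := (@lebesgue_measure R).
Variables (O U : set V) (T : R) (L : V -> V -> R) (F G : V -> Prob R n -> R)
  (kappa M mu : R) (u : R -> V -> R) (m : R -> Prob R n).
Hypothesis S : setting O U T L F G kappa M mu u m.
Let T0 := T_gt0 S.
Let T0' := ltW (T_gt0 S).
Local Notation run := (run T L F m).
Implicit Types (g f : R -> V).

Definition energy f (a b : R) : R := rint a b (fun s => enorm (f s) ^+ 2).
Definition Fint x0 (a b : R) : R := rint a b (fun s => F x0 (m (clamp T s))).

Lemma Fx_continuous x0 : closure O x0 -> continuous (fun s => F x0 (m (clamp T s))).
Proof. by move=> cx; exact: (F_curve_continuous S (Gamma_cst T cx)). Qed.

Lemma M_nonneg : 0 <= M.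
Proof. by apply: (M_ge0 (L_0 S)); have [x /(OU S) Ux] := closure_nonempty S; exists x. Qed.

Lemma energy_intble g f a b : Gamma O T g -> velocity T g f ->
  intble a b (run g f) -> intble a b (fun s => enorm (f s) ^+ 2).
Proof.
move=> Gg vf ir; have [C C0 HC] := run_lb S.
have mu4 : 0 < 4 * mu by rewrite mulr_gt0 // (mu_gt0 S).
apply: (@intble_le _ _ _ _ (fun s => (4 * mu) * (run g f s + C))).
- apply: (@velocity_measurable _ _ T g f (fun z : V * V => enorm z.2 ^+ 2)) => //; first by case: Gg.
  move=> s w; apply: (@continuous_comp _ _ _ (fun z : V * V => enorm z.2) (fun r : R => r ^+ 2)).
    apply: (@continuous_comp _ _ _ snd (@enorm R n)); first exact: cvg_snd.
    exact: continuous_enorm.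
  exact: exprn_continuous.
- by apply: intbleZ; apply: intbleD => //; exact: intble_cst.
- move=> s _; rewrite ger0_norm ?sqr_ge0 // -ler_pdivrMl // mulrC -lerBlDr.
  exact: HC.
Qed.

Let lower_pt (Lg Lf L0 Fg F0 q c d N dl kd : R) :
  L0 + q + c <= Lf -> `|Lg - Lf| <= dl * N * d -> `|Fg - F0| <= kd * d -> 1 <= N -> 0 <= kd -> 0 <= d ->
  (L0 + q) + (c + (F0 + - ((dl + kd) * d) * N)) <= Lg + Fg.
Proof.
rewrite !ler_norml => h1 /andP[h2 _] /andP[h3 _] N1 kd0 d0.
have : kd * d <= kd * d * N by rewrite ler_peMr // mulr_ge0.
rewrite -mulrA (mulrC N) mulrA in h2 *; lra.
Qed.

(** The Taylor lower bound is taken at the mean slope [w], so the linear term integrates to 0 and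
    the quadratic one leaves the variance. Moving the state to [x0] costs
    [(M + 2 * mu + kappa) * d], weighted by 1 + |f|^2. *)
Lemma run_lower x0 r g f a b d : closure O x0 -> (forall y, enorm (y - x0) < r -> U y) ->
  Gamma O T g -> velocity T g f -> 0 <= a -> a < b -> b <= T -> intble a b (run g f) ->
  0 <= d -> d < r -> (forall s, a <= s <= b -> enorm (g s - x0) <= d) ->
  forall w, w = (b - a)^-1 *: (g b - g a) ->
  (b - a) * L x0 w + rint a b (fun s => enorm (f s - w) ^+ 2) / (2 * mu) + Fint x0 a b
    - (M + 2 * mu + kappa) * d * ((b - a) + energy f a b) <= rint a b (run g f).
Proof.
move=> cx rU Gg vf a0 ab bT ir d0 dr gd w wE; have ab' := ltW ab.
have h0 : 0 < b - a by rewrite subr_gt0.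
have Ux := OU S cx; have mu0 := mu_gt0 S; have k0 := kappa_ge0 S; have M0 := M_nonneg.
have ie := energy_intble Gg vf ir.
have [iv _] := velocity_variance w vf a0 ab' bT ie.
have [id dE] := velocity_dot (gradv L x0 w) vf a0 ab' bT.
pose p := gradv L x0 w.
pose low s := (L x0 w + (dotv p (f s) + - dotv p w)) + ((2 * mu)^-1 * enorm (f s - w) ^+ 2 +
   (F x0 (m (clamp T s)) + - ((M + 2 * mu + kappa) * d) * (1 + enorm (f s) ^+ 2))).
have iF : intble a b (fun s => F x0 (m (clamp T s))) by apply: intble_continuous; exact: Fx_continuous.
have i1 : intble a b (fun s => dotv p (f s) + - dotv p w) by apply: intbleD => //; exact: intble_cst.
have i2 : intble a b (fun s => L x0 w + (dotv p (f s) + - dotv p w)) by apply: intbleD => //; exact: intble_cst.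
have i3 : intble a b (fun s => (2 * mu)^-1 * enorm (f s - w) ^+ 2) by exact: intbleZ.
have i4 : intble a b (fun s => 1 + enorm (f s) ^+ 2) by apply: intbleD => //; exact: intble_cst.
have i5 : intble a b (fun s => - ((M + 2 * mu + kappa) * d) * (1 + enorm (f s) ^+ 2)) by exact: intbleZ.
have i6 := intbleD iF i5; have i7 := intbleD i3 i6; have i8 := intbleD i2 i7.
have le : rint a b low <= rint a b (run g f).
  apply: rint_le => // s /andP[as_ sb]; rewrite /low /run.
  have sT : 0 <= s <= T by rewrite (le_trans a0 as_) (le_trans sb bT).
  rewrite (clamp_id sT); have gs := gd s; rewrite as_ sb in gs; have {}gs := gs isT.
  have seg : segment_in U x0 (g s).
    by apply: (segment_in_eball rU); [rewrite subrr enorm0; exact: le_lt_trans dr|exact: le_lt_trans dr].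
  have t1 := L_taylor_lb (L_C1 S) (L_1 S) w (f s) Ux.
  rewrite dotvBr (mulrC (enorm _ ^+ 2)) in t1.
  have t2 := L_lip_x (L_C1 S) (L_0 S) mu0 (L_1 S) (f s) seg.
  have t3 := F_lip S sT seg.
  have N1 : 1 <= 1 + enorm (f s) ^+ 2 by rewrite lerDl sqr_ge0.
  apply: (lower_pt t1 _ _ N1 k0 d0).
    apply: le_trans t2 _; rewrite ler_wpM2l // mulr_ge0 ?addr_ge0 ?mulr_ge0 ?sqr_ge0 // ltW //.
  by apply: le_trans t3 _; rewrite ler_wpM2l.
apply: le_trans le; rewrite /low (rintD i2 i7) (rintD i3 i6) (rintD iF i5) (rintZ _ i4) (rintZ _ iv).
rewrite (rintD (intble_cst _ _ _) i1) (rintD id (intble_cst _ _ _)) (rintD (intble_cst _ _ _) ie).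
rewrite !rint_cst // dE.
have -> : dotv (gradv L x0 w) (g b - g a) = (b - a) * dotv p w.
  have <- : (b - a) *: w = g b - g a by rewrite wE scalerA divff ?scale1r // gt_eqF.
  by rewrite dotvZr.
rewrite mulr1 -/(energy f a b) -/(Fint x0 a b); move: (dotv p w) (rint _ _ _) => q I.
by rewrite le_eqVlt; apply/orP; left; apply/eqP; ring.
Qed.

Let upper_pt (Lc Lf L0 Fc F0 q B2 D N dl kd ml : R) :
  Lf <= L0 + q + ml * B2 -> `|Lc - Lf| <= dl * N * D -> `|Fc - F0| <= kd * D ->
  Lc + Fc <= (L0 + q) + (F0 + (ml * B2 + dl * N * D + kd * D)).
Proof. by rewrite !ler_norml => h1 /andP[_ h2] /andP[_ h3]; lra. Qed.

(** The three terms pay for the dependence of [L] on the state, for that of [F], and for the Taylor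
    remainder due to the bump. [1 + E] bounds the distance to the centre in units of [d], and
    [1 + 2 * E] the speed in units of the mean speed. *)
Definition chord_const (E : R) : R :=
  (M + 2 * mu) * (1 + E) * (1 + 2 * E) ^+ 2 + kappa * (1 + E) + 2 * mu * E ^+ 2.

Let chord_const_pt (E W d B Ff : R) : 0 <= E -> 0 <= W -> 0 <= d -> d <= 1 -> 0 <= B -> 0 <= Ff ->
  B <= 2 * d * E * W -> Ff <= W + B ->
  mu / 2 * B ^+ 2 + (M + 2 * mu) * (1 + Ff ^+ 2) * (d * (1 + E)) + kappa * (d * (1 + E)) <=
  chord_const E * d * (1 + W ^+ 2).
Proof.
move=> E0 W0 d0 d1 B0 F0 BW FW; have mu0 := mu_gt0 S; have k0 := kappa_ge0 S; have M0 := M_nonneg.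
have EW : 0 <= E * W by rewrite mulr_ge0.
have B1 : B <= 2 * E * W.
  apply: le_trans BW _; rewrite (_ : 2 * d * E * W = d * (2 * E * W)); last by ring.
  by rewrite ler_piMl // !mulr_ge0.
have h1 : B ^+ 2 <= 4 * E ^+ 2 * d * W ^+ 2.
  apply: (@le_trans _ _ ((2 * d * E * W) * (2 * E * W))).
    by rewrite expr2 ler_pM.
  by rewrite le_eqVlt; apply/orP; left; apply/eqP; ring.
have h2 : Ff ^+ 2 <= (1 + 2 * E) ^+ 2 * W ^+ 2.
  rewrite -exprMn ler_pXn2r ?nnegrE ?mulr_ge0 ?addr_ge0 ?mulr_ge0 //.
  by apply: le_trans FW _; rewrite mulrDl mul1r lerD2l.
have h3 : 1 + Ff ^+ 2 <= (1 + 2 * E) ^+ 2 * (1 + W ^+ 2).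
  have : 1 <= (1 + 2 * E) ^+ 2 by rewrite expr_ge1 // ?lerDl ?addr_ge0 ?mulr_ge0.
  by rewrite mulrDr mulr1 => h; apply: lerD.
have W2 : 0 <= W ^+ 2 by exact: sqr_ge0.
have k1 : mu / 2 * B ^+ 2 <= 2 * mu * E ^+ 2 * d * (1 + W ^+ 2).
  apply: (@le_trans _ _ (mu / 2 * (4 * E ^+ 2 * d * W ^+ 2))).
    by rewrite ler_wpM2l // divr_ge0 // ltW.
  have -> : mu / 2 * (4 * E ^+ 2 * d * W ^+ 2) = 2 * mu * E ^+ 2 * d * W ^+ 2 by field.
  by rewrite ler_wpM2l ?lerDr // !mulr_ge0 ?sqr_ge0 // ltW.
have k2 : (M + 2 * mu) * (1 + Ff ^+ 2) * (d * (1 + E)) <=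
   (M + 2 * mu) * (1 + E) * (1 + 2 * E) ^+ 2 * d * (1 + W ^+ 2).
  have -> : (M + 2 * mu) * (1 + E) * (1 + 2 * E) ^+ 2 * d * (1 + W ^+ 2) =
    (M + 2 * mu) * ((1 + 2 * E) ^+ 2 * (1 + W ^+ 2)) * (d * (1 + E)) by ring.
  by rewrite ler_wpM2r ?mulr_ge0 ?addr_ge0 // ler_wpM2l // addr_ge0 // mulr_ge0 // ltW.
have k3 : kappa * (d * (1 + E)) <= kappa * (1 + E) * d * (1 + W ^+ 2).
  have -> : kappa * (d * (1 + E)) = kappa * (1 + E) * d by ring.
  by rewrite ler_peMr ?lerDl // !mulr_ge0 ?addr_ge0.
by apply: le_trans (lerD (lerD k1 k2) k3) _; rewrite /chord_const le_eqVlt; apply/orP; left; apply/eqP; ring.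
Qed.

(** The bump changes the constant velocity [w] by at most 2 d |e| |w|, so speeds stay comparable
    with |w|. The linear Taylor term integrates to 0 again, and every error is a multiple of d (1 +
    |w|^2). Both end points are free, in time as well as in space, which is what perturbing one end
    of an arc requires. *)
Lemma chord_upper x0 r e a b y z d : closure O x0 -> chord_at O x0 r e ->
  (forall y, enorm (y - x0) < r * (1 + enorm e) -> U y) -> r <= 1 ->
  0 <= a -> a < b -> b <= T -> closure O y -> closure O z ->
  enorm (y - x0) <= d -> enorm (z - x0) <= d -> d < r ->
  forall w, w = (b - a)^-1 *: (z - y) ->
  u a y <= u b z + (b - a) * L x0 w + Fint x0 a b
    + chord_const (enorm e) * d * (1 + enorm w ^+ 2) * (b - a).
Proof.
move=> cx ch rU r1 a0 ab bT cy cz yd zd dr w wE; have ab' := ltW ab.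
have h0 : 0 < b - a by rewrite subr_gt0.
have d0 : 0 <= d by exact: le_trans yd.
have d1 : d <= 1 by exact: le_trans (ltW dr) r1.
have r0 : 0 < r by exact: le_lt_trans dr.
have Ux := OU S cx; have mu0 := mu_gt0 S; have k0 := kappa_ge0 S; have M0 := M_nonneg.
pose c := chord_curve y z e a b; pose E := enorm e.
pose K := (enorm (z - y) + enorm (z - y) ^+ 2 * enorm e) / (b - a).
have K0 : 0 <= K by apply: divr_ge0 (ltW h0); apply: addr_ge0 => //; apply: mulr_ge0 => //; exact: sqr_ge0.
have Gc : Gamma O T c.
  split; first exact: lipschitz_abs_cont K0 (chord_curve_lip y z e ab).
  by move=> s _; apply: ch; [| |exact: le_lt_trans dr|exact: le_lt_trans dr|exact: clamp_itv].
have [f vf] := abs_cont_velocity T0 Gc.1.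
have [_ _ fz [N [mN N0 fN fE]]] := vf.
have fK s : enorm (f s) <= K.
  have [s0T|ns] := pselect (0 < s < T); last by rewrite fz // enorm0.
  have [Ns|Ns] := pselect (N s); first by rewrite fN // enorm0.
  have [dc <-] := fE s Ns s0T; rewrite -[derive1 c s]subr0; apply: lip_derive => //.
  by near=> t; rewrite scaler0 subr0; exact: chord_curve_lip.
pose B := enorm (z - y) ^+ 2 * enorm e / (b - a).
have B0 : 0 <= B by apply: divr_ge0 (ltW h0); apply: mulr_ge0 => //; exact: sqr_ge0.
have fB s : a < s < b -> ~ N s -> enorm (f s - w) <= B.
  move=> /andP[as_ sb] Ns; have s0T : 0 < s < T by rewrite (le_lt_trans a0 as_) (lt_le_trans sb bT).
  have [dc <-] := fE s Ns s0T; rewrite wE; apply: lip_derive => //; near=> t.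
  apply: chord_curve_bump; rewrite ?(ltW as_) ?(ltW sb) //; apply/andP; split; apply: ltW; near: t.
  - exact: lt_nbhsr.
  - exact: lt_nbhsl.
have ir : intble a b (run c f) := run_bounded_intble S a b Gc vf fK.
have [id dE] := velocity_dot (gradv L x0 w) vf a0 ab' bT.
pose p := gradv L x0 w; pose W := enorm w.
pose up s := (L x0 w + (dotv p (f s) + - dotv p w)) + (F x0 (m (clamp T s)) + chord_const E * d * (1 + W ^+ 2)).
have iF : intble a b (fun s => F x0 (m (clamp T s))) by apply: intble_continuous; exact: Fx_continuous.
have i1 : intble a b (fun s => dotv p (f s) + - dotv p w) by apply: intbleD => //; exact: intble_cst.
have i2 : intble a b (fun s => L x0 w + (dotv p (f s) + - dotv p w)) by apply: intbleD => //; exact: intble_cst.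
have i3 : intble a b (fun s => F x0 (m (clamp T s)) + chord_const E * d * (1 + W ^+ 2)).
  by apply: intbleD => //; exact: intble_cst.
have i4 : intble a b up by exact: intbleD.
pose N' := N `|` [set a; b].
have mN' : measurable N' by apply: measurableU => //; apply: measurableU; exact: measurable_set1.
have N'0 : lam N' = 0%E.
  apply: null_set_setU => //; first by apply: measurableU; exact: measurable_set1.
  by apply: null_set_setU; [exact: measurable_set1|exact: measurable_set1|exact: lebesgue_measure_set1|exact: lebesgue_measure_set1].
have Wh : enorm (z - y) = (b - a) * W.
  by rewrite /W wE enormZ gtr0_norm ?invr_gt0 // mulrA divff ?mul1r // gt_eqF.
have zy : enorm (z - y) <= 2 * d.
  apply: le_trans (enorm_dist x0 _ _) _; rewrite (enormBC x0).
  by apply: le_trans (lerD zd yd) _; rewrite -mulr2n mulr_natl.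
have BE : B <= 2 * d * E * W.
  have -> : B = enorm (z - y) * E * W by rewrite /B expr2 {1}Wh /E; field; rewrite gt_eqF.
  by apply: ler_wpM2r; [exact: enorm_ge0|apply: ler_wpM2r => //; exact: enorm_ge0].
have le : rint a b (run c f) <= rint a b up.
  apply: (rint_le_off_null mN' N'0) => // s /andP[as_ sb] Ns.
  have as' : a < s by rewrite lt_neqAle as_ andbT; apply/eqP => sE; apply: Ns; right; left.
  have sb' : s < b by rewrite lt_neqAle sb andbT; apply/eqP => sE; apply: Ns; right; right.
  have fs : enorm (f s - w) <= B by apply: fB; [rewrite as' sb'|move=> h; apply: Ns; left].
  have sT : 0 <= s <= T by rewrite (le_trans a0 as_) (le_trans sb bT).
  rewrite /up /run (clamp_id sT).
  have cd := chord_curve_dist e a b s d0 d1 yd zd; rewrite -/c in cd.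
  have seg : segment_in U x0 (c s).
    apply: (segment_in_eball rU); first by rewrite subrr enorm0 mulr_gt0 // ltr_wpDr.
    by apply: le_lt_trans cd _; rewrite ltr_pM2r // ltr_wpDr.
  have t1 := L_taylor_ub (L_C1 S) (L_1 S) w (f s) Ux; rewrite dotvBr in t1.
  have t2 := L_lip_x (L_C1 S) (L_0 S) mu0 (L_1 S) (f s) seg.
  have t3 := F_lip S sT seg.
  have c1 : 0 <= M + 2 * mu by rewrite addr_ge0 // mulr_ge0 // ltW.
  have N0' : 0 <= 1 + enorm (f s) ^+ 2 by rewrite addr_ge0 // sqr_ge0.
  have ff : enorm (f s) <= W + enorm (f s - w).
    by have := enormD (f s - w) w; rewrite subrK addrC.
  have cc := @chord_const_pt E W d (enorm (f s - w)) (enorm (f s)) (enorm_ge0 _) (enorm_ge0 _) d0 d1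
    (enorm_ge0 _) (enorm_ge0 _) (le_trans fs BE) ff.
  have t4 : (L x0 w + (dotv p (f s) + - dotv p w)) + (F x0 (m s) + (mu / 2 * enorm (f s - w) ^+ 2 +
      (M + 2 * mu) * (1 + enorm (f s) ^+ 2) * (d * (1 + E)) + kappa * (d * (1 + E)))) <=
      L x0 w + (dotv p (f s) + - dotv p w) + (F x0 (m s) + chord_const E * d * (1 + W ^+ 2)).
    by rewrite lerD2l lerD2l.
  have t2' := le_trans t2 (ler_wpM2l (mulr_ge0 c1 N0') cd).
  have t3' := le_trans t3 (ler_wpM2l k0 cd).
  exact: le_trans (upper_pt t1 t2' t3') t4.
have := u_dpp S Gc vf a0 ab' bT ir; rewrite /c (chord_curve_a y z e a b) (chord_curve_b y z e ab) -/c.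
move=> h; apply: le_trans h _; rewrite addrC; apply: le_trans (lerD (lexx _) le) _.
rewrite /up (rintD i2 i3) (rintD iF (intble_cst _ _ _)).
rewrite (rintD (intble_cst _ _ _) i1) (rintD id (intble_cst _ _ _)) !rint_cst // dE.
have -> : dotv (gradv L x0 w) (c b - c a) = (b - a) * dotv p w.
  rewrite /c (chord_curve_a y z e a b) (chord_curve_b y z e ab).
  have <- : (b - a) *: w = z - y by rewrite wE scalerA divff ?scale1r // gt_eqF.
  by rewrite dotvZr.
rewrite -/(Fint x0 a b); move: (dotv p w) => q.
by rewrite le_eqVlt; apply/orP; left; apply/eqP; rewrite /E /W; ring.
Unshelve. all: by end_near. Qed.

End ActionBounds.

(** * Geometric sequences of scales *)

Section DyadicLimits.
Context {R : realType}.

(** Nested intervals: the lower ends [lo] increase, the upper ends [hi] decrease, and the limit is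
    the supremum of the lower ends. *)
Lemma dyadic_limit (a : nat -> R) (C : R) : (forall k, `|a k.+1 - a k| <= C / 2 ^+ k) ->
  exists v, forall k, `|a k - v| <= 2 * C / 2 ^+ k.
Proof.
move=> H; pose lo k := a k - 2 * C / 2 ^+ k; pose hi k := a k + 2 * C / 2 ^+ k.
have half k : 2 * C / 2 ^+ k.+1 = C / 2 ^+ k.
  by rewrite exprS invfM mulrACA divff ?mul1r.
have dbl k : 2 * C / 2 ^+ k = C / 2 ^+ k + C / 2 ^+ k by rewrite -mulrA mulrDl !mul1r.
have lo1 k : lo k <= lo k.+1.
  have := H k; rewrite /lo half dbl ler_norml => /andP[h _]; lra.
have hi1 k : hi k.+1 <= hi k.
  have := H k; rewrite /hi half dbl ler_norml => /andP[_ h]; lra.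
have C0 k : 0 <= C / 2 ^+ k by exact: le_trans (normr_ge0 _) (H k).
have lohi k : lo k <= hi k by rewrite /lo /hi dbl; have := C0 k; lra.
have lom : {homo lo : i j / (i <= j)%N >-> i <= j} by apply: homo_leq => // ; exact: le_trans.
have him : {homo hi : i j / (i <= j)%N >-> j <= i}.
  by apply: (@homo_leq _ hi (fun x y => y <= x)) => // x y z h1 h2; exact: le_trans h1.
have cross i j : lo i <= hi j.
  apply: le_trans (lom _ _ (leq_maxl i j)) _; apply: le_trans (lohi _) _.
  by apply: him; exact: leq_maxr.
have sl : has_sup [set lo k | k in [set: nat]].
  split; first by exists (lo 0%N), 0%N.
  by exists (hi 0%N) => _ [k _ <-]; exact: cross.
exists (sup [set lo k | k in [set: nat]]) => k.
have h1 : lo k <= sup [set lo k | k in [set: nat]] by apply: ub_le_sup; [exact: sl.2|exists k].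
have h2 : sup [set lo k | k in [set: nat]] <= hi k.
  by apply: ge_sup; [exact: sl.1|move=> _ [i _ <-]; exact: cross].
by move: h1 h2; rewrite /lo /hi ler_norml => h1 h2; apply/andP; split; lra.
Qed.

Lemma dyadic_small (C e : R) : 0 < e -> exists k, C / 2 ^+ k <= e.
Proof.
move=> e0; exists (Num.bound (`|C| / e)); rewrite ler_pdivrMr ?exprn_gt0 // mulrC -ler_pdivrMr //.
apply: (@le_trans _ _ (`|C| / e)); first by rewrite ler_pM2r ?invr_gt0 // ler_norm.
apply: le_trans (ltW (archi_boundP _)) _; first by rewrite divr_ge0 // ltW.
by rewrite -natrX ler_nat ltnW // ltn_expl.
Qed.

Lemma scale16 (h0 h : R) : 0 < h -> h <= h0 -> exists k, h0 / 16 ^+ k.+1 < h <= h0 / 16 ^+ k.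
Proof.
move=> hp hh; have h00 : 0 < h0 by exact: lt_le_trans hh.
have ex : exists k, h0 / 16 ^+ k.+1 < h.
  have [k hk] := dyadic_small h0 (e := h / 2) ltac:(lra); exists k.
  apply: (@le_lt_trans _ _ (h / 2)); last lra.
  apply: le_trans hk; rewrite ler_pM2l // lef_pV2 ?posrE ?exprn_gt0 //.
  rewrite -!natrX ler_nat; apply: (@leq_trans (16 ^ k)); first by case: (k) => // j; rewrite leq_exp2r.
  by rewrite leq_exp2l.
case: (ex_minnP ex) => k hk mk; exists k; rewrite hk /=.
case: k hk mk => [|k] hk mk; first by rewrite expr0 divr1.
by rewrite leNgt; apply/negP => /mk; rewrite ltnn.
Qed.

End DyadicLimits.

Section DyadicVectors.
Context {R : realType} {n : nat}.
Local Notation V := 'rV[R]_n.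

Lemma dyadic_limitv (w : nat -> V) (C : R) : 0 <= C -> (forall k, enorm (w k.+1 - w k) <= C / 2 ^+ k) ->
  exists v, forall k, enorm (w k - v) <= n%:R * (2 * C / 2 ^+ k).
Proof.
move=> C0 H.
have Hi i : exists v, forall k, `|w k 0 i - v| <= 2 * C / 2 ^+ k.
  apply: dyadic_limit => k; apply: le_trans (H k).
  by have := coord_le_enorm (w k.+1 - w k) i; rewrite !mxE.
have [v vP] := choice Hi; exists (\row_i v i) => k.
apply: le_trans (enorm_le_norm _) _; rewrite ler_wpM2l //.
apply: norm_le_coord => [|i]; first by rewrite divr_ge0 ?mulr_ge0 // exprn_ge0.
by rewrite !mxE; exact: vP.
Qed.

(** The increments are relative to the current size, so a bound has to be carried along the
    induction; the factor [2 - (2 ^+ k)^-1] absorbs the next increment exactly. *)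
Lemma dyadic_growth (w : nat -> V) : (forall k, enorm (w k.+1 - w k) <= 1 / 4 / 2 ^+ k * (1 + enorm (w k))) ->
  forall k, 1 + enorm (w k) <= 2 * (1 + enorm (w 0%N)).
Proof.
move=> H k; have := erefl (1 + enorm (w 0%N)); move: {2}(1 + enorm _) => W WE; rewrite WE; have W0 : 0 <= W by rewrite -WE addr_ge0.
suff : 1 + enorm (w k) <= (2 - (2 ^+ k)^-1) * W.
  move/le_trans; apply; rewrite ler_wpM2r // gerBl invr_ge0 exprn_ge0 //.
elim: k => [|k IH]; first by rewrite WE expr0 invr1 (_ : 2 - 1 = 1) ?mul1r //; ring.
have k0 : 0 < (2 ^+ k)^-1 :> R by rewrite invr_gt0 exprn_gt0.
have e1 : (2 ^+ k.+1)^-1 = (2 ^+ k)^-1 / 2 :> R by rewrite exprS invfM mulrC.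
have := H k; have tri : enorm (w k.+1) <= enorm (w k) + enorm (w k.+1 - w k).
  by have := enormD (w k) (w k.+1 - w k); rewrite addrC subrK.
have IH2 : 1 + enorm (w k) <= 2 * W by apply: le_trans IH _; rewrite ler_wpM2r // gerBl ltW.
have : 1 / 4 / 2 ^+ k * (1 + enorm (w k)) <= 1 / 4 / 2 ^+ k * (2 * W).
  by rewrite ler_wpM2l // mulr_ge0 ?(ltW k0).
rewrite e1; move: tri IH k0; move: (enorm (w k.+1)) (enorm (w k)) (enorm _) ((2 ^+ k)^-1) => A B D q.
by clear; move=> *; lra.
Qed.

End DyadicVectors.

(** * Differentiability of optimal curves *)

Section Regularity.
Context {R : realType} {n : nat}.
Local Notation V := 'rV[R]_n.
Variables (O U : set V) (T : R) (L : V -> V -> R) (F G : V -> Prob R n -> R)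
  (kappa M mu : R) (u : R -> V -> R) (m : R -> Prob R n).
Hypothesis S : setting O U T L F G kappa M mu u m.
Let T0 := T_gt0 S.
Local Notation run := (run T L F m).
Implicit Types (g f : R -> V).

(** The ball is shrunk so that bent chords, which may leave it by the factor 1 + |e|, remain in
    [U]. *)
Lemma good_chord x0 : closure O x0 -> exists r e, [/\ 0 < r, r <= 1, chord_at O x0 r e &
  forall y, enorm (y - x0) < r * (1 + enorm e) -> U y].
Proof.
move=> cx; have [r1 [e [r10 ch]]] := local_chord (domO S) cx.
have [r2 r20 rU] := closure_ball_U S cx.
have e1 : 0 < 1 + enorm e by rewrite ltr_wpDr.
exists (Num.min (Num.min r1 1) (r2 / (1 + enorm e))), e; split.
- by rewrite !lt_min r10 ltr01 divr_gt0.
- by rewrite !ge_min lexx orbT.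
- move=> y z l cy cz; rewrite !lt_min => /andP[/andP[y1 _] _] /andP[/andP[z1 _] _].
  exact: ch.
- move=> y yr; apply: rU; apply: lt_le_trans yr _.
  by rewrite -ler_pdivlMr // ge_min lexx orbT.
Qed.

(** What is retained of optimality: equality in dynamic programming on every subinterval.
    Competitors no longer appear, only [u]. *)
Definition extremal g f : Prop := [/\ Gamma O T g, velocity T g f, intble 0 T (run g f) &
  forall a b, 0 <= a -> a <= b -> b <= T -> rint a b (run g f) = u a (g a) - u b (g b)].

Lemma energy_sub g f a b a' b' : extremal g f -> 0 <= a' -> a' <= a -> a <= b -> b <= b' -> b' <= T ->
  energy f a b <= energy f a' b'.
Proof.
move=> [Gg vf ir _] a0 aa ab bb bT; apply: rint_sub => //; last by move=> s _; exact: sqr_ge0.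
have ir' : intble a' b' (run g f) by apply: intbleS ir.
exact: (energy_intble S Gg vf ir').
Qed.

Lemma energy_ge0 f a b : 0 <= energy f a b.
Proof. by apply: rint_ge0 => s _; exact: sqr_ge0. Qed.

Lemma extremal_holder g f a b : extremal g f -> 0 <= a -> a <= b -> b <= T ->
  enorm (g b - g a) ^+ 2 <= (b - a) * energy f a b.
Proof.
move=> [Gg vf ir _] a0 ab bT; apply: (velocity_holder vf) => //.
have ir' : intble a b (run g f) by apply: intbleS ir.
exact: (energy_intble S Gg vf ir').
Qed.

Lemma window_dist g f t h s : extremal g f -> 0 <= t - h -> t + h <= T -> t - h <= s <= t + h ->
  enorm (g s - g t) <= Num.sqrt (h * energy f (t - h) (t + h)).
Proof.
move=> ex th tT /andP[s1 s2]; have E0 := energy_ge0 f (t - h) (t + h).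
have h0 : 0 <= h by lra.
suff : enorm (g s - g t) ^+ 2 <= h * energy f (t - h) (t + h).
  by move=> /ler_wsqrtr; rewrite sqrtr_sqr ger0_norm.
have [st|/ltW ts] := leP s t.
- rewrite enormBC; apply: le_trans (extremal_holder ex _ st _) _; [lra|lra|].
  apply: ler_pM; [lra|exact: energy_ge0|lra|].
  by apply: (energy_sub ex) => //; lra.
- apply: le_trans (extremal_holder ex _ ts _) _; [lra|lra|].
  apply: ler_pM; [lra|exact: energy_ge0|lra|].
  by apply: (energy_sub ex) => //; lra.
Qed.

Definition slope g (a b : R) : V := (b - a)^-1 *: (g b - g a).

Lemma slope_energy g f a b : extremal g f -> 0 <= a -> a < b -> b <= T ->
  (b - a) * enorm (slope g a b) ^+ 2 <= energy f a b.
Proof.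
move=> ex a0 ab bT; have := extremal_holder ex a0 (ltW ab) bT; have h0 : 0 < b - a by rewrite subr_gt0.
rewrite /slope enormZ exprMn real_normK ?num_real //; move: (enorm _ ^+ 2) => D.
rewrite (_ : (b - a) * ((b - a)^-1 ^+ 2 * D) = D / (b - a)); last by field; rewrite gt_eqF.
by rewrite ler_pdivrMr // mulrC.
Qed.

Let combine (A B C l c1 c2 E W h k : R) : 0 < k -> 0 <= c1 -> 0 <= c2 -> W <= E -> 0 <= h ->
  A + l / (2 * k) + B - c1 * (h + E) <= C -> C <= A + B + c2 * (h + W) ->
  l <= 2 * k * (c1 + c2) * (h + E).
Proof.
move=> k0 c10 c20 WE h0 h1 h2.
have k2 : 0 < 2 * k by rewrite mulr_gt0.
have : l / (2 * k) <= (c1 + c2) * (h + E).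
  have : c2 * (h + W) <= c2 * (h + E) by rewrite ler_wpM2l // lerD2l.
  lra.
by rewrite ler_pdivrMr // => /le_trans; apply; rewrite le_eqVlt; apply/orP; left; apply/eqP; ring.
Qed.

Lemma chord_const_ge0 (E : R) : 0 <= E -> 0 <= chord_const kappa M mu E.
Proof.
move=> E0; have mu0 := ltW (mu_gt0 S); have k0 := kappa_ge0 S; have M0 := M_nonneg S.
by rewrite /chord_const !addr_ge0 ?mulr_ge0 ?addr_ge0 ?sqr_ge0 ?mulr_ge0.
Qed.

(** Equality in dynamic programming confronts the lower bound on the arc with the upper bound on the
    chord, at the same centre and mean slope. The leading terms cancel, and the variance is left
    against errors that all carry the factor [d]. *)
Lemma window_excess g f t h r e : extremal g f -> 0 < h -> 0 <= t - h -> t + h <= T ->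
  0 < r -> r <= 1 -> chord_at O (g t) r e -> (forall y, enorm (y - g t) < r * (1 + enorm e) -> U y) ->
  let d := Num.sqrt (h * energy f (t - h) (t + h)) in d < r ->
  rint (t - h) (t + h) (fun s => enorm (f s - slope g (t - h) (t + h)) ^+ 2) <=
  2 * mu * (M + 2 * mu + kappa + chord_const kappa M mu (enorm e)) * d * (2 * h + energy f (t - h) (t + h)).
Proof.
move=> ex h0 th tT r0 r1 ch rU d dr; have [Gg vf ir dpp] := ex.
have ab : t - h < t + h by lra.
have cx : closure O (g t) by have [_ cg] := Gg; apply: cg; apply/andP; split; lra.
have bE : t + h - (t - h) = 2 * h by ring.
have d0 : 0 <= d by exact: sqrtr_ge0.
have rU' y : enorm (y - g t) < r -> U y.
  by move=> yr; apply: rU; apply: lt_le_trans yr _; rewrite ler_peMr ?lerDl // ltW.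
have dd s : t - h <= s <= t + h -> enorm (g s - g t) <= d by exact: window_dist ex th tT.
have ir' : intble (t - h) (t + h) (run g f) by apply: intbleS ir.
have lo := run_lower S cx rU' Gg vf th ab tT ir' d0 dr dd (erefl (slope g (t - h) (t + h))).
have ca s : 0 <= s <= T -> closure O (g s) by have [_ cg] := Gg; exact: cg.
have up := chord_upper S cx ch rU r1 th ab tT (ca (t - h) ltac:(apply/andP; split; lra)) (ca (t + h) ltac:(apply/andP; split; lra))
  (dd (t - h) ltac:(apply/andP; split; lra)) (dd (t + h) ltac:(apply/andP; split; lra)) dr (erefl (slope g (t - h) (t + h))).
rewrite dpp // in lo; last lra.
have se := slope_energy ex th ab tT.
rewrite bE in lo up se.
have mu0 := mu_gt0 S; have k0 := kappa_ge0 S; have M0 := M_nonneg S.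
have cc := chord_const_ge0 (enorm_ge0 e).
have c1 : 0 <= (M + 2 * mu + kappa) * d by rewrite mulr_ge0 // !addr_ge0 // mulr_ge0 // ltW.
have c2 : 0 <= chord_const kappa M mu (enorm e) * d by rewrite mulr_ge0.
have h2 : 0 <= 2 * h by rewrite mulr_ge0 // ltW.
have {}up : u (t - h) (g (t - h)) - u (t + h) (g (t + h)) <=
   2 * h * L (g t) (slope g (t - h) (t + h)) + Fint T F m (g t) (t - h) (t + h) +
   chord_const kappa M mu (enorm e) * d * (2 * h + 2 * h * enorm (slope g (t - h) (t + h)) ^+ 2).
  rewrite lerBlDl; apply: le_trans up _; rewrite !addrA lerD2l -mulrA ler_wpM2l //.
  by rewrite mulrDl mul1r mulrC (mulrC (_ ^+ 2)).
have := combine mu0 c1 c2 se h2 lo up; move/le_trans; apply.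
by rewrite le_eqVlt; apply/orP; left; apply/eqP; ring.
Qed.

Lemma slope_variance g f a b : extremal g f -> 0 <= a -> a < b -> b <= T ->
  energy f a b = rint a b (fun s => enorm (f s - slope g a b) ^+ 2) + (b - a) * enorm (slope g a b) ^+ 2.
Proof.
move=> [Gg vf ir _] a0 ab bT; have ir' : intble a b (run g f) by apply: intbleS ir.
have [_ ->] := velocity_variance (slope g a b) vf a0 (ltW ab) bT (energy_intble S Gg vf ir').
have <- : (b - a) *: slope g a b = g b - g a.
  by rewrite /slope scalerA divff ?scale1r // gt_eqF // subr_gt0.
by rewrite dotvZr enorm_sqr -/(energy f a b); ring.
Qed.

(** Jensen on the subwindow: the integral of |f - w|^2 dominates the squared distance from [w] to
    the mean slope. *)
Lemma slope_dist g f a b a' b' w : extremal g f -> 0 <= a -> a <= a' -> a' < b' -> b' <= b -> b <= T ->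
  (b' - a') * enorm (slope g a' b' - w) ^+ 2 <= rint a b (fun s => enorm (f s - w) ^+ 2).
Proof.
move=> ex a0 aa ab bb bT; have [Gg vf ir _] := ex.
have a0' : 0 <= a' by exact: le_trans aa.
have bT' : b' <= T by exact: le_trans bT.
have ab' : a <= b by rewrite (le_trans aa) // (le_trans (ltW ab)).
have ie : intble a b (fun s => enorm (f s) ^+ 2).
  by apply: (energy_intble S Gg vf); apply: intbleS ir.
have ie' : intble a' b' (fun s => enorm (f s) ^+ 2) by apply: intbleS ie.
have [iv _] := velocity_variance w vf a0 ab' bT ie.
have [_ E] := velocity_variance w vf a0' (ltW ab) bT' ie'.
have se := slope_energy ex a0' ab bT'.
apply: (@le_trans _ _ (rint a' b' (fun s => enorm (f s - w) ^+ 2))); last first.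
  by apply: rint_sub => //; [exact: ltW|move=> s _; exact: sqr_ge0].
have dE : dotv w (g b' - g a') = (b' - a') * dotv w (slope g a' b').
  by rewrite /slope dotvZr mulrA divff ?mul1r // gt_eqF // subr_gt0.
rewrite E sq_sub dE; move: se; rewrite -/(energy f a' b').
move: (energy f a' b') (dotv w (slope g a' b')) (enorm w ^+ 2) (enorm (slope g a' b') ^+ 2) => A B C D se.
by rewrite -subr_ge0; apply: le_trans (_ : 0 <= A - (b' - a') * D) _; [rewrite subr_ge0|rewrite le_eqVlt; apply/orP; left; apply/eqP; ring].
Qed.

(** With [q] at most 1/2 the part of the energy on the right is absorbed by the left side, and the
    energy becomes comparable with that of uniform motion. *)
Let window_small (D E h q W : R) : 0 <= h -> 0 <= W -> 0 <= q -> q <= 1 / 2 ->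
  D <= q * (2 * h + E) -> E = D + 2 * h * W -> 0 <= E ->
  E <= 2 * h + 4 * h * W /\ D <= q * (4 * h * (1 + W)).
Proof.
move=> h0 W0 q0 q2 Dq EE E0.
have : q * (2 * h + E) <= 1 / 2 * (2 * h + E) by rewrite ler_wpM2r // addr_ge0 // mulr_ge0.
move=> h1; have h2 : E <= 2 * h + 4 * h * W by nra.
split => //; apply: le_trans Dq _; rewrite ler_wpM2l //; lra.
Qed.

Lemma extremal_window g f t : extremal g f -> 0 < t < T -> exists h0, [/\ 0 < h0, h0 <= t, t + h0 <= T &
  forall k h, 0 < h -> h = h0 / 16 ^+ k ->
    energy f (t - h) (t + h) <= 2 * h + 4 * h * enorm (slope g (t - h) (t + h)) ^+ 2 /\
    forall a b, t - h <= a -> b <= t + h -> h / 16 <= b - a ->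
      enorm (slope g a b - slope g (t - h) (t + h)) <= 1 / 4 / 2 ^+ k * (1 + enorm (slope g (t - h) (t + h)))].
Proof.
move=> ex /andP[t0 tT]; have [Gg vf ir dpp] := ex.
have cx : closure O (g t) by have [_ cg] := Gg; apply: cg; rewrite !ltW.
have [r [e [r0 r1 ch rU]]] := good_chord cx.
pose Et := energy f 0 T; have Et0 : 0 <= Et by exact: energy_ge0.
pose C1 := 2 * mu * (M + 2 * mu + kappa + chord_const kappa M mu (enorm e)).
have C10 : 0 <= C1.
  have mu0 := ltW (mu_gt0 S); have k0 := kappa_ge0 S; have M0 := M_nonneg S.
  have cc := chord_const_ge0 (enorm_ge0 e); have m2 : 0 <= 2 * mu by rewrite mulr_ge0.
  exact: mulr_ge0 m2 (addr_ge0 (addr_ge0 (addr_ge0 M0 m2) k0) cc).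
(* 16 comes from the shortest subwindow, 4 from [window_small], and (1/4)^2 is the square of the
   slope error aimed at. *)
have [c [c0 c2 cE]] : exists c : R, [/\ 0 < c, c <= 1 / 2 & 16 * c * 4 = (1 / 4) ^+ 2].
  by exists ((1 / 4) ^+ 2 / 16 / 4); split; [rewrite !mulr_gt0 ?exprn_gt0 ?invr_gt0|lra|field].
pose C2 := C1 * Num.sqrt Et; have C20 : 0 <= C2 by rewrite mulr_ge0 ?sqrtr_ge0.
(* [b1] keeps the displacement below [r], where chords are available; [b2] brings the excess factor
   [C1 * d] below [c / 4 ^+ k]. *)
pose b1 := (r / 2) ^+ 2 / (Et + 1); pose b2 := (c / (C2 + 1)) ^+ 2.
have Et1 : 0 < Et + 1 by rewrite ltr_wpDl.
have C21 : 0 < C2 + 1 by rewrite ltr_wpDl.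
have b10 : 0 < b1 by rewrite divr_gt0 // exprn_gt0 // divr_gt0.
have b20 : 0 < b2 by rewrite exprn_gt0 // divr_gt0.
pose h0 := Num.min (Num.min t (T - t)) (Num.min b1 b2).
have h00 : 0 < h0 by rewrite !lt_min t0 subr_gt0 tT b10 b20.
have h0t : h0 <= t by rewrite !ge_min lexx.
have h0T : h0 <= T - t by rewrite !ge_min lexx orbT.
have h0b1 : h0 <= b1 by rewrite !ge_min lexx !orbT.
have h0b2 : h0 <= b2 by rewrite !ge_min lexx !orbT.
exists h0; split => //; first by rewrite -lerBrDl.
move=> k h hp hE.
have p16 : 1 <= 16 ^+ k :> R by rewrite exprn_ege1 // ler1n.
have hh0 : h <= h0 by rewrite hE ler_pdivrMr ?exprn_gt0 // ler_peMr // ltW.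
have th : 0 <= t - h by rewrite subr_ge0 (le_trans hh0).
have tT' : t + h <= T by rewrite -lerBrDl (le_trans hh0).
have ab : t - h < t + h by lra.
set E := energy f (t - h) (t + h); have E0 : 0 <= E by exact: energy_ge0.
have EEt : E <= Et by apply: (energy_sub ex) => //; lra.
pose d := Num.sqrt (h * E).
have dle : d <= Num.sqrt h * Num.sqrt Et.
  by rewrite -sqrtrM ?(ltW hp) // ler_wsqrtr // ler_wpM2l // ltW.
have dr : d < r.
  apply: (@le_lt_trans _ _ (r / 2)); last by rewrite ltr_pdivrMr // ltr_pMr // ltr1n.
  rewrite -[leRHS](ger0_norm (x := r / 2)) ?divr_ge0 ?(ltW r0) // -sqrtr_sqr ler_wsqrtr //.
  apply: (@le_trans _ _ (b1 * (Et + 1))); last by rewrite /b1 divfK // gt_eqF.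
  by apply: ler_pM; rewrite ?(ltW hp) //; [exact: le_trans h0b1|rewrite (le_trans EEt) // lerDl].
have ewx := window_excess ex hp th tT' r0 r1 ch rU dr.
set w := slope g (t - h) (t + h) in ewx *; set D := rint _ _ _ in ewx.
have bE : t + h - (t - h) = 2 * h by ring.
have EE : E = D + 2 * h * enorm w ^+ 2.
  by rewrite /E (slope_variance ex th ab tT') bE.
have s4 : Num.sqrt h = Num.sqrt h0 / 4 ^+ k.
  rewrite hE sqrtrM ?(ltW h00) //; congr (_ * _).
  have -> : (16 ^+ k)^-1 = ((4 ^+ k)^-1) ^+ 2 :> R.
    have -> : 16 = 4 ^+ 2 :> R by ring.
    by rewrite -exprM mulnC exprM exprVn.
  by rewrite sqrtr_sqr ger0_norm // invr_ge0 exprn_ge0.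
have sh0 : C2 * Num.sqrt h0 <= c.
  have : Num.sqrt h0 <= c / (C2 + 1).
    apply: le_trans (ler_wsqrtr h0b2) _; by rewrite sqrtr_sqr ger0_norm // divr_ge0 ?(ltW c0) ?(ltW C21).
  rewrite ler_pdivlMr // mulrDr mulr1 mulrC => h1; apply: le_trans h1.
  by rewrite lerDl sqrtr_ge0.
pose q := c / 4 ^+ k : R.
have p4 : 0 < 4 ^+ k :> R by rewrite exprn_gt0.
have p41 : 1 <= 4 ^+ k :> R by rewrite exprn_ege1 // ler1n.
have q0 : 0 <= q by rewrite divr_ge0 ?(ltW c0) ?(ltW p4).
have q2 : q <= 1 / 2.
  by apply: le_trans c2; rewrite /q ler_pdivrMr // ler_peMr // ltW.
have Dq : D <= q * (2 * h + E).
  apply: le_trans ewx _; rewrite -/C1 ler_wpM2r ?addr_ge0 ?mulr_ge0 ?(ltW hp) //.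
  apply: (@le_trans _ _ (C2 * Num.sqrt h)).
    apply: le_trans (ler_wpM2l C10 dle) _.
    by rewrite /C2 le_eqVlt; apply/orP; left; apply/eqP; ring.
  by rewrite s4 mulrA /q ler_wpM2r // invr_ge0 ltW.
have [Eh Dh] := window_small (ltW hp) (sqr_ge0 (enorm w)) q0 q2 Dq EE E0.
split => // a b ta tb lab.
have l0 : 0 < b - a by apply: lt_le_trans lab; rewrite divr_gt0.
have ab2 : a < b by rewrite -subr_gt0.
have sd := slope_dist w ex th ta ab2 tb tT'.
have {}sd : (b - a) * enorm (slope g a b - w) ^+ 2 <= q * (4 * h * (1 + enorm w ^+ 2)) by exact: le_trans sd Dh.
have X2 : enorm (slope g a b - w) ^+ 2 <= 16 * q * 4 * (1 + enorm w ^+ 2).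
  have : h / 16 * enorm (slope g a b - w) ^+ 2 <= q * (4 * h * (1 + enorm w ^+ 2)).
    by apply: le_trans sd; rewrite ler_wpM2r // sqr_ge0.
  rewrite mulrAC ler_pdivrMr // mulrC => X.
  rewrite -(ler_pM2r hp); apply: le_trans X _; rewrite le_eqVlt; apply/orP; left; apply/eqP; ring.
have W0 := enorm_ge0 w.
suff : enorm (slope g a b - w) ^+ 2 <= (1 / 4 / 2 ^+ k * (1 + enorm w)) ^+ 2.
  by rewrite ler_pXn2r ?nnegrE // mulr_ge0 ?addr_ge0 // divr_ge0 // exprn_ge0.
apply: le_trans X2 _.
have -> : 16 * q * 4 * (1 + enorm w ^+ 2) = (1 / 4) ^+ 2 / 4 ^+ k * (1 + enorm w ^+ 2).
  by rewrite -cE /q; ring.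
have -> : (1 / 4 / 2 ^+ k * (1 + enorm w)) ^+ 2 = (1 / 4) ^+ 2 / 4 ^+ k * (1 + enorm w) ^+ 2 :> R.
  have -> : 4 ^+ k = (2 ^+ k) ^+ 2 :> R.
    have -> : 4 = 2 ^+ 2 :> R by ring.
    by rewrite -!exprM mulnC.
  by field; rewrite expf_neq0.
rewrite ler_wpM2l ?divr_ge0 ?sqr_ge0 ?(ltW p4) // sqrrD expr1n mul1r.
by rewrite lerD2r lerDl mulrn_wge0.
Qed.

(* A Campanato iteration on windows shrinking by 16, along which the mean slopes form a geometric Cauchy sequence. *)
Lemma extremal_derivable g f t : extremal g f -> 0 < t < T -> exists h0 v C, [/\ 0 < h0, h0 <= t, t + h0 <= T,
  forall h, 0 < h -> h <= h0 -> energy f (t - h) (t + h) <= C * h &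
  forall e, 0 < e -> exists2 d, 0 < d & forall h, 0 < h -> h < d -> h <= h0 ->
    enorm (slope g t (t + h) - v) <= e /\ enorm (slope g (t - h) t - v) <= e].
Proof.
move=> ex tT; have [h0 [h00 h0t h0T H]] := extremal_window ex tT.
pose hk k := h0 / 16 ^+ k.
have p16 k : 0 < 16 ^+ k :> R by rewrite exprn_gt0.
have hk0 k : 0 < hk k by rewrite divr_gt0.
have hkS k : hk k.+1 = hk k / 16 by rewrite /hk exprS invfM mulrA mulrAC.
pose w k := slope g (t - hk k) (t + hk k).
have Hk k := H k (hk k) (hk0 k) erefl.
have step k : enorm (w k.+1 - w k) <= 1 / 4 / 2 ^+ k * (1 + enorm (w k)).
  have [_ h] := Hk k; apply: h; rewrite hkS; have := hk0 k; lra.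
have gr := dyadic_growth step; pose W := 1 + enorm (w 0%N).
have W0 : 0 <= W by rewrite addr_ge0.
have p2 k : 0 < 2 ^+ k :> R by rewrite exprn_gt0.
have step2 k a b : t - hk k <= a -> b <= t + hk k -> hk k / 16 <= b - a -> enorm (slope g a b - w k) <= W / 2 / 2 ^+ k.
  move=> h1 h2 h3; have [_ h] := Hk k; apply: le_trans (h a b h1 h2 h3) _.
  apply: (@le_trans _ _ (1 / 4 / 2 ^+ k * (2 * W))).
    by apply: ler_wpM2l; [rewrite divr_ge0 ?divr_ge0 // ltW|have := gr k; rewrite -/W; lra].
  by rewrite le_eqVlt; apply/orP; left; apply/eqP; field; rewrite gt_eqF.
have [v vP] : exists v, forall k, enorm (w k - v) <= n%:R * (2 * (W / 2) / 2 ^+ k).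
  apply: dyadic_limitv; first by rewrite divr_ge0.
  by move=> k; apply: step2; rewrite hkS; have := hk0 k; lra.
(* One step inside the window plus the distance from [w k] to the limit. *)
pose K := W / 2 + n%:R * W.
have sl k a b : t - hk k <= a -> b <= t + hk k -> hk k / 16 <= b - a -> enorm (slope g a b - v) <= K / 2 ^+ k.
  move=> h1 h2 h3; apply: le_trans (enorm_dist (w k) _ _) _.
  apply: le_trans (lerD (step2 k a b h1 h2 h3) (vP k)) _.
  by rewrite le_eqVlt; apply/orP; left; apply/eqP; rewrite /K; field; rewrite gt_eqF.
(* At the scale [hk k] the energy is at most [hk k * (2 + 16 * W ^+ 2)], and [hk k] is below
   [16 * h]. *)
exists h0, v, (16 * (2 + 16 * W ^+ 2)); split => //.
- move=> h hp hh; have [k /andP[kh hk']] := scale16 hp hh.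
  rewrite -/(hk k) in hk'; rewrite -/(hk k.+1) hkS in kh.
  have h0k : hk k <= h0.
    by rewrite /hk ler_pdivrMr // ler_peMr ?(ltW h00) // exprn_ege1 // ler1n.
  have [Ek _] := Hk k.
  have : energy f (t - h) (t + h) <= energy f (t - hk k) (t + hk k).
    by apply: (energy_sub ex) => //; have := hk0 k; lra.
  move/le_trans; apply; apply: le_trans Ek _.
  have wk : enorm (w k) <= 2 * W by have := gr k; rewrite -/W; lra.
  have wk2 : enorm (w k) ^+ 2 <= 4 * W ^+ 2.
    have -> : 4 * W ^+ 2 = (2 * W) ^+ 2 by ring.
    by rewrite ler_pXn2r ?nnegrE // mulr_ge0.
  rewrite -/(w k); have := hk0 k; have := sqr_ge0 W; move: (enorm _ ^+ 2) (W ^+ 2) wk2 => A B wk2 B0 hkp.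
  have : 4 * hk k * A <= 4 * hk k * (4 * B) by rewrite ler_wpM2l // mulr_ge0 // ltW.
  nra.
- move=> e e0; have [k0 Kk] := dyadic_small K e0.
  exists (hk k0) => // h hp hd hh; have [k /andP[kh hk']] := scale16 hp hh.
  rewrite -/(hk k) in hk'; rewrite -/(hk k.+1) in kh.
  have kk : (k0 <= k)%N.
    rewrite leqNgt; apply/negP => kk; move: (lt_trans kh hd); apply/negP; rewrite -leNgt.
    by rewrite /hk ler_pM2l // lef_pV2 ?posrE // ler_eXn2l ?ltr1n.
  have K0 : 0 <= K by rewrite /K addr_ge0 ?divr_ge0 ?mulr_ge0.
  have Ke : K / 2 ^+ k <= e.
    apply: le_trans Kk; rewrite ler_wpM2l // lef_pV2 ?posrE // ler_eXn2l ?ltr1n //.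
  rewrite hkS in kh.
  by split; apply: le_trans Ke; apply: sl; have := hk0 k; lra.
Qed.

End Regularity.

(** * Expansion of the value function *)

Section Expansion.
Context {R : realType} {n : nat}.
Local Notation V := 'rV[R]_n.
Variables (O U : set V) (T : R) (L : V -> V -> R) (F G : V -> Prob R n -> R)
  (kappa M mu : R) (u : R -> V -> R) (m : R -> Prob R n).
Hypothesis S : setting O U T L F G kappa M mu u m.
Let T0 := T_gt0 S.
Local Notation run := (run T L F m).
Local Notation Fint := (Fint T F m).
Implicit Types (g f : R -> V).

Lemma Fint_near x t : closure O x -> 0 <= t <= T -> forall e, 0 < e -> exists2 d, 0 < d &
  forall a b, 0 <= a -> a <= b -> b <= T -> t - d < a -> b < t + d ->
  `|Fint x a b - (b - a) * F x (m t)| <= e * (b - a).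
Proof.
move=> cx tT e e0; have [d d0 H] := F_time S tT e0; exists d => // a b a0 ab bT ta tb.
have iF : intble a b (fun s => F x (m (clamp T s))) by apply: intble_continuous; exact: (Fx_continuous S).
have Hs s : a <= s <= b -> F x (m t) - e <= F x (m (clamp T s)) <= F x (m t) + e.
  move=> /andP[as_ sb]; have sT : 0 <= s <= T by rewrite (le_trans a0 as_) (le_trans sb bT).
  rewrite clamp_id //; have := H s x sT _ (OU S cx); rewrite !ltr_norml.
  have -> : - d < s - t < d by apply/andP; split; lra.
  by move=> /(_ isT) /andP[h1 h2]; apply/andP; split; lra.
have lo := rint_le (intble_cst a b _) iF (fun s h => proj1 (andP (Hs s h))).
have up := rint_le iF (intble_cst a b _) (fun s h => proj2 (andP (Hs s h))).
rewrite rint_cst // -/(Fint x a b) in lo; rewrite rint_cst // -/(Fint x a b) in up.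
by rewrite ler_norml; apply/andP; split; nra.
Qed.

Lemma Fint_split x a b c : closure O x -> a <= b -> b <= c -> Fint x a c = Fint x a b + Fint x b c.
Proof.
by move=> cx ab bc; apply: rint_split => //; apply: intble_continuous; exact: (Fx_continuous S).
Qed.

(** One end of an arc is moved from [t] to [a] and the other is kept, once for each direction of
    time. The common part cancels and only the interval between [a] and [t] contributes. *)
Lemma Fint_shift x t : closure O x -> 0 <= t <= T -> forall e, 0 < e -> exists2 d, 0 < d &
  forall a c, 0 <= a <= T -> `|a - t| < d ->
  (a <= c -> t <= c -> c <= T -> Fint x a c - Fint x t c <= (t - a) * F x (m t) + e * `|a - t|) /\
  (c <= a -> c <= t -> 0 <= c -> Fint x c a - Fint x c t <= (a - t) * F x (m t) + e * `|a - t|).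
Proof.
move=> cx /andP[t0 tT] e e0; have [d d0 H] := Fint_near cx (introT andP (conj t0 tT)) e0.
exists d => // a c /andP[a0 aT]; rewrite ltr_norml => /andP[ad1 ad2].
have [at_|/ltW ta] := leP a t.
- have := H a t a0 at_ tT; rewrite ler_norml (distrC a) ger0_norm ?subr_ge0 //.
  move=> /(_ ltac:(lra) ltac:(lra)) /andP[h1 h2].
  split=> [ac tc cT|ca ct c0].
    by rewrite (Fint_split cx at_ tc); lra.
  by rewrite (Fint_split cx ca at_); lra.
- have := H t a t0 ta aT; rewrite ler_norml ger0_norm ?subr_ge0 //.
  move=> /(_ ltac:(lra) ltac:(lra)) /andP[h1 h2].
  split=> [ac tc cT|ca ct c0].
    by rewrite (Fint_split cx ta ac); lra.
  by rewrite (Fint_split cx ct ta); lra.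
Qed.

(** Compares a chord of duration [l] with an arc of duration [h]; the equation between the linear
    terms expresses that they differ only by the displacement of one end point. *)
Let core_alg (l h Lw L1 L0 a b c X mu2 q : R) : 0 <= l -> 0 <= h ->
  Lw <= L0 + a + mu2 * X -> L0 + b + q <= L1 -> 0 <= q -> l * a = h * b + c ->
  l * Lw - h * L1 <= (l - h) * L0 + c + mu2 * (l * X).
Proof.
move=> l0 h0 h1 h2 q0 E.
have k1 : l * Lw <= l * (L0 + a + mu2 * X) by rewrite ler_wpM2l.
have k2 : h * (L0 + b) <= h * L1 by rewrite ler_wpM2l //; lra.
nra.
Qed.

Let core_sq (l h K t A eta N : R) : 2 <= K -> 0 < eta -> h = K * eta -> `|l - h| <= eta ->
  0 <= N -> 0 <= t -> 0 <= A ->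
  l * N <= h * t + A * eta -> l * N ^+ 2 <= 4 * eta * (K * t ^+ 2 + A ^+ 2 / K).
Proof.
move=> K2 e0 hE; rewrite ler_norml => /andP[l1 l2] N0 t0 A0 lN.
have K0 : 0 < K by lra.
have h0 : 0 < h by rewrite hE mulr_gt0.
have lh : h / 2 <= l by have : 2 * eta <= h by [rewrite hE ler_pM2r]; lra.
have l0 : 0 < l by lra.
have h1 : (l * N) ^+ 2 <= (h * t + A * eta) ^+ 2.
  by rewrite ler_pXn2r ?nnegrE ?addr_ge0 ?mulr_ge0 // ltW.
have h2 : (h * t + A * eta) ^+ 2 <= 2 * (h ^+ 2 * t ^+ 2 + A ^+ 2 * eta ^+ 2).
  by have := sqr_ge0 (h * t - A * eta); nra.
have h3 : h / 2 * (l * N ^+ 2) <= (l * N) ^+ 2.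
  have -> : (l * N) ^+ 2 = l * (l * N ^+ 2) by ring.
  by rewrite ler_wpM2r // mulr_ge0 ?sqr_ge0 // ltW.
have h4 := le_trans h3 (le_trans h1 h2).
have hh : 0 < h / 2 by lra.
rewrite -(ler_pM2l hh); apply: le_trans h4 _; rewrite le_eqVlt; apply/orP; left; apply/eqP.
by rewrite hE; field; rewrite gt_eqF.
Qed.

Let core_err (c h W X e eta : R) : X <= c * h * (1 + W) * (2 * h) ->
  4 * (c + 1) * (2 + W) * h * h <= e * eta -> 0 <= h * h * (2 + W) -> 0 <= c * (h * h) ->
  X + c * h * h <= e / 2 * eta.
Proof. by move=> h1 h2 h3 h4; lra. Qed.

Let core_sum (a b P Q X Y Z e eta : R) : a - b <= P + Q + X -> Y + Z <= e / 2 * eta -> X <= e / 2 * eta ->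
  a + Y - b + Z <= P + Q + e * eta.
Proof. by lra. Qed.

Let core_quarter (a b e : R) : a <= e -> b <= e -> (a + b) / 4 <= e / 2.
Proof. by lra. Qed.

(* [K] absorbs the error due to the displacement [xi]; it is fixed before the slope error [tau] and the size [h1]. *)
Lemma expand_step x v c A e : U x -> 0 <= c -> 0 <= A -> 0 < e ->
  exists K tau h1, [/\ 2 <= K, 0 < tau, 0 < h1 &
  forall eta h l th xi w, 0 < eta -> h = K * eta -> h <= h1 -> `|l - h| <= eta ->
    enorm th <= tau -> enorm xi <= A * eta -> l *: (w - v) = h *: th + xi ->
    l * L x w + c * h * (1 + enorm w ^+ 2) * l - h * L x (v + th) + c * h * h <=
    (l - h) * L x v + dotv (gradv L x v) xi + e * eta].
Proof.
move=> Ux c0 A0 e0; have mu0 := mu_gt0 S; have mu2 : 0 < mu / 2 by rewrite divr_gt0.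
(* The displacement adds at most 2 mu eta A^2 / K to the Taylor remainder, which this choice brings
   below e eta / 4; [2 <= K] keeps [l] at least [h / 2]. *)
pose K := 2 + 8 * mu * A ^+ 2 / e.
have K2 : 2 <= K by rewrite lerDl divr_ge0 ?mulr_ge0 ?sqr_ge0 // ltW.
have K0 : 0 < K by exact: lt_le_trans K2.
have KA : 8 * mu * (A ^+ 2 / K) <= e.
  have : 8 * mu * A ^+ 2 / e <= K by rewrite lerDr.
  rewrite ler_pdivrMr // => h; rewrite (_ : _ * (_ / K) = 8 * mu * A ^+ 2 / K); last by ring.
  by rewrite ler_pdivrMr // (mulrC e).
pose tau := Num.min 1 (e / (8 * mu * K)).
have mK : 0 < 8 * mu * K by rewrite !mulr_gt0.
have tau0 : 0 < tau by rewrite lt_min ltr01 divr_gt0.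
have tau1 : tau <= 1 by rewrite ge_min lexx.
have tauK : 8 * mu * (K * tau ^+ 2) <= e.
  have : tau <= e / (8 * mu * K) by rewrite ge_min lexx orbT.
  rewrite ler_pdivlMr // => h; apply: le_trans h; rewrite mulrA mulrC ler_pM2r // expr2 ler_piMl // ltW //.
pose W := enorm v + 2 * (1 + A).
have W0 : 0 <= W by rewrite addr_ge0 // mulr_ge0 // addr_ge0.
pose Q := 4 * (c + 1) * (2 + W ^+ 2) * K.
have Q0 : 0 < Q.
  have c1 : 0 < c + 1 by rewrite ltr_wpDl.
  have w2 : 0 < 2 + W ^+ 2 by rewrite ltr_wpDr // sqr_ge0.
  exact: mulr_gt0 (mulr_gt0 (mulr_gt0 (ltr0n _ 4) c1) w2) K0.
exists K, tau, (e / Q); split => //; first by rewrite divr_gt0.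
move=> eta h l th xi w eta0 hE hh1 lh tht xiA lw.
have h0 : 0 < h by rewrite hE mulr_gt0.
have /andP[l1 l2] : - eta <= l - h <= eta by rewrite -ler_norml.
have ee : 2 * eta <= h by rewrite hE ler_pM2r.
have l0 : 0 < l by lra.
have l2h : l <= 2 * h by lra.
have lN : l * enorm (w - v) <= h * tau + A * eta.
  rewrite -{1}(gtr0_norm l0) -enormZ lw; apply: le_trans (enormD _ _) _.
  by rewrite enormZ gtr0_norm // lerD // ler_wpM2l // ltW.
have sq := core_sq K2 eta0 hE lh (enorm_ge0 _) (ltW tau0) A0 lN.
have wW : enorm w <= W.
  have : enorm w <= enorm v + enorm (w - v) by have := enormD v (w - v); rewrite addrC subrK.
  move/le_trans; apply; rewrite /W lerD2l.
  have : h / 2 * enorm (w - v) <= h * (1 + A).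
    apply: (@le_trans _ _ (l * enorm (w - v))); first by rewrite ler_wpM2r //; lra.
    apply: le_trans lN _; rewrite mulrDr lerD ?ler_wpM2l ?(ltW h0) // mulrC ler_wpM2r //; lra.
  by rewrite -mulrA ler_pM2l // mulrC ler_pdivrMr // mulrC.
have W2 : enorm w ^+ 2 <= W ^+ 2 by rewrite ler_pXn2r ?nnegrE.
have t1 := L_taylor_ub (L_C1 S) (L_1 S) v w Ux.
have t2 := L_taylor_lb (L_C1 S) (L_1 S) v (v + th) Ux.
rewrite (addrC v th) addrK (addrC th v) in t2.
have q0 : 0 <= enorm th ^+ 2 / (2 * mu) by rewrite divr_ge0 ?sqr_ge0 // mulr_ge0 // ltW.
have dE : l * dotv (gradv L x v) (w - v) = h * dotv (gradv L x v) th + dotv (gradv L x v) xi.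
  by rewrite -!dotvZr lw dotvDr.
have a1 := core_alg (ltW l0) (ltW h0) t1 t2 q0 dE.
move: a1 W2 sq hh1; move: (L x w) (L x (v + th)) (L x v) (dotv _ xi) (enorm w ^+ 2) (enorm (w - v) ^+ 2).
move=> B1 B2 B3 B4 N X a1 W2 sq hh1.
have a2 : c * h * (1 + N) * l + c * h * h <= e / 2 * eta.
  have b1 : c * h * (1 + N) * l <= c * h * (1 + W ^+ 2) * (2 * h).
    have ch : 0 <= c * h by rewrite mulr_ge0 // ltW.
    apply: (@le_trans _ _ (c * h * (1 + W ^+ 2) * l)).
      by rewrite ler_wpM2r ?(ltW l0) // ler_wpM2l // lerD2l.
    by rewrite ler_wpM2l // mulr_ge0 // addr_ge0 // sqr_ge0.
  have b2 : h * Q <= e by rewrite -ler_pdivlMr.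
  have b3 : h * Q * eta <= e * eta by rewrite ler_wpM2r // ltW.
  have b4 : h * Q * eta = 4 * (c + 1) * (2 + W ^+ 2) * h * h by rewrite /Q hE; ring.
  have b5 : 0 <= h * h * (2 + W ^+ 2) by rewrite !mulr_ge0 ?addr_ge0 ?sqr_ge0 // ltW.
  have b6 : 0 <= c * (h * h) by rewrite !mulr_ge0 // ltW.
  rewrite b4 in b3; exact: core_err b1 b3 b5 b6.
have a3 : mu / 2 * (l * X) <= e / 2 * eta.
  have : mu / 2 * (l * X) <= mu / 2 * (4 * eta * (K * tau ^+ 2 + A ^+ 2 / K)) by rewrite ler_wpM2l // ltW.
  move/le_trans; apply.
  have -> : mu / 2 * (4 * eta * (K * tau ^+ 2 + A ^+ 2 / K)) =
    (8 * mu * (K * tau ^+ 2) + 8 * mu * (A ^+ 2 / K)) / 4 * eta by field; rewrite gt_eqF.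
  by rewrite ler_wpM2r ?(ltW eta0) //; exact: core_quarter.
exact: core_sum a1 a2 a3.
Qed.

End Expansion.

Section Expansion2.
Context {R : realType} {n : nat}.
Local Notation V := 'rV[R]_n.
Variables (O U : set V) (T : R) (L : V -> V -> R) (F G : V -> Prob R n -> R)
  (kappa M mu : R) (u : R -> V -> R) (m : R -> Prob R n).
Hypothesis S : setting O U T L F G kappa M mu u m.
Let T0 := T_gt0 S.
Local Notation run := (run T L F m).
Local Notation Fint := (Fint T F m).
Implicit Types (g f : R -> V).

Let window_facts (t t' h h0 eta : R) : - eta <= t' - t <= eta -> eta < h -> 0 < h -> h < h0 -> h0 <= t ->
  t + h0 <= T -> 0 < t < T ->
  [/\ [/\ t' < t + h, t - h < t', t < t + h & t - h < t], [/\ t + h <= T, 0 <= t - h, 0 <= t' & t' <= T],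
   [/\ 0 <= t + h <= T, 0 <= t - h <= T, t - h <= t - h <= t + h & t - h <= t + h <= t + h] &
   (forall s, t <= s <= t + h -> t - h <= s <= t + h) /\ (forall s, t - h <= s <= t -> t - h <= s <= t + h)].
Proof.
move=> /andP[h1 h2] h3 h4 h5 h6 h7 /andP[h8 h9].
split; split; try (apply/andP; split); try lra.
all: by move=> s /andP[k1 k2]; apply/andP; split; lra.
Qed.

Let half_sum (a b c : R) : a < c -> b < c -> (a + b) / 2 < c.
Proof. by lra. Qed.

Let one_side (A1 B1 A2 l h Lw Lw0 I1 I2 e1 e2 e1' e2' X Y var : R) :
  A1 <= B1 + l * Lw + I1 + e1 -> h * Lw0 + var + I2 - e2 <= A2 -> 0 <= var ->
  l * Lw + e1' - h * Lw0 + e2' <= X -> I1 - I2 <= Y -> e1 <= e1' -> e2 <= e2' ->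
  A1 - B1 - A2 <= X + Y.
Proof. by lra. Qed.

Let two_sides (d s s' P Q Fx e eta eta' : R) : eta' <= eta -> 0 <= e -> s' = - s ->
  d <= (s' * P + Q + e / 2 * eta) + (s' * Fx + e / 2 * eta') ->
  - d <= (s * P - Q + e / 2 * eta) + (s * Fx + e / 2 * eta') ->
  `|d + s * (P + Fx) - Q| <= e * eta.
Proof.
move=> h1 e0 ->; have : e / 2 * eta' <= e / 2 * eta by rewrite ler_wpM2l // divr_ge0.
by move=> h2 h3 h4; rewrite ler_norml; apply/andP; split; lra.
Qed.

Let err_le (a D c h X : R) : 0 <= a -> a * D <= c -> 0 <= h -> 0 <= X -> a * (D * h) * X <= c * h * X.
Proof. by move=> a0 ac h0 X0; rewrite mulrA ler_wpM2r // ler_wpM2r. Qed.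

(** The arc on [t, t + h], started instead from (t', y), bounds u(t', y) from above; the arc on
    [t - h, t], ended instead at (t', y), bounds it from below. Energy at most C h keeps the arc
    within [D * h] of [g t], so freezing the state costs O(h^2). *)
Lemma expansion g f t : extremal O T L F u m g f -> 0 < t < T -> exists v,
  (forall e, 0 < e -> exists2 d, 0 < d & forall h, 0 < h -> h < d ->
    enorm (slope g t (t + h) - v) <= e /\ enorm (slope g (t - h) t - v) <= e) /\
  forall e, 0 < e -> exists2 d, 0 < d & forall t' y, closure O y -> `|t' - t| < d -> enorm (y - g t) < d ->
   [/\ 0 <= t', t' <= T & `|u t' y - u t (g t) + (t' - t) * (L (g t) v + F (g t) (m t))
      - dotv (gradv L (g t) v) ((t' - t) *: v - (y - g t))| <= e * (`|t' - t| + enorm (y - g t))].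
Proof.
move=> ex tT; have [h0 [v [C [h00 h0t h0T En sl]]]] := extremal_derivable S ex tT.
have [Gg vf ir dpp] := ex; have /andP[t0 t1] := tT.
set x := g t; have cx : closure O x by apply: Gg.2; rewrite !ltW.
have Ux := OU S cx; have [r [ec [r0 r1 ch rU]]] := good_chord S cx.
exists v; split.
  move=> e e0; have [d d0 H] := sl e e0; exists (Num.min d h0); first by rewrite lt_min d0.
  by move=> h hp; rewrite lt_min => /andP[hd hh]; apply: H => //; exact: ltW.
move=> e e0; have e2 : 0 < e / 2 by rewrite divr_gt0.
have C0 : 0 <= C.
  by rewrite -(pmulr_lge0 _ h00); apply: le_trans (energy_ge0 f (t - h0) (t + h0)) (En _ h00 (lexx _)).
pose D := Num.sqrt C + 1; have D0 : 0 < D by rewrite ltr_wpDl ?sqrtr_ge0.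
have D1 : 1 <= D by rewrite lerDr sqrtr_ge0.
pose c1 := M + 2 * mu + kappa; pose cc := chord_const kappa M mu (enorm ec).
have cc0 : 0 <= cc := chord_const_ge0 S (enorm_ge0 ec).
have c10 : 0 <= c1.
  by rewrite !addr_ge0 ?(M_nonneg S) ?(kappa_ge0 S) // mulr_ge0 // ltW // (mu_gt0 S).
(* [D * cc] pays for the chord and [D * c1 * (1 + C)] for the arc. *)
pose c := D * cc + D * c1 * (1 + C); pose A := 1 + enorm v.
have DC0 : 0 <= D * cc by rewrite mulr_ge0 // ltW.
have DC1 : 0 <= D * c1 * (1 + C) := mulr_ge0 (mulr_ge0 (ltW D0) c10) (addr_ge0 ler01 C0).
have A0 : 0 <= A by rewrite addr_ge0.
have [K [tau [h1 [K2 tau0 h10 step]]]] := expand_step S v Ux (addr_ge0 DC0 DC1) A0 e2.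
have K0 : 0 < K by exact: lt_le_trans K2.
have [d1 d10 sl1] := sl tau tau0.
have [d2 d20 FS] := Fint_shift S cx (introT andP (conj (ltW t0) (ltW t1))) e2.
pose hm := Num.min (Num.min h1 (d1 / 2)) (Num.min h0 (r / (2 * D))).
have hm0 : 0 < hm by rewrite !lt_min h10 h00 !divr_gt0 // mulr_gt0.
exists (Num.min (hm / (2 * K)) d2); first by rewrite lt_min d20 divr_gt0 // mulr_gt0.
move=> t' y cy; rewrite !lt_min => /andP[td td2] /andP[yd _].
pose eta := `|t' - t| + enorm (y - x).
have eta_ge0 : 0 <= eta by rewrite addr_ge0.
have etat : `|t' - t| <= eta by rewrite lerDl.
have etay : enorm (y - x) <= eta by rewrite lerDr.
(* Longer than the perturbation, so that [t'] lies strictly between the ends of the window. *)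
pose h := K * eta.
have etah : eta <= h by rewrite /h ler_peMl //; lra.
have hhm : h < hm.
  move: td yd; rewrite !ltr_pdivlMr ?mulr_gt0 // => td yd.
  have -> : h = (`|t' - t| * (2 * K) + enorm (y - x) * (2 * K)) / 2 by rewrite /h /eta; field.
  exact: half_sum td yd.
move: hhm; rewrite !lt_min => /andP[/andP[hh1 hd1] /andP[hh0 hr]].
have {}hr : D * h < r.
  move: hr; rewrite ltr_pdivlMr ?mulr_gt0 // mulrA => hr; apply: le_lt_trans hr.
  by rewrite mulrC ler_wpM2r ?(ltW D0) // ler_peMr ?mulr_ge0 ?(ltW K0) // ler1n.
have tt : - eta <= t' - t <= eta by rewrite -ler_norml.
have t'T0 : 0 <= t' /\ t' <= T by move: tt => /andP[? ?]; split; lra.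
have [t'0 t'T] := t'T0.
split => //; have [eta0|etaz] := ltP 0 eta; last first.
  have t'E : t' = t by apply/eqP; rewrite -subr_eq0 -normr_le0 (le_trans etat).
  have yE : y = x by apply/eqP; rewrite -subr_eq0 -enorm_eq0 eq_le enorm_ge0 (le_trans etay).
  by rewrite t'E yE !subrr mul0r scale0r subr0 dotv0r !addr0 subr0 normr0 enorm0 addr0 mulr0.
have hp : 0 < h by rewrite mulr_gt0.
have etah' : eta < h by rewrite /h ltr_pMl // (lt_le_trans _ K2) // ltr1n.
have [[w1 w2 w3 w4] [w5 w6 _ _] [w7 w8 w9 w10] [w11 w12]] := window_facts tt etah' hp hh0 h0t h0T tT.
have Eh := En h hp (ltW hh0).
have dd s : t - h <= s <= t + h -> enorm (g s - x) <= D * h.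
  move=> hs; apply: le_trans (window_dist S ex w6 w5 hs) _.
  apply: (@le_trans _ _ (Num.sqrt (h * (C * h)))); first by rewrite ler_wsqrtr // ler_wpM2l // ltW.
  have -> : h * (C * h) = C * h ^+ 2 by ring.
  by rewrite sqrtrM // sqrtr_sqr gtr0_norm // ler_wpM2r ?(ltW hp) // lerDl.
have rU' z : enorm (z - x) < r -> U z.
  by move=> yr; apply: rU; apply: lt_le_trans yr _; rewrite ler_peMr ?lerDl // ltW.
have yD : enorm (y - x) <= D * h.
  by apply: le_trans etay _; apply: le_trans etah _; rewrite ler_peMl // ltW.
have Dh0 : 0 <= D * h by rewrite mulr_ge0 // ltW.
have hd1' : h < d1 by move: hd1 d10; rewrite ltr_pdivlMr // mulr_natr mulr2n => q1 q2; apply: le_lt_trans q1; rewrite lerDl ltW.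
have [sl2 sl3] := sl1 h hp hd1' (ltW hh0).
have ca s : 0 <= s <= T -> closure O (g s) by exact: Gg.2.
have energies a b : t - h <= a -> a <= b -> b <= t + h -> energy f a b <= C * h.
  by move=> ta ab tb; apply: le_trans Eh; exact: (energy_sub S ex).
have e1_le N l : 0 <= N -> 0 <= l -> cc * (D * h) * (1 + N) * l <= c * h * (1 + N) * l.
  move=> N0 l0; rewrite ler_wpM2r // err_le // ?(ltW hp) ?addr_ge0 //.
  by rewrite mulrC lerDl.
have e2_le E : E <= C * h -> c1 * (D * h) * (h + E) <= c * h * h.
  move=> EC; apply: (@le_trans _ _ (c1 * (D * h) * (h * (1 + C)))).
    by apply: ler_wpM2l; [exact: mulr_ge0 c10 Dh0|rewrite mulrDr mulr1 lerD2l mulrC].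
  have -> : c1 * (D * h) * (h * (1 + C)) = (D * c1 * (1 + C)) * h * h by ring.
  by rewrite !ler_wpM2r ?(ltW hp) // lerDr.
have mu2 : 0 < 2 * mu by rewrite mulr_gt0 // (mu_gt0 S).
have xiA (b : bool) : enorm ((-1) ^+ b *: ((t' - t) *: v - (y - x))) <= A * eta.
  rewrite enormZ normr_sign mul1r; apply: le_trans (enormB _ _) _; rewrite enormZ.
  have : `|t' - t| * enorm v <= eta * enorm v by rewrite ler_wpM2r.
  by move=> k; rewrite /A (_ : (1 + enorm v) * eta = eta * enorm v + eta); [exact: lerD|ring].
have fwd : u t' y - u t x <= (- (t' - t) * L x v + dotv (gradv L x v) ((t' - t) *: v - (y - x)) + e / 2 * eta)
    + (- (t' - t) * F x (m t) + e / 2 * `|t' - t|).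
    have up := chord_upper S cx ch rU r1 t'0 w1 w5 cy (ca (t + h) w7) yD
    (dd (t + h) w10) hr (erefl _).
  have lo := run_lower S cx rU' Gg vf (ltW t0) w3 w5 (intbleS (ltW t0) w5 ir) Dh0 hr
    (fun s hs => dd s (w11 s hs)) (erefl _).
  rewrite (dpp _ _ (ltW t0) (ltW w3) w5) in lo.
  have hE : t + h - t = h by ring.
  rewrite -/(slope g t (t + h)) in lo.
  set w := (t + h - t')^-1 *: (g (t + h) - y) in up; set w0 := slope g t (t + h) in lo sl2.
  have l00 : 0 < t + h - t' by rewrite subr_gt0.
  have lw : (t + h - t') *: (w - v) = h *: (w0 - v) + (-1) ^+ false *: ((t' - t) *: v - (y - x)).
    rewrite !scalerBr /w /w0 /slope !scalerA hE !divff ?gt_eqF // expr0 !scale1r -/x.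
    by apply/rowP => i; rewrite !mxE; ring.
  have st := step eta h (t + h - t') (w0 - v) _ w eta0 erefl (ltW hh1) ltac:(rewrite (_ : _ - h = - (t' - t)) ?normrN //; ring) sl2 (xiA false) lw.
  rewrite (addrC v (w0 - v)) subrK expr0 scale1r in st.
  have [FS1 _] := FS t' (t + h) (introT andP (conj t'0 t'T)) td2.
  have {}FS1 := FS1 (ltW w1) (ltW w3) w5.
  rewrite hE in lo.
  have vr : 0 <= rint t (t + h) (fun s => enorm (f s - w0) ^+ 2) / (2 * mu).
    by rewrite divr_ge0 ?(ltW mu2) // rint_ge0 // => s _; exact: sqr_ge0.
  have := one_side up lo vr st FS1 (e1_le _ _ (sqr_ge0 _) (ltW l00)) (e2_le _ (energies t (t + h) (ltW w4) (ltW w3) (lexx _))).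
  rewrite -/x; have -> : t + h - t' - h = - (t' - t) by ring.
  have -> : t - t' = - (t' - t) by ring.
  by rewrite opprB addrA subrK.
have bwd : - (u t' y - u t x) <= ((t' - t) * L x v - dotv (gradv L x v) ((t' - t) *: v - (y - x)) + e / 2 * eta)
    + ((t' - t) * F x (m t) + e / 2 * `|t' - t|).
  have up := chord_upper S cx ch rU r1 w6 w2 t'T (ca (t - h) w8) cy
    (dd (t - h) w9) yD hr (erefl _).
  have lo := run_lower S cx rU' Gg vf w6 w4 (ltW t1) (intbleS w6 (ltW t1) ir) Dh0 hr
    (fun s hs => dd s (w12 s hs)) (erefl _).
  rewrite (dpp _ _ w6 (ltW w4) (ltW t1)) in lo.
  have hE : t - (t - h) = h by ring.
  rewrite -/(slope g (t - h) t) in lo.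
  set w := (t' - (t - h))^-1 *: (y - g (t - h)) in up; set w0 := slope g (t - h) t in lo sl3.
  have l00 : 0 < t' - (t - h) by rewrite subr_gt0.
  have lw : (t' - (t - h)) *: (w - v) = h *: (w0 - v) + (-1) ^+ true *: ((t' - t) *: v - (y - x)).
    rewrite !scalerBr /w /w0 /slope !scalerA hE !divff ?gt_eqF // expr1 -/x.
    by apply/rowP => i; rewrite !mxE; ring.
  have st := step eta h (t' - (t - h)) (w0 - v) _ w eta0 erefl (ltW hh1) ltac:(rewrite (_ : _ - h = (t' - t)) //; ring) sl3 (xiA true) lw.
  rewrite (addrC v (w0 - v)) subrK expr1 scaleN1r dotvNr in st.
  have [_ FS1] := FS t' (t - h) (introT andP (conj t'0 t'T)) td2.
  have {}FS1 := FS1 (ltW w2) (ltW w4) w6.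
  rewrite hE in lo.
  have vr : 0 <= rint (t - h) t (fun s => enorm (f s - w0) ^+ 2) / (2 * mu).
    by rewrite divr_ge0 ?(ltW mu2) // rint_ge0 // => s _; exact: sqr_ge0.
  have := one_side up lo vr st FS1 (e1_le _ _ (sqr_ge0 _) (ltW l00)) (e2_le _ (energies (t - h) t (lexx _) (ltW w4) (ltW w3))).
  rewrite -/x; have -> : t' - (t - h) - h = t' - t by ring.
  by rewrite [X in X <= _ -> _](_ : _ = - (u t' y - u t x)) //; ring.
exact: two_sides etat (ltW e0) (erefl _) fwd bwd.
Qed.

End Expansion2.

(** * Differentials and first order expansions *)

Section SmallOh.
Context {R : realType} {n : nat}.
Local Notation V := 'rV[R]_n.

Lemma differentiable_expansion (W : normedModType R) (f : W -> R) (df : {linear W -> R}) x : continuous df ->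
  (forall e, 0 < e -> \forall h \near (0 : W), `|f (h + x) - f x - df h| <= e * `|h|) ->
  differentiable f x /\ 'd f x = df :> (W -> R).
Proof.
move=> cf H.
have E : f \o shift x = cst (f x) + df +o_ (0 : W) id.
  apply/eqaddoP => e e0; near=> h.
  rewrite /= (_ : (f \o shift x - (cst (f x) + df)) h = f (h + x) - f x - df h); last first.
    by rewrite !fctE /= opprD addrA.
  near: h; exact: H.
have D := diff_unique cf E; split => //; apply/diff_locallyP; rewrite D; split => //.
Unshelve. all: by end_near. Qed.

Lemma diff_small (W Y : normedModType R) (f : W -> Y) x : differentiable f x ->
  forall e, 0 < e -> \forall h \near (0 : W), `|f (h + x) - f x - 'd f x h| <= e * `|h|.
Proof.
move=> /diff_locallyP[_ /eqaddoP H] e e0; near=> h.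
rewrite (_ : f (h + x) - f x - 'd f x h = (f \o shift x - (cst (f x) + 'd f x)) h); last first.
  by rewrite !fctE /= opprD addrA.
near: h; exact: H.
Unshelve. all: by end_near. Qed.

Lemma diff_smallv (f : V -> R) x : differentiable f x -> forall e, 0 < e -> exists2 d, 0 < d &
  forall y, enorm (y - x) < d -> `|f y - f x - dotv (grad f x) (y - x)| <= e * enorm (y - x).
Proof.
move=> df e e0; have := diff_small df e0 => /nbhs_enormP[d d0 H]; exists d => // y yd.
have := H (y - x); rewrite subr0 => /(_ yd); rewrite subrK diff_grad // => /le_trans; apply.
by rewrite ler_wpM2l ?(ltW e0) // norm_le_enorm.
Qed.

Definition lin2 (a : R) (q : V) (z : R * V) : R := z.1 * a + dotv q z.2.

Fact lin2_is_linear a q : linear (lin2 a q).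
Proof. by move=> k y z; rewrite /lin2 /= dotvDr dotvZr; rewrite -[k *: y.1]/(k * y.1) -[k *: _]/(k * _); ring. Qed.
HB.instance Definition _ a q := GRing.isLinear.Build R (R * V)%type R _ (lin2 a q) (lin2_is_linear a q).

Lemma lin2_continuous a q : continuous (lin2 a q).
Proof.
move=> z; apply: (@cvgD _ _ _ _ (nbhs_filter z)).
  by apply: cvgMl; exact: cvg_fst.
apply: (@continuous_comp _ _ _ snd (dotv q)); first exact: cvg_snd.
exact: continuous_dotv.
Qed.

Lemma pair_norm_ge (z : R * V) : `|z.1| + enorm z.2 <= (1 + n%:R) * `|z|.
Proof.
rewrite mulrDl mul1r lerD //; first by rewrite prod_normE le_max lexx.
by apply: le_trans (enorm_le_norm _) _; rewrite ler_wpM2l // prod_normE le_max lexx orbT.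
Qed.

Lemma pair_norm_le (z : R * V) : `|z| <= `|z.1| + enorm z.2.
Proof.
by rewrite prod_normE ge_max lerDl enorm_ge0 /=; apply: le_trans (norm_le_enorm _) _; rewrite lerDr.
Qed.

Lemma nbhs_pairP (t : R) (x : V) (A : set (R * V)) :
  nbhs (t, x) A <-> exists2 d, 0 < d & forall t' y, `|t' - t| < d -> enorm (y - x) < d -> A (t', y).
Proof.
split=> [[[B C] [/= nB nC] BC]|[d d0 H]].
  have [d1 d10 H1] := (nbhs_ballP _ _).1 nB; have [d2 d20 H2] := (nbhs_enormP _ _).1 nC.
  exists (Num.min d1 d2); first by rewrite lt_min; apply/andP; split.
  move=> t' y; rewrite !lt_min => /andP[h1 _] /andP[_ h2]; apply: (BC (t', y)); split => /=.
    by apply: H1; rewrite /ball /= distrC.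
  exact: H2.
exists (ball t d, [set y | enorm (y - x) < d]) => /=.
  by split; [exact: nbhsx_ballx|apply/nbhs_enormP; exists d].
by move=> [t' y] /= [h1 h2]; apply: H => //; rewrite distrC.
Qed.

Lemma diff_small2 (f : R -> V -> R) t x : differentiable (uncurry2 f) (t, x) ->
  forall e, 0 < e -> exists2 d, 0 < d & forall t' y, `|t' - t| < d -> enorm (y - x) < d ->
  `|f t' y - f t x - ((t' - t) * dt f t x + dotv (dx f t x) (y - x))| <= e * (`|t' - t| + enorm (y - x)).
Proof.
move=> df e e0; have /nbhs_pairP[d d0 H] := diff_small df e0; exists d => // t' y td yd.
have := H (t' - t) (y - x); rewrite !subr0 => /(_ td yd).
rewrite /uncurry2 /= !subrK.
have -> : 'd (uncurry2 f) (t, x) (t' - t, y - x) = (t' - t) * dt f t x + dotv (dx f t x) (y - x).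
  have -> : (t' - t, y - x) = (t' - t) *: ((1, 0) : R * V) + \sum_(i < n) (y - x) 0 i *: ((0, unitv R i) : R * V).
    rewrite (_ : \sum_(i < n) _ = ((0, y - x) : R * V)).
      congr (_, _) => /=; first by rewrite addr0 [RHS]mulr1.
      by rewrite scaler0 add0r.
    rewrite [in RHS](row_unitvE (y - x)).
    elim/big_rec2: _ => // i q1 q2 _ ->; congr (_, _) => /=; by rewrite ?scaler0 ?addr0.
  rewrite linearD linearZ /= linear_sum; congr (_ + _); rewrite /dotv; apply: eq_bigr => i _.
  have -> : (dx f t x) 0 i = 'd (uncurry2 f) (t, x) (0, unitv R i) by rewrite /dx mxE.
  by rewrite linearZ mulrC.
move/le_trans; apply; rewrite ler_wpM2l ?(ltW e0) //; exact: pair_norm_le.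
Qed.

End SmallOh.

(** * The value function along optimal curves, inside and on the boundary *)

Section RegularPoints.
Context {R : realType} {n : nat}.
Local Notation V := 'rV[R]_n.
Variables (O U : set V) (T : R) (L : V -> V -> R) (F G : V -> Prob R n -> R)
  (kappa M mu : R) (u : R -> V -> R) (m : R -> Prob R n).
Hypothesis S : setting O U T L F G kappa M mu u m.
Implicit Types (g f : R -> V).

Let affine_split (D k a b c : R) : D + k * a - (k * b - c) = D - (k * (b - a) + - c).
Proof. by ring. Qed.

Let cone_alg (A B k s : R) : A - s * - k <= B -> B <= k / 2 * s -> 0 < k * s -> A < 0.
Proof. by lra. Qed.

Let normal_alg (A B D : R) : - D <= B - A -> B <= 0 -> A <= D.
Proof. by lra. Qed.

(** At an interior point the expansion holds on a full neighbourhood, so its slopes form the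
    differential, and the equation becomes the Legendre identity at the velocity [v]. *)
Lemma interior_regular g f t : extremal O T L F u m g f -> 0 < t < T -> O (g t) ->
  differentiable (uncurry2 u) (t, g t) /\
  - dt u t (g t) + Ham L (g t) (dx u t (g t)) = F (g t) (m t).
Proof.
move=> ex tT Ox; have [v [_ H]] := expansion S ex tT.
have Ux : U (g t) by apply: (OU S); exact: subset_closure.
set x := g t in H Ox Ux *; pose p := gradv L x v.
pose a := dotv p v - (L x v + F x (m t)).
have [oO _ _] := domO S.
have [r r0 rO] : exists2 r, 0 < r & forall y, enorm (y - x) < r -> O y.
  by apply/nbhs_enormP; exact: open_nbhs_nbhs.
have [du dE] : differentiable (uncurry2 u) (t, x) /\ 'd (uncurry2 u) (t, x) = lin2 a (- p) :> (_ -> R).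
  apply: differentiable_expansion; first exact: lin2_continuous.
  move=> e e0; have n1 : 0 < 1 + n%:R :> R by rewrite ltr_pwDl.
  have [d d0 Hd] := H _ (divr_gt0 e0 n1).
  apply/(nbhs_pairP 0 0); exists (Num.min d r); first by rewrite lt_min d0.
  move=> s z; rewrite !subr0 !lt_min => /andP[sd _] /andP[zd zr].
  have := Hd (s + t) (z + x); rewrite !addrK => /(_ _ sd zd) [].
    by apply: subset_closure; apply: rO; rewrite addrK.
  change (0 <= s + t -> s + t <= T -> `|u (s + t) (z + x) - u t x + s * (L x v + F x (m t)) - dotv p (s *: v - z)|
    <= e / (1 + n%:R) * (`|s| + enorm z) ->
    `|u (s + t) (z + x) - u t x - (s * a + dotv (- p) z)| <= e * `|(s, z)|).
  move=> _ _; rewrite dotvBr dotvZr affine_split dotvNl => /le_trans; apply.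
  have := pair_norm_ge (s, z) => /= k; rewrite -mulrA ler_wpM2l ?(ltW e0) //.
  by rewrite mulrC ler_pdivrMr // mulrC.
split => //.
have -> : dx u t x = - p.
  apply/rowP => i; have -> : (dx u t x) 0 i = lin2 a (- p) (0, unitv R i) by rewrite /dx mxE dE.
  by rewrite /lin2 /= mul0r add0r dotv_unitv.
have -> : dt u t x = a by rewrite /dt dE /lin2 /= mul1r dotv0r addr0.
rewrite (Ham_gradv (L_C1 S) (L_0 S) (mu_gt0 S) (L_1 S)) // /a; move: (dotv _ _) (L x v) (F x (m t)) => A B C; ring.
Qed.

Lemma cone_in (rho : V -> R) (x xi : V) (r : R) : 0 < r -> differentiable rho x -> rho x = 0 ->
  (forall y, ball x r y -> (O y <-> rho y < 0)) -> dotv (grad rho x) xi < 0 ->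
  exists2 s0, 0 < s0 & forall s, 0 < s -> s < s0 -> O (x + s *: xi).
Proof.
move=> r0 df rx rP neg; pose k := - dotv (grad rho x) xi; have k0 : 0 < k by rewrite oppr_gt0.
have N1 : 0 < enorm xi + 1 by rewrite ltr_wpDl.
have kN : 0 < k / 2 / (enorm xi + 1) by rewrite !divr_gt0.
have [d d0 H] := diff_smallv df kN.
exists (Num.min d r / (enorm xi + 1)); first by rewrite divr_gt0 // lt_min d0.
move=> s s0; rewrite ltr_pdivlMr // lt_min => /andP[sd sr].
have sx : enorm (x + s *: xi - x) = s * enorm xi by rewrite addrC addKr enormZ gtr0_norm.
have lt1 : s * enorm xi < s * (enorm xi + 1) by rewrite ltr_pM2l // ltrDl.
have b : ball x r (x + s *: xi) by apply: eball_ball; rewrite sx; exact: lt_trans sr.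
apply/rP => //; have := H (x + s *: xi); rewrite sx => /(_ (lt_trans lt1 sd)).
rewrite rx subr0 (addrC x) addrK dotvZr ler_norml => /andP[_ h].
have h2 : k / 2 / (enorm xi + 1) * (s * enorm xi) <= k / 2 * s.
  rewrite -!mulrA ler_pM2l // ler_pM2l ?invr_gt0 // mulrC ler_pdivrMr //; exact: ltW.
have h3 : dotv (grad rho x) xi = - k by rewrite opprK.
rewrite h3 in h; have ks : 0 < k * s by rewrite mulr_gt0.
exact: cone_alg h h2 ks.
Qed.

(** [outward_normal] comes with a defining function of its own. All later use of the normal goes
    through these three facts, which no longer mention any defining function. *)
Lemma bdry_normal (x nux : V) : bdry O x -> outward_normal O x nux ->
  [/\ dotv nux nux = 1,
      (forall xi, dotv nux xi < 0 -> exists2 s0, 0 < s0 & forall s, 0 < s -> s < s0 -> O (x + s *: xi)) &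
      (forall e, 0 < e -> exists2 d, 0 < d & forall y, closure O y -> enorm (y - x) < d ->
         dotv nux (y - x) <= e * enorm (y - x))].
Proof.
move=> [cx nOx] [r [r0 [rho [C1 rP gn nuE]]]].
have xb : ball x r x by exact: ballxx.
have df : differentiable rho x by exact: (C1 x xb).1.
have cr y : ball x r y -> {for y, continuous rho}.
  by move=> yb; apply: differentiable_continuous; exact: (C1 y yb).1.
have rx : rho x = 0.
  apply/eqP; rewrite eq_le; apply/andP; split.
    by apply: (defining_le0 cr rP) => //; rewrite subrr enorm0.
  by rewrite leNgt; apply/negP => /(rP x xb).
have N0 : 0 < enorm (grad rho x) by exact: enorm_gt0.
split.
- rewrite nuE dotvZl dotvZr -enorm_sqr; move: (enorm _) N0 => N N0; field; by rewrite gt_eqF.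
- move=> xi; rewrite nuE dotvZl pmulr_rlt0 ?invr_gt0 // => neg; exact: cone_in r0 df rx rP neg.
- move=> e e0; have [d d0 H] := diff_smallv df (mulr_gt0 e0 N0).
  exists (Num.min d r); first by rewrite lt_min d0.
  move=> y cy; rewrite lt_min => /andP[yd yr].
  have := H y yd; rewrite rx subr0 ler_norml => /andP[h _].
  have h2 := defining_le0 cr rP cy yr.
  rewrite nuE dotvZl mulrC ler_pdivrMr // mulrAC.
  exact: normal_alg h h2.
Qed.

Let ge0_eps (a K : R) : 0 <= K -> (forall e, 0 < e -> e <= 1 -> a <= e * K) -> a <= 0.
Proof.
move=> K0 H; rewrite leNgt; apply/negP => a0.
have K1 : 0 < K + 1 by rewrite ltr_wpDl.
pose e := Num.min 1 (a / 2 / (K + 1)).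
have e0 : 0 < e by rewrite lt_min ltr01 !divr_gt0.
have e1 : e <= 1 by rewrite ge_min lexx.
have e2 : e <= a / 2 / (K + 1) by rewrite ge_min lexx orbT.
have := H e e0 e1; apply/negP; rewrite -ltNge.
apply: (@le_lt_trans _ _ (e * (K + 1))); first by rewrite ler_wpM2l ?(ltW e0) // lerDl.
apply: (@le_lt_trans _ _ (a / 2)); last by rewrite ltr_pdivrMr // ltr_pMr // ltr1n.
by rewrite -ler_pdivlMr.
Qed.

Lemma tangential_velocity g f t v nux : extremal O T L F u m g f -> 0 < t < T ->
  bdry O (g t) -> outward_normal O (g t) nux ->
  (forall e, 0 < e -> exists2 d, 0 < d & forall h, 0 < h -> h < d ->
    enorm (slope g t (t + h) - v) <= e /\ enorm (slope g (t - h) t - v) <= e) ->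
  dotv v nux = 0.
Proof.
move=> [Gg _ _ _] /andP[t0 tT] bx nx sl; have [nn _ le] := bdry_normal bx nx.
have nu1 : enorm nux = 1 by rewrite /enorm nn sqrtr1.
(* 1 accounts for the slope error, since the normal is a unit vector, and [enorm v + 1] bounds the
   slopes in the first order half-space estimate. *)
pose K := 1 + (enorm v + 1).
have K0 : 0 <= K by rewrite !addr_ge0.
have main (e : R) : 0 < e -> e <= 1 -> dotv nux v <= e * K /\ - dotv nux v <= e * K.
  move=> e0 e1; have [d1 d10 H1] := le e e0; have [d2 d20 H2] := sl e e0.
  pose h := Num.min (Num.min t (T - t) / 2) (Num.min (d1 / (enorm v + 2)) (d2) / 2).
  have v2 : 0 < enorm v + 2 by rewrite ltr_wpDl.
  have m1 : 0 < Num.min t (T - t) by rewrite lt_min t0 subr_gt0.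
  have m2 : 0 < Num.min (d1 / (enorm v + 2)) d2 by rewrite lt_min d20 divr_gt0.
  have h0 : 0 < h by rewrite lt_min !divr_gt0.
  have half (a : R) : 0 < a -> a / 2 < a by move=> a0; rewrite ltr_pdivrMr // ltr_pMr // ltr1n.
  have hm1 : h < Num.min t (T - t) by apply: le_lt_trans (half _ m1); rewrite ge_min lexx.
  have hm2 : h < Num.min (d1 / (enorm v + 2)) d2 by apply: le_lt_trans (half _ m2); rewrite ge_min lexx orbT.
  move: hm1 hm2; rewrite !lt_min => /andP[ht hT] /andP[hd1 hd2].
  have [s1 s2] := H2 h h0 hd2.
  have dir (w : V) : enorm (w - v) <= e -> `|dotv nux w - dotv nux v| <= e /\ enorm w <= enorm v + 1.
    move=> wv; split.
      by rewrite -dotvBr; apply: le_trans (dotv_cauchy _ _) _; rewrite nu1 mul1r.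
    have := enormD v (w - v); rewrite (addrC v) subrK => /le_trans; apply.
    by rewrite lerD2l (le_trans wv).
  have c1 : closure O (g (t + h)) by apply: Gg.2; apply/andP; split; lra.
  have c2 : closure O (g (t - h)) by apply: Gg.2; apply/andP; split; lra.
  have E1 : g (t + h) - g t = h *: slope g t (t + h).
    by rewrite /slope (_ : t + h - t = h) ?scalerA ?divff ?scale1r ?gt_eqF //; ring.
  have E2 : g (t - h) - g t = - (h *: slope g (t - h) t).
    by rewrite /slope (_ : t - (t - h) = h) ?scalerA ?divff ?scale1r ?gt_eqF ?opprB //; ring.
  have [a1 b1] := dir _ s1; have [a2 b2] := dir _ s2.
  have small (w : V) : enorm w <= enorm v + 1 -> h * enorm w < d1.
    move=> wv; apply: le_lt_trans (_ : _ <= h * (enorm v + 2)) _; last by rewrite -ltr_pdivlMr.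
    by rewrite ler_wpM2l ?(ltW h0) // (le_trans wv) // lerD2l ler1n.
  have k1 := H1 _ c1; rewrite E1 enormZ gtr0_norm // dotvZr mulrCA ler_pM2l // in k1.
  have {}k1 := k1 (small _ b1).
  have k2 := H1 _ c2; rewrite E2 enormN enormZ gtr0_norm // dotvNr dotvZr mulrCA -mulrN ler_pM2l // in k2.
  have {}k2 := k2 (small _ b2).
  have eb1 : e * enorm (slope g t (t + h)) <= e * (enorm v + 1) by rewrite ler_wpM2l // ltW.
  have eb2 : e * enorm (slope g (t - h) t) <= e * (enorm v + 1) by rewrite ler_wpM2l // ltW.
  move: a1 a2 (le_trans k1 eb1) (le_trans k2 eb2); rewrite !ler_norml /K.
  move: (dotv nux v) (dotv nux _) (dotv nux _) (enorm v) => A B D N /andP[p1 p2] /andP[p3 p4] p5 p6.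
  by split; lra.
rewrite dotvC; apply/eqP; rewrite eq_le; apply/andP; split.
  by apply: (ge0_eps K0) => e e0 e1; have [] := main e e0 e1.
by rewrite -oppr_le0; apply: (ge0_eps K0) => e e0 e1; have [] := main e e0 e1.
Qed.

(** At fixed position the expansion gives the time derivative, and at fixed time the element [p0] of
    the superdifferential. Other elements can be compared with [p0] along inward directions only,
    which leaves their normal part undetermined. *)
Lemma boundary_regular g f t (nu : V -> V) : extremal O T L F u m g f -> 0 < t < T -> bdry O (g t) ->
  outward_normal O (g t) (nu (g t)) ->
  derivable (fun s => u s (g t)) t 1 /\
  exists q : V, [/\ exists p, superdiff O u t (g t) p,
    (forall p, superdiff O u t (g t) p -> p - dotv p (nu (g t)) *: nu (g t) = q) &
    - derive1 (fun s => u s (g t)) t + Ham_tau L nu (g t) q = F (g t) (m t)].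
Proof.
move=> ex tT bx nx; have [v [sl H]] := expansion S ex tT.
have vnu := tangential_velocity ex tT bx nx sl.
have cx : closure O (g t) by case: bx.
have Ux := OU S cx; have [nn cone _] := bdry_normal bx nx.
set x := g t in H bx nx cx Ux vnu nn cone *; pose p0 := - gradv L x v.
set nux := nu x in nx vnu nn cone *.
pose a := dotv (gradv L x v) v - (L x v + F x (m t)).
have idu : is_derive t (1 : R) (fun s => u s x) a.
  suff cv : h^-1 *: (u (h *: 1 + t) x - u t x) @[h --> (0 : R)^'] --> a.
    by apply: DeriveDef; [apply/cvg_ex; exists a|exact: cvg_lim].
  apply/cvgrPdist_le => e e0; have [d d0 Hd] := H e e0.
  near=> h; have h0 : h != 0 by near: h; exact: nbhs_dnbhs_neq.
  have hd : `|h| < d by near: h; apply: dnbhs0_lt.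
  have := Hd (h + t) x cx; rewrite addrK subrr enorm0 => /(_ hd d0) [_ _].
  rewrite subr0 dotvZr addr0 => k.
  have -> : h *: 1 = h :> R by rewrite [LHS]mulr1.
  rewrite distrC -(ler_pM2l (_ : 0 < `|h|)) ?normr_gt0 // -normrM [leRHS]mulrC; apply: le_trans k.
  rewrite le_eqVlt; apply/orP; left; apply/eqP; congr `|_|; rewrite (_ : forall c d : R, c *: d = c * d) // /a.
  move: (dotv _ _) (u _ _) (u _ _) (L _ _) (F _ _) => A1 A2 A3 A4 A5; by field.
have [du dE] := idu; split => //.
have sup0 : superdiff O u t x p0.
  move=> e e0; have [d d0 Hd] := H e e0; exists d => // y cy yd.
  have := Hd t y cy; rewrite subrr normr0 => /(_ d0 yd) [_ _].
  rewrite mul0r addr0 scale0r sub0r dotvNr add0r ler_norml => /andP[_]; rewrite /p0 dotvNl //.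
(* Along the ray x + s xi the expansion with slope [p0] and the superdifferential inequality for [p]
   are combined and divided by [s]. *)
have tang p : superdiff O u t x p -> forall xi, dotv nux xi < 0 -> dotv (p0 - p) xi <= 0.
  move=> sp xi neg; have [s0 s00 cO] := cone xi neg.
  apply: (@ge0_eps _ (2 * enorm xi)) => [|e e0 _]; first by rewrite mulr_ge0.
  have [d1 d10 H1] := sp e e0; have [d2 d20 H2] := H e e0.
  have N1 : 0 < enorm xi + 1 by rewrite ltr_wpDl.
  pose s := Num.min s0 (Num.min d1 d2 / (enorm xi + 1)) / 2.
  have md : 0 < Num.min d1 d2 by rewrite lt_min d10.
  have mm : 0 < Num.min s0 (Num.min d1 d2 / (enorm xi + 1)) by rewrite lt_min s00 divr_gt0.
  have sp0 : 0 < s by rewrite divr_gt0.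
  have : s < Num.min s0 (Num.min d1 d2 / (enorm xi + 1)) by rewrite ltr_pdivrMr // ltr_pMr // ltr1n.
  rewrite lt_min ltr_pdivlMr // lt_min => /and3P[ss0 sd1 sd2].
  have lt1 : s * enorm xi < s * (enorm xi + 1) by rewrite ltr_pM2l // ltrDl.
  have cy : closure O (x + s *: xi) by apply: subset_closure; exact: cO.
  have yE : x + s *: xi - x = s *: xi by rewrite addrC addKr.
  have yN : enorm (x + s *: xi - x) = s * enorm xi by rewrite yE enormZ gtr0_norm.
  have k1 := H1 _ cy; rewrite yN yE dotvZr in k1; have {}k1 := k1 (lt_trans lt1 sd1).
  have k2 := H2 t _ cy; rewrite yN yE subrr normr0 in k2; have [_ _ {}k2] := k2 d20 (lt_trans lt1 sd2).
  rewrite mul0r addr0 scale0r sub0r dotvNr add0r dotvZr ler_norml opprK in k2; have /andP[k3 _] := k2.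
  rewrite dotvBl /p0 dotvNl -(ler_pM2l sp0).
  move: k1 k3; move: (u t _ - u t x) (dotv p xi) (dotv _ xi) (enorm xi) => A1 A2 A3 A4 k1 k3; lra.
(* A tangent vector tilted inwards by [e] is admissible; the tilt tends to 0, and using both [tau]
   and [- tau] gives equality. *)
have tang0 p : superdiff O u t x p -> forall tau, dotv nux tau = 0 -> dotv (p0 - p) tau = 0.
  move=> sp; have half tau : dotv nux tau = 0 -> dotv (p0 - p) tau <= 0.
    move=> tn; apply: (@ge0_eps _ (`|dotv (p0 - p) nux|)) => // e e0 _.
    have := tang p sp (tau - e *: nux); rewrite !dotvBr !dotvZr tn nn mulr1 sub0r oppr_lt0 => /(_ e0).
    by rewrite subr_le0 => /le_trans; apply; rewrite ler_wpM2l ?(ltW e0) // ler_norm.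
  move=> tau tn; apply/eqP; rewrite eq_le half //= -oppr_le0 -dotvNr half //.
  by rewrite dotvNr tn oppr0.
have uniq p : superdiff O u t x p -> p - dotv p nux *: nux = p0 - dotv p0 nux *: nux.
  (* The tangential part of [p0 - p] is orthogonal to itself. *)
  move=> sp; pose d := p0 - p; pose tau := d - dotv d nux *: nux.
  have tn : dotv nux tau = 0 by rewrite dotvBr dotvZr nn mulr1 (dotvC nux) subrr.
  have dt0 := tang0 p sp tau tn.
  have : dotv tau tau = 0 by rewrite {1}/tau dotvBl dotvZl tn mulr0 subr0.
  rewrite -enorm_sqr => /eqP; rewrite sqrf_eq0 enorm_eq0 => /eqP tz.
  apply/esym/eqP; rewrite -subr_eq0; apply/eqP; rewrite -tz /tau /d dotvBl scalerBl.
  by apply/rowP => i; rewrite !mxE; ring.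
exists (p0 - dotv p0 nux *: nux); split; [by exists p0|exact: uniq|].
rewrite (Ham_tau_gradv (L_C1 S) (L_0 S) (mu_gt0 S) (L_1 S) (v := v)) //.
  rewrite derive1E dE /a; move: (dotv _ _) (L _ _) (F _ _) => A1 A2 A3; ring.
by move=> w wn; rewrite dotvBl dotvZl (dotvC nux) wn mulr0 subr0.
Unshelve. all: by end_near. Qed.

End RegularPoints.

(** * Viscosity inequalities *)

Section Viscosity.
Context {R : realType} {n : nat}.
Local Notation V := 'rV[R]_n.
Variables (O U : set V) (T : R) (L : V -> V -> R) (F G : V -> Prob R n -> R)
  (kappa M mu : R) (u : R -> V -> R) (m : R -> Prob R n).
Hypothesis S : setting O U T L F G kappa M mu u m.
Local Notation run := (run T L F m).
Local Notation Fint := (Fint T F m).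
Implicit Types (g f : R -> V).

Lemma energy_run : exists2 C, 0 <= C & forall g f a b, Gamma O T g -> velocity T g f -> a <= b ->
  intble a b (run g f) -> energy f a b <= 4 * mu * (rint a b (run g f) + C * (b - a)).
Proof.
have [C C0 HC] := run_lb S; exists C => // g f a b Gg vf ab ir.
have mu4 : 0 < 4 * mu by rewrite mulr_gt0 // (mu_gt0 S).
have ie := energy_intble S Gg vf ir.
have i1 : intble a b (fun s => run g f s + C) by apply: intbleD => //; exact: intble_cst.
have -> : rint a b (run g f) + C * (b - a) = rint a b (fun s => run g f s + C).
  by rewrite (rintD ir (intble_cst _ _ _)) rint_cst // mulrC.
rewrite -rintZ //; apply: rint_le => //; first exact: intbleZ.
move=> s _; rewrite -ler_pdivrMl // mulrC -lerBlDr; exact: HC.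
Qed.

Let run_cst_alg (a b c d M1 CF : R) : `|c| + a + b <= M1 -> `|d| <= CF -> 0 <= a -> 0 <= b -> c + d <= M1 + CF.
Proof. by have := ler_norm c; have := ler_norm d; lra. Qed.

(** The lower bound is coercivity of the running cost; the upper one is the cost of staying at
    [x]. *)
Lemma u_bounded : exists2 C, 0 <= C & forall t x, 0 <= t <= T -> closure O x -> `|u t x| <= C.
Proof.
have [C C0 HC] := energy_run; have [CG HG] := G_bnd S; have [CF HF] := F_bound S.
have T0 := T_gt0 S; have T0' := ltW T0; have M0 := M_nonneg S.
have [x0 cx0] := closure_nonempty S.
have CG0 : 0 <= CG by apply: le_trans (HG x0 (OU S cx0)).
have CF0 : 0 <= CF by apply: le_trans (HF x0 0 cx0 _) => //; rewrite lexx.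
exists (C * T + (M + CF) * T + CG); first by rewrite !addr_ge0 // mulr_ge0 // addr_ge0.
move=> t x tT cx; have /andP[t0 t1] := tT; have MF0 : 0 <= M + CF by rewrite addr_ge0.
have gT g : Gamma O T g -> `|G (g T) (m T)| <= CG.
  by move=> [_ cg]; apply: HG; apply: (OU S); apply: cg; rewrite lexx T0'.
have mu4 : 0 < 4 * mu by rewrite mulr_gt0 // (mu_gt0 S).
have CT : C * (T - t) <= C * T by rewrite ler_wpM2l // gerBl.
have MT : (M + CF) * (T - t) <= (M + CF) * T by rewrite ler_wpM2l // gerBl.
have CT0 : 0 <= C * T by rewrite mulr_ge0.
have MT0 : 0 <= (M + CF) * T by rewrite mulr_ge0.
rewrite ler_norml; apply/andP; split.
  apply/ler_addgt0Pr => e e0; have [g [f [Gg vf _ ir le]]] := u_near S tT cx e0.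
  have h1 := HC g f t T Gg vf t1 ir.
  have h2 : 0 <= rint t T (run g f) + C * (T - t).
    by rewrite -(pmulr_rge0 _ mu4); apply: le_trans h1; exact: energy_ge0.
  have := gT g Gg; rewrite ler_norml => /andP[h3 _]; lra.
have Gc := Gamma_cst T cx; have [f vf] := abs_cont_velocity T0 Gc.1.
have [_ _ fz [N [_ _ fN fE]]] := vf.
have f0 s : f s = 0.
  have [s0T|ns] := pselect (0 < s < T); last exact: fz.
  have [Ns|Ns] := pselect (N s); first exact: fN.
  by have [_ <-] := fE s Ns s0T; rewrite derive1_cst.
have f0' s : enorm (f s) <= 0 by rewrite f0 enorm0.
have ir := run_bounded_intble S t T Gc vf f0'.
have := u_le_cost S Gc tT; rewrite (cost_rint G Gc vf t0 ir) lee_fin.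
have h1 : rint t T (run (fun=> x) f) <= (M + CF) * (T - t).
  rewrite mulrC -rint_cst //; apply: rint_le => //; first exact: intble_cst.
  move=> s _; rewrite /run f0.
  exact: run_cst_alg (L_0 S (OU S cx)) (HF x (clamp T s) cx (clamp_itv _ T0')) (enorm_ge0 _) (enorm_ge0 _).
have := gT _ Gc; rewrite ler_norml => /andP[_ h3]; lra.
Qed.

Lemma le_eps (a b K : R) : 0 <= K -> (forall e, 0 < e -> e <= 1 -> a <= b + e * K) -> a <= b.
Proof.
move=> K0 H; apply/ler_addgt0Pr => e e0; have K1 : 0 < K + 1 by rewrite ltr_wpDl.
pose d := Num.min 1 (e / (K + 1)).
have d0 : 0 < d by rewrite lt_min ltr01 divr_gt0.
have d1 : d <= 1 by rewrite ge_min lexx.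
apply: le_trans (H d d0 d1) _; rewrite lerD2l.
have : d <= e / (K + 1) by rewrite ge_min lexx orbT.
by rewrite ler_pdivlMr // mulrDr mulr1; apply: le_trans; rewrite lerDl ltW.
Qed.

Let sub_alg (u0 u1 p0 p1 h D q Lv I Fx e c N d : R) : 0 < h ->
  u0 <= u1 + h * Lv + I + c * d * (1 + N ^+ 2) * h -> u1 - p1 <= u0 - p0 ->
  `|p1 - p0 - (h * D + h * q)| <= e * (h + h * N) -> `|I - h * Fx| <= e * h -> c * d <= e ->
  - D + (- q - Lv) <= Fx + e * (2 + N + (1 + N ^+ 2)).
Proof.
move=> h0 h1 h2; rewrite !ler_norml => /andP[h3 h4] /andP[h5 h6] h7.
have h8 : c * d * (1 + N ^+ 2) * h <= e * (1 + N ^+ 2) * h.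
  by rewrite ler_wpM2r ?(ltW h0) // ler_wpM2r // addr_ge0 // sqr_ge0.
rewrite -(ler_pM2l h0); move: (N ^+ 2) h1 h8 => N2 h1 h8; lra.
Qed.

(** The Hamiltonian is a supremum, so one velocity [v] is treated at a time: u(t, x) is compared
    with u(t + h, x + h v) by the chord joining the two points. *)
Lemma viscosity_sub : visc_sub O L F m T u.
Proof.
move=> phi C1 t x /andP[t0 tT] Ox loc.
have cx : closure O x by exact: subset_closure.
have Ux := OU S cx; have [oO _ _] := domO S.
have dphi : differentiable (uncurry2 phi) (t, x) by exact: (C1 (t, x) I).1.
have [r [ec [r0 r1 ch rU]]] := good_chord S cx.
rewrite -lerBrDl; apply: ge_sup; first by exists (- dotv (dx phi t x) 0 - L x 0), 0.
move=> _ [v _ <-]; rewrite lerBrDl; set q := dx phi t x.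
pose K := 2 + enorm v + (1 + enorm v ^+ 2).
have K0 : 0 <= K by rewrite !addr_ge0 // sqr_ge0.
apply: (le_eps K0) => e e0 e1.
have [d1 d10 H1] := diff_small2 dphi e0.
have [d2 d20 H2] := (nbhs_pairP _ _ _).1 loc.
have tT' : 0 <= t <= T by rewrite !ltW.
have [d3 d30 H3] := Fint_near S cx tT' e0.
have [d4 d40 H4] : exists2 r, 0 < r & forall y, enorm (y - x) < r -> O y.
  by apply/nbhs_enormP; exact: open_nbhs_nbhs.
pose N := enorm v + 1; have N0 : 0 < N by rewrite ltr_wpDl.
pose c := chord_const kappa M mu (enorm ec); have c0 : 0 <= c := chord_const_ge0 S (enorm_ge0 ec).
have c1 : 0 < c + 1 by rewrite ltr_wpDl.
pose A := Num.min (Num.min d1 d2) (Num.min d4 (Num.min r (e / (c + 1)))).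
have A0 : 0 < A by rewrite !lt_min d10 d20 d40 r0 divr_gt0.
pose B := Num.min (A / N) (Num.min d3 (T - t)).
have B0 : 0 < B by rewrite !lt_min divr_gt0 // d30 subr_gt0.
pose h := B / 2; have h0 : 0 < h by rewrite divr_gt0.
have : h < B by rewrite ltr_pdivrMr // ltr_pMr // ltr1n.
rewrite /B !lt_min ltr_pdivlMr // => /andP[hA /andP[hd3 hT]].
have hN : h * enorm v <= h * N by rewrite ler_wpM2l ?(ltW h0) // lerDl.
have hh : h <= h * N by rewrite ler_peMr ?(ltW h0) // lerDr.
have hvA := le_lt_trans hN hA; have hhA := le_lt_trans hh hA.
move: hvA hhA; rewrite !lt_min => /andP[/andP[v1 v2] /and3P[v4 vr vc]] /andP[/andP[k1 k2] _].
have zE : x + h *: v - x = h *: v by rewrite addrC addKr.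
have zN : enorm (x + h *: v - x) = h * enorm v by rewrite zE enormZ gtr0_norm.
have Oz : O (x + h *: v) by apply: H4; rewrite zN.
have tth : t + h <= T by rewrite -lerBrDl ltW.
have th : t < t + h by rewrite ltrDl.
have hE : t + h - t = h by rewrite addrC addKr.
have vE : v = (t + h - t)^-1 *: (x + h *: v - x) by rewrite hE zE scalerA mulVf ?scale1r // gt_eqF.
have zd : enorm (x - x) <= h * enorm v by rewrite subrr enorm0 mulr_ge0 // ltW.
have zd' : enorm (x + h *: v - x) <= h * enorm v by rewrite zN.
have cz : closure O (x + h *: v) by exact: subset_closure.
have up := chord_upper S cx ch rU r1 (ltW t0) th tth cx cz zd zd' vr vE.
rewrite hE in up.
have l1 : `|t + h - t| < d2 by rewrite hE gtr0_norm.
have l2 := H2 (t + h) (x + h *: v) l1; rewrite zN /= in l2; have {}l2 := l2 v2.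
have l3 : 0 < t + h < T /\ O (x + h *: v).
  by split => //; rewrite (lt_trans t0 th) /= -ltrBrDl.
have {}l2 := l2 l3.
have l4 := H1 (t + h) (x + h *: v); rewrite zN hE gtr0_norm // zE dotvZr in l4.
have {}l4 := l4 k1 v1.
have l5 := H3 t (t + h) (ltW t0) (ltW th) tth; rewrite hE in l5.
have {}l5 := l5 ltac:(by rewrite ltrBlDr ltrDl) ltac:(by rewrite ltrD2l).
have l6 : c * (h * enorm v) <= e.
  move: vc; rewrite ltr_pdivlMr // => vc; apply: le_trans (ltW vc).
  by rewrite mulrC; apply: ler_wpM2l; [rewrite mulr_ge0 // ltW|rewrite lerDl].
exact: sub_alg h0 up l2 l4 l5 l6.
Qed.

End Viscosity.

(** * The supersolution inequality up to the boundary *)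

Section ViscositySuper.
Context {R : realType} {n : nat}.
Local Notation V := 'rV[R]_n.
Variables (O U : set V) (T : R) (L : V -> V -> R) (F G : V -> Prob R n -> R)
  (kappa M mu : R) (u : R -> V -> R) (m : R -> Prob R n).
Hypothesis S : setting O U T L F G kappa M mu u m.
Local Notation run := (run T L F m).
Local Notation Fint := (Fint T F m).
Implicit Types (g f : R -> V).

Let young (s h E K : R) : 0 <= h -> 0 <= E -> s ^+ 2 = h * E -> K * s <= E / 2 + K ^+ 2 / 2 * h.
Proof.
move=> h0 E0 sE; have [hz|hp] := leP h 0.
  have hz' : h = 0 by apply/eqP; rewrite eq_le hz.
  have /eqP : s ^+ 2 = 0 by rewrite sE hz' mul0r.
  by rewrite sqrf_eq0 => /eqP ->; rewrite hz' !mulr0 addr0 divr_ge0.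
by rewrite -(ler_pM2l hp); have := sqr_ge0 (s - K * h); nra.
Qed.

(** Self-improvement: the cost bounds the energy, the test function bounds the cost by an expression
    in sqrt(h E), and Young's inequality closes the loop. *)
Let super_small (E h a b K Q s k : R) : 0 < k -> 0 <= h -> h <= 1 -> 0 <= E ->
  E <= k * (a + K * h) -> a <= b + h * h -> b <= Q * (h + s) -> s ^+ 2 = h * E ->
  E <= (2 * k * (K + 1 + Q) + (k * Q) ^+ 2) * h.
Proof.
move=> k0 h0 hl E0 h1 h2 h3 sE; have am := young (k * Q) h0 E0 sE.
have hh : h * h <= h by rewrite ler_piMl.
have : k * (a + K * h) <= k * (Q * (h + s) + h + K * h) by rewrite ler_wpM2l ?(ltW k0) //; lra.
by move=> h4; have := le_trans h1 h4; move: am; move: (_ ^+ 2) => Z; lra.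
Qed.

Let super_alg (h Lw var I c E a u0 u1 p0 p1 D q N e Fx H D0 : R) : 0 < h -> 0 <= var -> 0 < e ->
  h * Lw + var + I - c * (h + E) <= a -> a <= u0 - u1 + h * h -> u0 - p0 <= u1 - p1 ->
  `|p1 - p0 - (h * D + h * q)| <= e * (h + N) -> N <= D0 * h -> `|I - h * Fx| <= e * h ->
  c * (h + E) <= e * h -> h <= e -> - q - Lw <= H ->
  Fx <= (- D + H) + e * (4 + D0).
Proof.
move=> h0 v0 e0 h1 h2 h3; rewrite !ler_norml => /andP[h4 _] hN /andP[h5 _] h6 h7 h8.
have k1 : h * h <= e * h by rewrite ler_wpM2r // ltW.
have k2 : e * N <= e * (D0 * h) by rewrite ler_wpM2l // ltW.
have k3 : h * (- q - Lw) <= h * H by rewrite ler_wpM2l // ltW.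
rewrite -(ler_pM2l h0); lra.
Qed.

Let incr_alg (p0 p1 u0 u1 h D q e Q aD N : R) : u0 - p0 <= u1 - p1 ->
  `|p1 - p0 - (h * D + q)| <= e * (h + N) -> - aD <= D -> - (Q * N) <= q -> e <= 1 -> 0 <= h -> 0 <= N ->
  0 <= aD -> 0 <= Q -> u0 - u1 <= (aD + Q + 1) * (h + N).
Proof.
move=> h1; rewrite ler_norml => /andP[h2 _] h3 h4 h5 h0 N0 a0 Q0.
have k1 : - aD * h <= D * h by rewrite ler_wpM2r.
have k2 : e * (h + N) <= h + N by rewrite ler_piMl // addr_ge0.
have k3 : 0 <= aD * N by rewrite mulr_ge0.
have k4 : 0 <= Q * h by rewrite mulr_ge0.
lra.
Qed.

(** A curve from (t, x) that is optimal up to [h * h] is followed for a time [h]. Its energy is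
    first bounded by a constant, which keeps its end where the local minimum is tested, then by
    [C2 * h] through the test function; the curve then stays within [D0 * h] of [x] and the lower
    action bound has error o(h). *)
Lemma viscosity_super : visc_super O L F m T u.
Proof.
move=> phi phiC1 t x /andP[t0 tT] cx loc; have Ux := OU S cx.
have dphi : differentiable (uncurry2 phi) (t, x) by exact: (phiC1 (t, x) I).1.
have [C C0 HC] := energy_run S; have [Cu Cu0 HCu] := u_bounded S.
have mu4 : 0 < 4 * mu by rewrite mulr_gt0 // (mu_gt0 S).
set D := dt phi t x; set q := dx phi t x.
pose C1 := 4 * mu * (2 * Cu + 1 + C); pose Q := `|D| + enorm q + 1.
have C10 : 0 <= C1 by rewrite mulr_ge0 ?(ltW mu4) // !addr_ge0 // mulr_ge0.
have Q0 : 0 <= Q by rewrite !addr_ge0.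
pose C2 := 2 * (4 * mu) * (C + 1 + Q) + (4 * mu * Q) ^+ 2.
have C20 : 0 <= C2.
  by apply: addr_ge0 (sqr_ge0 _); rewrite mulr_ge0 ?addr_ge0 // mulr_ge0 // ltW.
pose D0 := Num.sqrt C2; have D00 : 0 <= D0 by exact: sqrtr_ge0.
pose c1 := M + 2 * mu + kappa.
have c10 : 0 <= c1.
  by rewrite !addr_ge0 ?(M_nonneg S) ?(kappa_ge0 S) // mulr_ge0 // ltW // (mu_gt0 S).
have [r r0 rU] := closure_ball_U S cx.
have K0 : 0 <= 4 + D0 by rewrite addr_ge0.
apply: (le_eps K0) => e e0 e1.
have [d1 d10 H1] := diff_small2 dphi e0.
have [d2 d20 H2] := (nbhs_pairP _ _ _).1 loc.
have tT' : 0 <= t <= T by rewrite !ltW.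
have [d3 d30 H3] := Fint_near S cx tT' e0.
have [dl [dl0 dl1 dl2]] : exists dl, [/\ 0 < dl, dl <= d1 & dl <= d2].
  by exists (Num.min d1 d2); rewrite lt_min d10 d20 !ge_min !lexx orbT.
pose c2 := c1 * D0 * (1 + C2); have c20 : 0 <= c2 := mulr_ge0 (mulr_ge0 c10 D00) (addr_ge0 ler01 C20).
pose B1 := Num.min (Num.min 1 e) (Num.min (T - t) d3).
(* [dl ^+ 2 / (C1 + 1)] confines the end point, whose squared distance to [x] is at most h times the
   energy. *)
pose B2 := Num.min (Num.min dl (dl ^+ 2 / (C1 + 1))) (Num.min (r / (D0 + 1)) (e / (c2 + 1))).
have p1 (a : R) : 0 <= a -> 0 < a + 1 by move=> a0; rewrite ltr_wpDl.
have B0 : 0 < Num.min B1 B2.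
  by rewrite !lt_min ltr01 e0 subr_gt0 tT d30 dl0 !divr_gt0 ?exprn_gt0 // p1.
pose h := Num.min B1 B2 / 2; have h0 : 0 < h by rewrite divr_gt0.
have : h < Num.min B1 B2 by rewrite ltr_pdivrMr // ltr_pMr // ltr1n.
rewrite !lt_min !ltr_pdivlMr ?p1 // => /andP[/andP[/andP[h1 he] /andP[hT hd3]]].
move=> /andP[/andP[hdl hC1] /andP[hr hc]].
have h0' := ltW h0; have th : t < t + h by rewrite ltrDl.
have tth : t + h <= T by rewrite -lerBrDl ltW.
have hE : t + h - t = h by rewrite addrC addKr.
have [g [f [Gg vf gt_ irT le]]] := u_near_dpp S (ltW t0) (ltW th) tth cx (mulr_gt0 h0 h0).
have ir : intble t (t + h) (run g f) by apply: intbleS irT.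
have cg : closure O (g (t + h)) by apply: Gg.2; rewrite tth (le_trans (ltW t0) (ltW th)).
set a := rint t (t + h) (run g f) in le.
have {}le : a <= u t x - u (t + h) (g (t + h)) + h * h by rewrite addrAC lerBrDr.
set E := energy f t (t + h); have E0 : 0 <= E by exact: energy_ge0.
have EC : E <= 4 * mu * (a + C * h) by have := HC g f t (t + h) Gg vf (ltW th) ir; rewrite hE.
have EC1 : E <= C1.
  apply: le_trans EC _; rewrite ler_wpM2l ?(ltW mu4) //.
  have := HCu t x tT' cx; have := HCu (t + h) (g (t + h)) (introT andP (conj (le_trans (ltW t0) (ltW th)) tth)) cg.
  have hh : h * h <= 1 by rewrite mulr_ile1 // ltW.
  have Ch : C * h <= C by rewrite ler_piMr // ltW.
  rewrite !ler_norml => /andP[k1 k2] /andP[k3 k4]; lra.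
have ie : intble t (t + h) (fun s => enorm (f s) ^+ 2) by exact: (energy_intble S Gg vf ir).
have hold s : t <= s <= t + h -> enorm (g s - x) ^+ 2 <= h * E.
  move=> /andP[ts sh]; rewrite -gt_; have sT : s <= T by exact: le_trans tth.
  have ie' : intble t s (fun s => enorm (f s) ^+ 2) by apply: intbleS ie.
  apply: le_trans (velocity_holder vf (ltW t0) ts sT ie') _.
  apply: ler_pM; rewrite ?subr_ge0 //; first by apply: rint_ge0 => z _; exact: sqr_ge0.
    by rewrite lerBlDl.
  by apply: rint_sub => // z _; exact: sqr_ge0.
pose N := enorm (g (t + h) - x); pose s := Num.sqrt (h * E).
have Ns : N <= s.
  suff : Num.sqrt (N ^+ 2) <= s by rewrite sqrtr_sqr ger0_norm // /N.
  by rewrite ler_wsqrtr // hold // (ltW th) lexx.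
have sE : s ^+ 2 = h * E by rewrite sqr_sqrtr // mulr_ge0.
have Ndl : N < dl.
  have N0 : 0 <= N by exact: enorm_ge0.
  rewrite -(@ltr_pXn2r _ 2) ?nnegrE ?(ltW dl0) //.
  apply: le_lt_trans (hold (t + h) _) _; first by rewrite (ltW th) lexx.
  by apply: le_lt_trans hC1; rewrite ler_wpM2l // (le_trans EC1) // lerDl.
have Nd1 := lt_le_trans Ndl dl1; have Nd2 := lt_le_trans Ndl dl2.
have hd1 := lt_le_trans hdl dl1; have hd2 := lt_le_trans hdl dl2.
have l1 : u t x - phi t x <= u (t + h) (g (t + h)) - phi (t + h) (g (t + h)).
  apply: (H2 (t + h) (g (t + h))) => //; first by rewrite hE gtr0_norm.
  by split => //=; rewrite (lt_trans t0 th) /= -ltrBrDl.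
have l2 := H1 (t + h) (g (t + h)); rewrite hE gtr0_norm // in l2; have {}l2 := l2 hd1 Nd1.
have qN : - (enorm q * N) <= dotv q (g (t + h) - x).
  by have := dotv_cauchy q (g (t + h) - x); rewrite ler_norml => /andP[].
have aD : - `|D| <= D by rewrite lerNl -normrN ler_norm.
have l3 := incr_alg l1 l2 aD qN e1 h0' (enorm_ge0 _) (normr_ge0 _) (enorm_ge0 _).
have l3' : u t x - u (t + h) (g (t + h)) <= Q * (h + s).
  by apply: le_trans l3 _; rewrite ler_wpM2l // lerD2l.
have E2 : E <= C2 * h := super_small mu4 h0' (ltW h1) E0 EC le l3' sE.
have gd z : t <= z <= t + h -> enorm (g z - x) <= D0 * h.
  move=> /hold hz; have : Num.sqrt (enorm (g z - x) ^+ 2) <= Num.sqrt (C2 * h ^+ 2).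
    by rewrite ler_wsqrtr // (le_trans hz) // expr2 mulrA mulrC ler_wpM2r.
  by rewrite sqrtr_sqr ger0_norm // sqrtrM // sqrtr_sqr gtr0_norm.
have Dhr : D0 * h < r.
  by apply: le_lt_trans hr; rewrite mulrC ler_wpM2l // lerDl.
have Dh0 : 0 <= D0 * h by rewrite mulr_ge0.
have lo := run_lower S cx rU Gg vf (ltW t0) th tth ir Dh0 Dhr gd (erefl _).
rewrite hE -/E -/a gt_ in lo; set w := h^-1 *: (g (t + h) - x) in lo.
have wE : g (t + h) - x = h *: w by rewrite scalerA divff ?scale1r // gt_eqF.
have var0 : 0 <= rint t (t + h) (fun s => enorm (f s - w) ^+ 2) / (2 * mu).
  rewrite divr_ge0 ?rint_ge0 // => [z _|]; first exact: sqr_ge0.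
  by rewrite mulr_ge0 // ltW // (mu_gt0 S).
have l5 := H3 t (t + h) (ltW t0) (ltW th) tth; rewrite hE in l5.
have {}l5 := l5 ltac:(by rewrite ltrBlDr ltrDl) ltac:(by rewrite ltrD2l).
have ce : c1 * (D0 * h) * (h + E) <= e * h.
  apply: (@le_trans _ _ (c2 * h * h)).
    have -> : c2 * h * h = c1 * (D0 * h) * (h * (1 + C2)) by rewrite /c2; ring.
    by apply: ler_wpM2l; [exact: mulr_ge0|rewrite mulrDr mulr1 lerD2l mulrC].
  rewrite ler_wpM2r //; apply: le_trans (ltW hc); rewrite mulrC ler_wpM2l // lerDl //.
have hN : N <= D0 * h by apply: gd; rewrite (ltW th) lexx.
have l2' : `|phi (t + h) (g (t + h)) - phi t x - (h * D + h * dotv q w)| <= e * (h + N).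
  by rewrite -dotvZr -wE.
have hm := Ham_ge (L_C1 S) (L_0 S) (mu_gt0 S) (L_1 S) q w Ux.
exact: super_alg h0 var0 e0 lo le l1 l2' hN l5 ce (ltW he) hm.
Qed.

End ViscositySuper.

(** * Support of the equilibrium *)

Section Families.
Context {R : realType} {n : nat}.
Local Notation V := 'rV[R]_n.
Implicit Types (g f : R -> V).

(** Once the first interval is set aside, every other one lies on its left or on its right. These
    two parts are arbitrary sublists, hence the induction on a bound [N] for the size. *)
Lemma monotone_increments (Phi : R -> R) N (l : seq (R * R)) (a b : R) : (size l <= N)%N ->
  disjoint_family l -> all (fun p => (a <= p.1) && (p.2 <= b)) l -> a <= b ->
  (forall x y, a <= x -> x <= y -> y <= b -> Phi x <= Phi y) ->
  \sum_(p <- l) (Phi p.2 - Phi p.1) <= Phi b - Phi a.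
Proof.
elim: N l a b => [|N IH] l a b; first by rewrite leqn0 => /nilP -> _ _ ab H; rewrite big_nil subr_ge0 H.
case: l => [|p l]; first by move=> _ _ _ ab H; rewrite big_nil subr_ge0 H.
rewrite /= ltnS => sl /andP[/andP[p12 al]] /andP[pl pw] /andP[/andP[ap pb] abl] ab H.
have -> : \sum_(q <- p :: l) (Phi q.2 - Phi q.1) = (Phi p.2 - Phi p.1) +
    (\sum_(q <- [seq q <- l | q.2 <= p.1]) (Phi q.2 - Phi q.1) +
     \sum_(q <- [seq q <- l | ~~ (q.2 <= p.1)]) (Phi q.2 - Phi q.1)).
  by rewrite big_cons !big_filter; congr (_ + _); exact: bigID.
have left_ : \sum_(q <- [seq q <- l | q.2 <= p.1]) (Phi q.2 - Phi q.1) <= Phi p.1 - Phi a.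
  apply: IH => //.
  - by rewrite (leq_trans _ sl) // size_filter count_size.
  - by rewrite /disjoint_family pairwise_filter // andbT; apply/allP => q; rewrite mem_filter => /andP[_ /(allP al)].
  - by apply/allP => q; rewrite mem_filter => /andP[qp /(allP abl) /andP[-> _]].
  - by move=> x y ax xy yp; apply: H => //; rewrite (le_trans yp) // (le_trans p12).
have right_ : \sum_(q <- [seq q <- l | ~~ (q.2 <= p.1)]) (Phi q.2 - Phi q.1) <= Phi b - Phi p.2.
  apply: IH => //.
  - by rewrite (leq_trans _ sl) // size_filter count_size.
  - by rewrite /disjoint_family pairwise_filter // andbT; apply/allP => q; rewrite mem_filter => /andP[_ /(allP al)].
  - apply/allP => q; rewrite mem_filter => /andP[qp ql]; have /andP[_ ->] := allP abl q ql.
    by have := allP pl q ql; rewrite /nonoverlap (negbTE qp) orbF andbT.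
  - by move=> x y ax xy yp; apply: H => //; rewrite (le_trans ap) // (le_trans p12).
have := H p.1 p.2 ap p12 pb; move: left_ right_; lra.
Qed.

Let young (D h e lam : R) : 0 < lam -> 0 <= h -> 0 <= e -> 0 <= D -> D ^+ 2 <= h * e ->
  D <= (h / lam + lam * e) / 2.
Proof.
move=> l0 h0 e0 D0 De; have S0 : 0 <= (h / lam + lam * e) / 2.
  by rewrite divr_ge0 // addr_ge0 ?divr_ge0 ?mulr_ge0 // ltW.
rewrite -(@ler_pXn2r _ 2) ?nnegrE //; apply: le_trans De _.
have -> : ((h / lam + lam * e) / 2) ^+ 2 = ((h / lam - lam * e) / 2) ^+ 2 + h * e by field; rewrite gt_eqF.
by rewrite lerDr sqr_ge0.
Qed.

(** By Young, |g(t) - g(s)| is at most ((t - s)/l + l times the energy on [s, t])/2. Summed over a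
    disjoint family the energies stay below [E], so one modulus serves all curves of energy at most
    [E]. *)
Lemma energy_abs_cont T (E : R) : 0 <= E -> forall e, 0 < e -> exists2 d, 0 < d &
  forall g f, velocity T g f -> intble 0 T (fun s => enorm (f s) ^+ 2) -> energy f 0 T <= E ->
  forall (k : nat) (s t : 'I_k -> R),
      (forall i, 0 <= s i /\ s i <= t i /\ t i <= T) ->
      (forall i j, i != j -> t i <= s j \/ t j <= s i) ->
      \sum_(i < k) (t i - s i) < d ->
      \sum_(i < k) enorm (g (t i) - g (s i)) < e.
Proof.
move=> E0 e e0; have E1 : 0 < E + 1 by rewrite ltr_wpDl.
pose l := e / (E + 1); have l0 : 0 < l by rewrite divr_gt0.
exists (l * e) => [|g f vf ie eE k s t st dis ld]; first by rewrite mulr_gt0.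
case: k s t st dis ld => [|k] s t st dis ld; first by rewrite big_ord0.
have T0 : 0 <= T by have [a [b c]] := st ord0; rewrite (le_trans a) // (le_trans b).
pose Phi x := energy f 0 x.
have PhiE a b : 0 <= a -> a <= b -> b <= T -> Phi b - Phi a = energy f a b.
  move=> a0 ab bT; have i0 : intble 0 b (fun s => enorm (f s) ^+ 2) by apply: intbleS ie.
  by rewrite /Phi /energy (rint_split a0 ab i0) addrAC subrr add0r.
have step i : enorm (g (t i) - g (s i)) <= ((t i - s i) / l + l * (Phi (t i) - Phi (s i))) / 2.
  have [a [b c]] := st i; rewrite PhiE //; apply: young => //; first by rewrite subr_ge0.
    by apply: rint_ge0 => x _; exact: sqr_ge0.
  by apply: (velocity_holder vf) => //; apply: intbleS ie.
have inc : \sum_(i < k.+1) (Phi (t i) - Phi (s i)) <= E.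
  pose q := [seq (s i, t i) | i <- enum 'I_k.+1].
  have -> : \sum_(i < k.+1) (Phi (t i) - Phi (s i)) = \sum_(p <- q) (Phi p.2 - Phi p.1).
    by rewrite big_map big_enum.
  apply: (@le_trans _ _ (Phi T - Phi 0)); last first.
    by rewrite PhiE.
  apply: (@monotone_increments Phi (size q)) => //.
  - apply/andP; split; first by apply/allP => _ /mapP[i _ ->] /=; have [_ []] := st i.
    rewrite /q pairwise_map; have := enum_uniq 'I_k.+1; rewrite uniq_pairwise.
    by apply: sub_pairwise => i j /= /dis; rewrite /nonoverlap /= => -[->|->] //; rewrite orbT.
  - by apply/allP => _ /mapP[i _ ->] /=; have [-> [_ ->]] := st i.
  - move=> x y x0 xy yT; rewrite -subr_ge0 PhiE //.
    by apply: rint_ge0 => z _; exact: sqr_ge0.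
apply: le_lt_trans (ler_sum _ (fun i _ => step i)) _.
rewrite -mulr_suml big_split /= -mulr_suml -mulr_sumr ltr_pdivrMr //.
have h1 : (\sum_(i < k.+1) (t i - s i)) / l < e by rewrite ltr_pdivrMr // mulrC.
have h2 : l * \sum_(i < k.+1) (Phi (t i) - Phi (s i)) <= e.
  apply: (@le_trans _ _ (l * E)); first by rewrite ler_wpM2l // ltW.
  by rewrite /l mulrAC ler_pdivrMr // ler_wpM2l ?(ltW e0) // lerDl.
move: h1 h2; move: (_ / l) (l * _) => a b; lra.
Qed.

(** Tychonoff on the product over times and coordinates gives a cluster point for pointwise
    convergence. It need not be the limit of a subsequence: closeness holds at finitely many times
    at once, for arbitrarily large indices. *)
Lemma curve_cluster (B : R) (c : nat -> R -> V) : (forall k s i, `|c k s 0 i| <= B) ->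
  exists g, forall (l : seq R) e k0, 0 < e -> exists2 k, (k0 <= k)%N & forall s, s \in l -> enorm (c k s - g s) < e.
Proof.
move=> cB; pose I := (R * 'I_n)%type.
pose A (i : I) : set R := `[- B, B]%classic.
have cA := @tychonoff I (fun=> R) A (fun i => @segment_compact R (- B) B).
pose P : topologicalType := {ptws I -> R}.
pose F : set_system P := (fun k (i : I) => c k i.1 0 i.2) @ \oo.
have PF : ProperFilter F by exact: fmap_proper_filter.
have FA : F [set f : P | forall i, A i (f i)].
  by exists 0%N => // k _ i; rewrite /A /= in_itv /= -ler_norml.
have [p [_ clp]] := cA _ PF FA.
exists (fun s => \row_i p (s, i)) => l e k0 e0.
pose d := e / (n%:R + 1); have n1 : 0 < n%:R + 1 :> R by rewrite ltr_wpDl.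
have d0 : 0 < d by rewrite divr_gt0.
pose W (s : R) : set P := [set f | forall i, `|f (s, i) - p (s, i)| < d].
have nW s : nbhs p (W s).
  rewrite /W; apply: (@filter_forall _ _ _ _ (nbhs_filter p)) => i.
  have nb : nbhs (p (s, i)) [set x : R | `|x - p (s, i)| < d].
    by apply/nbhs_ballP; exists d => // x; rewrite /ball /= distrC.
  exact: (@proj_continuous I (fun=> R) (s, i) p _ nb).
have nl : nbhs p [set f | forall s, s \in l -> W s f].
  elim: l => [|s l IH]; first by apply: (@filterE _ _ (nbhs_filter p)) => f s.
  apply: (@filterS2 _ _ (nbhs_filter p) _ _ _ _ (nW s) IH) => f fs fl z.
  by rewrite inE => /orP[/eqP ->|zl]; [exact: fs|exact: fl].
have Ft : F [set f | exists2 k, (k0 <= k)%N & f = (fun i : I => c k i.1 0 i.2)].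
  by exists k0 => // k kk; exists k.
have [f [[k kk ->] fl]] := clp _ _ Ft nl; exists k => // s sl.
have H := fl s sl; apply: le_lt_trans (enorm_le_norm _) _.
apply: (@le_lt_trans _ _ (n%:R * d)).
  rewrite ler_wpM2l //; apply: norm_le_coord; first exact: ltW.
  by move=> i; rewrite !mxE; apply: ltW; exact: H.
by rewrite /d mulrCA -[ltRHS]mulr1 ltr_pM2l // ltr_pdivrMr // mul1r ltrDl.
Qed.

End Families.

(** * The support of a measure on curves *)

Section Support.
Context {R : realType} {n : nat}.
Local Notation V := 'rV[R]_n.
Variables (O : set V) (T : R) (eta : probability (CurveSp n T) R).
Hypotheses (T0 : 0 < T) (carried : carried_by_Gamma O eta).
Implicit Types (g : R -> V).

Lemma open_eball (c : V) a : open (eball c a).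
Proof.
rewrite openE => y yc; apply/nbhs_enormP; exists (a - enorm (y - c)); first by rewrite subr_gt0.
move=> z zy; rewrite /eball /=; apply: le_lt_trans (enorm_dist y _ _) _.
by rewrite -ltrBrDr.
Qed.

Lemma measurable_eball (c : V) a : measurable (eball c a : set (Bor R n)).
Proof. by apply: sub_sigma_algebra; exact: open_eball. Qed.

Lemma measurable_cball (c : V) a : measurable ([set v | enorm (v - c) <= a] : set (Bor R n)).
Proof.
have -> : [set v | enorm (v - c) <= a] = ~` [set v : V | a < enorm (v - c)].
  by apply/seteqP; split => v /=; rewrite leNgt => /negP.
apply: measurableC; apply: sub_sigma_algebra; rewrite openE => y /= yc; apply/nbhs_enormP.
exists (enorm (y - c) - a); first by rewrite subr_gt0.
move=> z zy /=; have := enorm_dist z y c; rewrite (enormBC y z); lra.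
Qed.

Lemma measurable_eval t (B : set (Bor R n)) : 0 <= t <= T -> measurable B ->
  measurable ([set g | B (g t)] : set (CurveSp n T)).
Proof. by move=> tT mB; apply: sub_sigma_algebra; exists t, B. Qed.

Definition tube g (e : R) : set (R -> V) :=
  [set g' | exists2 r, r < e & forall t, 0 <= t <= T -> enorm (g' t - g t) <= r].

Lemma rat_near (t d : R) : 0 <= t <= T -> 0 < d -> exists2 q : rat, 0 <= (ratr q : R) <= T & `|(ratr q : R) - t| < d.
Proof.
move=> /andP[t0 tT] d0; pose a := Num.max 0 (t - d); pose b := Num.min T (t + d).
have ab : a < b.
  by rewrite /a /b gt_max !lt_min T0 /=; apply/andP; split; [|apply/andP; split]; lra.
have [q] := rat_in_itvoo ab; rewrite in_itv /= /a /b gt_max lt_min => /andP[/andP[q1 q2] /andP[q3 q4]].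
exists q; first by rewrite (ltW q1) (ltW q3).
by rewrite ltr_norml; apply/andP; split; lra.
Qed.

(* The uncountable intersection defining a tube may be restricted to rational times, by continuity of the curves. *)
Lemma tube_trace g e : Gamma O T g -> exists2 A : set (CurveSp n T), measurable A &
  A `&` Gamma O T = tube g e `&` Gamma O T.
Proof.
move=> Gg.
pose C j k : set (R -> V) := if unpickle k is Some q then
  (if 0 <= (ratr q : R) <= T then [set g' | enorm (g' (ratr q) - g (ratr q)) <= e - j.+1%:R^-1] else setT) else setT.
exists (\bigcup_j \bigcap_k C j k).
  apply: bigcupT_measurable => j; apply: bigcapT_measurable => k; rewrite /C.
  case: (unpickle k) => [q|]; last exact: measurableT.
  case: ifPn => [qT|_]; last exact: measurableT.
  exact: (measurable_eval qT (measurable_cball _ _)).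
apply/seteqP; split=> g' [H Gg']; (split; last exact: Gg').
- have [j _ Hj] := H; exists (e - j.+1%:R^-1); first by rewrite ltrBlDr ltrDl.
  move=> t tT; apply/ler_addgt0Pr => d d0; have d2 : 0 < d / 2 by rewrite divr_gt0.
  have [d1 d10 H1] := abs_cont_unif Gg.1 d2; have [d3 d30 H3] := abs_cont_unif Gg'.1 d2.
  have d130 : 0 < Num.min d1 d3 by rewrite lt_min d10.
  have [q qT qt] := rat_near tT d130.
  have := Hj (pickle q) I; rewrite /C pickleK qT /= => Hq.
  move: qt; rewrite lt_min => /andP[q1 q3].
  have h1 := H1 (ratr q) t qT tT q1; have h3 := H3 t (ratr q) tT qT; rewrite distrC in h3; have {}h3 := h3 q3.
  have := enorm_dist (g' (ratr q)) (g' t) (g t); have := enorm_dist (g (ratr q)) (g' (ratr q)) (g t).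
  move: Hq h1 h3; move: (j.+1%:R^-1) => jj; lra.
- have [r re Hr] := H.
  have : 0 < e - r by rewrite subr_gt0.
  move=> er; have [j jr] : exists j : nat, j.+1%:R^-1 <= e - r.
    exists (Num.trunc (e - r)^-1); rewrite -[leRHS]invrK lef_pV2 ?posrE ?invr_gt0 //.
    by rewrite ltW // truncnS_gt.
  exists j => // k _; rewrite /C; case: (unpickle k) => [q|//]; case: ifPn => // qT /=.
  by apply: le_trans (Hr _ qT) _; rewrite lerBrDr -lerBrDl.
Qed.

(** The part of [A] outside [B] misses [Gamma], hence is null. *)
Lemma carried_le (A B : set (CurveSp n T)) : measurable A -> measurable B ->
  A `&` Gamma O T `<=` B -> (eta A <= eta B)%E.
Proof.
move=> mA mB AB; have mD : measurable (A `\` B) by exact: measurableD.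
have D0 : eta (A `\` B) = 0%E.
  by apply: carried => //; apply/seteqP; split => // g [[Ag nB] Gg]; apply: nB; apply: AB.
apply: (@le_trans _ _ (eta ((A `\` B) `|` B))).
  apply: le_measure; rewrite ?inE //; first exact: measurableU.
  by move=> g Ag; have [Bg|nB] := pselect (B g); [right|left].
have E : (eta (A `\` B) + eta B = eta B)%E by rewrite D0 add0e.
by rewrite -[leRHS]E; exact: (measureU2 eta mD mB).
Qed.

(** The tube of radius e/3 about a nearby support curve lies in the tube of radius [e] about [g]. *)
Lemma csupp_closed g : Gamma O T g ->
  (forall e, 0 < e -> exists2 g', in_csupp O eta g' & forall t, 0 <= t <= T -> enorm (g' t - g t) <= e) ->
  in_csupp O eta g.
Proof.
move=> Gg H; split => // e e0 A mA AE; have e3 : 0 < e / 3 by rewrite divr_gt0.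
have [g' [Gg' cg'] g'g] := H _ e3; have [A' mA' A'E] := tube_trace (e / 3) Gg'.
apply: lt_le_trans (cg' _ e3 A' mA' A'E) _; apply: carried_le => // z zA.
have : (tube g' (e / 3) `&` Gamma O T) z by rewrite -A'E.
move=> [[r re zr] Gz]; suff : (A `&` Gamma O T) z by case.
rewrite AE; split => //; exists (e / 3 + e / 3) => [|t tT]; first by lra.
apply: le_trans (enorm_dist (g' t) _ _) _; apply: lerD; last exact: g'g.
by apply: le_trans (zr t tT) _; exact: ltW.
Qed.

(** Curves that stay near one rational vector on the grid steps around each node. The codes (N, k,
    q) are countable, and for each [k] every curve of [Gamma] has one. *)
Definition cell (N k : nat) (q : seq 'rV[rat]_n) g : Prop :=
  forall (s : R) i, 0 <= s <= T -> (i <= N)%N -> `|s - i%:R * (T / N.+1%:R)| <= T / N.+1%:R ->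
    enorm (g s - map_mx ratr (nth 0 q i)) <= k.+1%:R^-1.

Lemma grid_near (d s : R) N : 0 <= s -> s <= N.+1%:R * d -> exists2 i, (i <= N)%N & `|s - i%:R * d| <= d.
Proof.
move=> s0; elim: N => [|N IH] sN.
  by exists 0%N => //; rewrite mul0r subr0 ger0_norm // -[d]mul1r.
have [/IH[i iN id]|] := leP s (N.+1%:R * d); first by exists i => //; exact: leqW.
move=> Ns; exists N.+1 => //; rewrite ger0_norm; first by rewrite lerBlDl; move: sN; rewrite -natr1 mulrDl mul1r.
by rewrite subr_ge0 ltW.
Qed.

Lemma cell_dist N k q g g' : cell N k q g -> cell N k q g' ->
  forall s, 0 <= s <= T -> enorm (g' s - g s) <= 2 / k.+1%:R.
Proof.
move=> cg cg' s sT; have /andP[s0 s1] := sT.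
have sN : s <= N.+1%:R * (T / N.+1%:R) by rewrite mulrC divfK.
have [i iN id] := grid_near s0 sN.
apply: le_trans (enorm_dist (map_mx ratr (nth 0 q i)) _ _) _; rewrite (enormBC _ (g s)).
by rewrite mulrDl mul1r; apply: lerD; [exact: cg'|exact: cg].
Qed.

Lemma rat_vec (v : V) (e : R) : 0 < e -> exists q : 'rV[rat]_n, enorm (v - map_mx ratr q) <= e.
Proof.
move=> e0; have n1 : 0 < n%:R + 1 :> R by rewrite ltr_wpDl.
pose d := e / (n%:R + 1); have d0 : 0 < d by rewrite divr_gt0.
have H i : exists q : rat, `|v 0 i - ratr q| < d.
  have vd : v 0 i - d < v 0 i + d by lra.
  have [q] := rat_in_itvoo vd.
  by rewrite in_itv /= => /andP[q1 q2]; exists q; rewrite ltr_norml; apply/andP; split; lra.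
have [q qP] := choice H; exists (\row_i q i).
apply: le_trans (enorm_le_norm _) _; apply: (@le_trans _ _ (n%:R * d)).
  rewrite ler_wpM2l //; apply: norm_le_coord; first exact: ltW.
  by move=> i; rewrite !mxE; exact: ltW.
by rewrite /d mulrCA -[leRHS]mulr1 ler_wpM2l ?(ltW e0) // ler_pdivrMr // mul1r lerDl.
Qed.

Lemma in_cell g k : Gamma O T g -> exists N q, cell N k q g.
Proof.
move=> Gg; have k2 : 0 < k.+1%:R^-1 / 2 :> R by rewrite divr_gt0.
have [d d0 H] := abs_cont_unif Gg.1 k2.
have [N Nd] : exists N, T / N.+1%:R < d.
  exists (Num.trunc (T / d)); rewrite ltr_pdivrMr // mulrC -ltr_pdivrMr //; exact: truncnS_gt.
have [q qP] := choice (fun i : nat => rat_vec (g (i%:R * (T / N.+1%:R))) k2).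
exists N, (mkseq q N.+1) => s i sT iN si; rewrite nth_mkseq ?ltnS //.
apply: le_trans (enorm_dist (g (i%:R * (T / N.+1%:R))) _ _) _; rewrite [leRHS]splitr.
apply: lerD (qP i); apply: ltW; apply: H => //; last exact: le_lt_trans Nd.
rewrite mulr_ge0 ?divr_ge0 ?(ltW T0) //= mulrA ler_pdivrMr // mulrC ler_wpM2l ?(ltW T0) // ler_nat.
exact: leqW.
Qed.

(* A Lindelof argument: the cells are countably many and each curve lies in a cell contained in a given tube. *)
Lemma csupp_meets (A : set (CurveSp n T)) : measurable A -> (0 < eta A)%E ->
  exists2 g, in_csupp O eta g & A g.
Proof.
move=> mA A0; apply: contrapT => no.
pose code := (nat * (nat * seq 'rV[rat]_n))%type.
(* A curve outside the support has a null tube; [bad] says that the cell contains a curve whose null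
   tube is wide enough to contain the whole cell, up to the trace on [Gamma]. *)
pose bad (c : code) (B : set (CurveSp n T)) := exists g e, [/\ Gamma O T g, measurable B, eta B = 0%E,
  B `&` Gamma O T = tube g e `&` Gamma O T & 2 / c.2.1.+1%:R < e /\ cell c.1 c.2.1 c.2.2 g].
(* One null set is chosen per code, not per curve, so that their union is countable. *)
have ex k : exists B : set (CurveSp n T), [/\ measurable B, eta B = 0%E &
    forall c : code, unpickle k = Some c -> (exists B', bad c B') -> bad c B].
  case E : (unpickle k) => [c|]; last by exists set0; split => //; exact: measure0.
  have [[B bB]|nb] := pselect (exists B', bad c B').
    by exists B; have [g [e [_ mB B0 _ _]]] := bB; split => // c' [<-].
  by exists set0; split => //; move=> c' [<-].
have [B BP] := choice ex.
have mB : measurable (\bigcup_k B k) by apply: bigcupT_measurable => k; have [] := BP k.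
have B0 : eta (\bigcup_k B k) = 0%E.
  apply: measure_negligible => //; apply: negligible_bigcup => k.
  by have [mk k0 _] := BP k; exists (B k); split.
suff : (eta A <= eta (\bigcup_k B k))%E by rewrite B0 leNgt A0.
apply: carried_le => // g [Ag Gg].
have : ~ in_csupp O eta g by move=> cg; apply: no; exists g.
move/not_andP => [//|/existsNP[e /not_implyP[e0 /existsNP[A' /not_implyP[mA' /not_implyP[A'E nA']]]]]].
have A'0 : eta A' = 0%E.
  by apply/eqP; rewrite eq_le measure_ge0 andbT leNgt; apply/negP.
have [k ke] : exists k : nat, 2 / k.+1%:R < e.
  exists (Num.trunc (2 / e)); rewrite ltr_pdivrMr // mulrC -ltr_pdivrMr //; exact: truncnS_gt.
have [N [q cq]] := in_cell k Gg.
pose c : code := (N, (k, q)).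
have [mBc _ Bc] := BP (pickle c).
have [|g' [e' [Gg' _ _ BE [ke' cg']]]] := Bc c (pickleK _); first by exists A', g, e.
exists (pickle c) => //; suff : (B (pickle c) `&` Gamma O T) g by case.
rewrite BE; split => //; exists (2 / k.+1%:R) => //; exact: (cell_dist cg' cq).
Qed.

End Support.

(** * Optimal curves through the support of m(t) *)

Section SupportExtremal.
Context {R : realType} {n : nat}.
Local Notation V := 'rV[R]_n.
Variables (O U : set V) (T : R) (L : V -> V -> R) (F G : V -> Prob R n -> R)
  (kappa M mu : R) (u : R -> V -> R) (m : R -> Prob R n) (m0 : Prob R n) (eta : probability (CurveSp n T) R).
Hypotheses (S : setting O U T L F G kappa M mu u m) (eq_eta : equilibrium O L F G m0 m eta).
Let T0 := T_gt0 S.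
Let T0' := ltW (T_gt0 S).
Implicit Types (g f : R -> V).

Lemma optimal_extremal g x : optimal O L F G m T x g -> exists f, extremal O T L F u m g f.
Proof. by move=> op; have [f [vf ir dpp]] := optimal_run S op; exists f; split => //; case: op. Qed.

(** The total running cost of an extremal is a difference of values of [u], which are bounded. *)
Lemma extremal_energy : exists2 E, 0 <= E & forall g f, extremal O T L F u m g f ->
  intble 0 T (fun s => enorm (f s) ^+ 2) /\ energy f 0 T <= E.
Proof.
have [C C0 HC] := energy_run S; have [Cu Cu0 HCu] := u_bounded S.
have mu4 : 0 < 4 * mu by rewrite mulr_gt0 // (mu_gt0 S).
exists (4 * mu * (2 * Cu + C * T)).
  by rewrite mulr_ge0 ?(ltW mu4) // addr_ge0 // mulr_ge0.
move=> g f [Gg vf ir dpp]; split; first exact: (energy_intble S Gg vf ir).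
apply: le_trans (HC g f 0 T Gg vf T0' ir) _; rewrite ler_wpM2l ?(ltW mu4) // subr0 lerD2r dpp //.
have h0 : 0 <= (0 : R) <= T by rewrite lexx. have hT : 0 <= T <= T by rewrite lexx T0'.
have := HCu 0 (g 0) h0 (Gg.2 _ h0); have := HCu T (g T) hT (Gg.2 _ hT).
rewrite !ler_norml => /andP[k1 k2] /andP[k3 k4]; lra.
Qed.

Lemma closure_bounded : exists B, forall y, closure O y -> enorm y <= B.
Proof.
have [_ [B HB] _] := domO S; exists (B + 1) => y /closure_enormP /(_ 1 ltr01) [z Oz zy].
have := enorm_dist z y 0; rewrite !subr0 (enormBC y) => /le_trans; apply.
by rewrite addrC lerD ?HB // ltW.
Qed.

(** The common modulus from the energy bound turns closeness on a fine grid into uniform closeness.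
    The cluster curve inherits that modulus because a finite family of intervals involves finitely
    many times. *)
Lemma equi_limit (c : nat -> R -> V) (E : R) : 0 <= E ->
  (forall k, exists f, [/\ Gamma O T (c k), velocity T (c k) f, intble 0 T (fun s => enorm (f s) ^+ 2) & energy f 0 T <= E]) ->
  exists2 g, Gamma O T g & forall e k0, 0 < e -> exists2 k, (k0 <= k)%N &
    forall s, 0 <= s <= T -> enorm (c k s - g s) <= e.
Proof.
move=> E0 cP; have [B HB] := closure_bounded.
have [g gP] : exists g, forall (l : seq R) e k0, 0 < e -> exists2 k, (k0 <= k)%N &
    forall s, s \in l -> enorm (c k (clamp T s) - g s) < e.
  apply: (@curve_cluster _ _ B (fun k s => c k (clamp T s))) => k s i.
  apply: le_trans (coord_le_enorm _ _) _; apply: HB; have [f [Gc _ _ _]] := cP k.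
  by apply: Gc.2; exact: clamp_itv.
have near_g (l : seq R) e k0 : 0 < e -> (forall s, s \in l -> 0 <= s <= T) -> exists2 k, (k0 <= k)%N &
    forall s, s \in l -> enorm (c k s - g s) < e.
  move=> e0 lT; have [k kk H] := gP l e k0 e0; exists k => // s sl.
  by have := H s sl; rewrite clamp_id // lT.
have ac_g : abs_cont_on 0 T g.
  move=> e e0; have e2 : 0 < e / 2 by rewrite divr_gt0.
  have [d d0 H] := @energy_abs_cont R n T E E0 _ e2; exists d => // K s t st dis ld.
  have K1 : 0 < K%:R + 1 :> R by rewrite ltr_wpDl.
  (* With 2 e' lost on each of the [K] intervals, the total loss is at most e / 2. *)
  pose e' := e / 4 / (K%:R + 1); have e'0 : 0 < e' by rewrite !divr_gt0.
  have [|k _ Hk] := near_g (codom s ++ codom t) e' 0%N e'0.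
    move=> z; rewrite mem_cat => /orP[] /codomP[i ->]; have [a [b b']] := st i.
      by rewrite a (le_trans b).
    by rewrite b' (le_trans a).
  have [f [Gc vf ie eE]] := cP k; have Hc := H _ f vf ie eE K s t st dis ld.
  have step i : enorm (g (t i) - g (s i)) <= enorm (c k (t i) - c k (s i)) + 2 * e'.
    have h1 := Hk (s i); rewrite mem_cat codom_f in h1; have {}h1 := h1 isT.
    have h2 := Hk (t i); rewrite mem_cat codom_f orbT in h2; have {}h2 := h2 isT.
    have := enorm_dist (c k (t i)) (g (t i)) (g (s i)); have := enorm_dist (c k (s i)) (c k (t i)) (g (s i)).
    by rewrite (enormBC (g (t i)) (c k (t i))); move: e' h1 h2 {e'0 Hk} => e' h1 h2; lra.
  apply: le_lt_trans (ler_sum _ (fun i _ => step i)) _.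
  rewrite big_split /= sumr_const card_ord (splitr e); apply: ltr_leD Hc _.
  have -> : (2 * e') *+ K = e / 2 * (K%:R / (K%:R + 1)).
    by rewrite -[LHS]mulr_natl /e'; field; rewrite gt_eqF.
  by rewrite ler_piMr ?(ltW e2) // ler_pdivrMr // mul1r lerDl.
have cg s : 0 <= s <= T -> closure O (g s).
  move=> sT; apply/closure_enormP => e e0; have e2 : 0 < e / 2 by rewrite divr_gt0.
  have [|k _ Hk] := near_g [:: s] (e / 2) 0%N e2; first by move=> z; rewrite inE => /eqP ->.
  have [f [[_ cc] _ _ _]] := cP k.
  have /closure_enormP /(_ _ e2) [y Oy yc] := cc s sT; exists y => //.
  apply: le_lt_trans (enorm_dist (c k s) _ _) _; rewrite (splitr e); apply: ltrD yc _.
  by apply: Hk; rewrite inE.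
exists g => // e k0 e0; have e3 : 0 < e / 3 by rewrite divr_gt0.
have [d1 d10 H1] := abs_cont_unif ac_g e3.
have [d2 d20 H2] := @energy_abs_cont R n T E E0 _ e3.
have d0 : 0 < Num.min d1 d2 by rewrite lt_min d10.
have [N Nd] : exists N, T / N.+1%:R < Num.min d1 d2.
  exists (Num.trunc (T / Num.min d1 d2)); rewrite ltr_pdivrMr // mulrC -ltr_pdivrMr //; exact: truncnS_gt.
pose p (i : nat) := i%:R * (T / N.+1%:R).
have pT i : (i <= N)%N -> 0 <= p i <= T.
  move=> iN; rewrite mulr_ge0 ?divr_ge0 //= /p mulrA ler_pdivrMr // mulrC ler_wpM2l // ler_nat.
  exact: leqW.
have [|k kk Hk] := near_g [seq p i | i <- iota 0 N.+1] (e / 3) k0 e3.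
  by move=> z /mapP[i]; rewrite mem_iota /= add0n => iN ->; exact: pT.
exists k => // s sT; have /andP[s0 s1] := sT.
have sN : s <= N.+1%:R * (T / N.+1%:R) by rewrite mulrC divfK.
have [i iN id] := grid_near s0 sN; rewrite -/(p i) in id.
have := le_lt_trans id Nd; rewrite lt_min => /andP[l1 l2].
have h1 : enorm (g s - g (p i)) < e / 3 by apply: H1 => //; exact: pT.
have h2 : enorm (c k (p i) - g (p i)) < e / 3.
  by apply: Hk; apply: map_f; rewrite mem_iota /= add0n.
have [f [Gc vf ie eE]] := cP k.
have Hc a b : 0 <= a -> a <= b -> b <= T -> b - a < d2 -> enorm (c k b - c k a) < e / 3.
  move=> a0 ab bT bad; have := H2 _ f vf ie eE 1%N (fun=> a) (fun=> b) (fun=> conj a0 (conj ab bT)).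
  by rewrite !big_ord1; apply => // x y; rewrite !ord1.
have h3 : enorm (c k s - c k (p i)) < e / 3.
  have /andP[pi0 piT] := pT i iN; move: l2; rewrite ltr_norml => /andP[l3 l4].
  have [sp|/ltW ps] := leP s (p i); last exact: Hc.
  by rewrite enormBC; apply: Hc => //; lra.
have := enorm_dist (c k (p i)) (c k s) (g s); have := enorm_dist (g (p i)) (c k (p i)) (g s).
by rewrite (enormBC (g (p i)) (g s)); lra.
Qed.

Lemma supp_extremal t x : 0 <= t <= T -> msupp (m t) x -> exists g f, extremal O T L F u m g f /\ g t = x.
Proof.
move=> tT sx; have [carr _ mt opt] := eq_eta; have [E E0 HE] := extremal_energy.
have ex k : exists g, in_csupp O eta g /\ enorm (g t - x) < k.+1%:R^-1.
  have k0 : 0 < k.+1%:R^-1 :> R by rewrite invr_gt0.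
  have mb := measurable_eball x k.+1%:R^-1.
  (* [m t] is the image of [eta] under evaluation, so the curves that pass through the ball at time
     [t] have positive measure. *)
  have := sx _ k0; rewrite (mt t tT _ mb) => pos.
  have [g cg gx] := csupp_meets T0 carr (measurable_eval tT mb) pos.
  by exists g.
have [c cP] := choice ex.
have [|g Gg gP] := @equi_limit c E E0.
  move=> k; have [[Gc cc] _] := cP k; have [y op] := opt _ (cP k).1.
  have [f ef] := optimal_extremal op; have [ie eE] := HE _ _ ef.
  by exists f; split => //; case: ef.
have gx : g t = x.
  apply/eqP; rewrite -subr_eq0 -enorm_eq0 eq_le enorm_ge0 andbT; apply/ler_addgt0Pr => e e0.
  have e2 : 0 < e / 2 by rewrite divr_gt0.
  have [k kk Hk] := gP (e / 2) (Num.trunc (e / 2)^-1) e2.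
  have h1 := Hk t tT; have [_ h2] := cP k.
  have h3 : k.+1%:R^-1 <= e / 2.
    rewrite -[leRHS]invrK lef_pV2 ?posrE ?invr_gt0 //.
    by apply: ltW; apply: lt_le_trans (truncnS_gt _) _; rewrite ler_nat.
  rewrite add0r; apply: le_trans (enorm_dist (c k t) _ _) _; rewrite (splitr e) enormBC.
  by apply: lerD => //; apply: le_trans h3; exact: ltW.
have csg : in_csupp O eta g.
  apply: (csupp_closed T0 carr Gg) => e e0; have [k _ Hk] := gP e 0%N e0.
  by exists (c k) => //; exact: (cP k).1.
have [y op] := opt g csg; have [f ef] := optimal_extremal op.
by exists g, f.
Qed.

End SupportExtremal.

Theorem theorem4p17 (R : realType) (n : nat)
  (O U : set 'rV[R]_n) (T : R) (nu : 'rV[R]_n -> 'rV[R]_n)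
  (L : 'rV[R]_n -> 'rV[R]_n -> R) (F G : 'rV[R]_n -> Prob R n -> R)
  (kappa M mu : R) (m0 : Prob R n) (u : R -> 'rV[R]_n -> R) (m : R -> Prob R n) :
  0 < T ->
  C2_domain O ->
  open U -> closure O `<=` U ->
  (forall x, bdry O x -> outward_normal O x (nu x)) ->
  (* (D1) *)
  (forall x, U x -> forall m1 m2, inP O m1 -> inP O m2 ->
     `|F x m1 - F x m2| + `|G x m1 - G x m2| <= kappa * d1 O m1 m2) ->
  (* (D2) *)
  (forall m1, inP O m1 ->
     [/\ C1b_on U (fun x => F x m1), C1b_on U (fun x => G x m1) &
         forall x, U x ->
           enorm (grad (fun y => F y m1) x) + enorm (grad (fun y => G y m1) x) <= kappa]) ->
  (* (D3) *)
  (exists C, forall m1, inP O m1 -> semiconcave_lin U C (fun x => F x m1)) ->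
  (* (L0) *)
  C1_on [set z : 'rV[R]_n * 'rV[R]_n | U z.1] (fun z => L z.1 z.2) ->
  (forall x, U x -> `|L x 0| + enorm (gradx L x 0) + enorm (gradv L x 0) <= M) ->
  (* (L1) *)
  0 < mu ->
  (forall x v, U x ->
     differentiable (fun z : 'rV[R]_n * 'rV[R]_n => gradv L z.1 z.2) (x, v) /\
     forall xi : 'rV[R]_n,
       [/\ enorm xi ^+ 2 / mu <= dotv xi ('d (gradv L x) v xi),
           dotv xi ('d (gradv L x) v xi) <= mu * enorm xi ^+ 2 &
           enorm ('d (fun y => gradv L y v) x xi) <= mu * (1 + enorm v) * enorm xi]) ->
  (* (L2) *)
  (forall r, 0 < r -> exists C, forall x v w, U x -> enorm v <= r -> enorm w <= r ->
     enorm (gradx L x v - gradx L x w) <= C * enorm (v - w)) ->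
  (* (L3) *)
  (forall r, 0 < r -> exists C, forall v, enorm v <= r ->
     semiconcave_lin U C (fun x => L x v)) ->
  (* (u, m) is a mild solution *)
  mild_solution O L F G T m0 u m ->
  [/\ visc_sub O L F m T u,
      visc_super O L F m T u,
      (forall x, closure O x -> u T x = G x (m T)),
      (forall t x, 0 < t < T -> O x -> msupp (m t) x ->
         differentiable (uncurry2 u) (t, x) /\
         - dt u t x + Ham L x (dx u t x) = F x (m t)) &
      (forall t x, 0 < t < T -> bdry O x -> msupp (m t) x ->
         derivable (fun s => u s x) t 1 /\
         exists q : 'rV[R]_n,
           [/\ exists p, superdiff O u t x p,
               (forall p, superdiff O u t x p -> p - dotv p (nu x) *: nu x = q) &
               - derive1 (fun s => u s x) t + Ham_tau L nu x q = F x (m t)])].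
Proof.
move=> T0 domO oU OU nuP D1 D2 _ LC1 L0 mu0 L1 _ _ [uc mP mc [eta eq_eta] uv].
have hT : 0 <= T <= T by rewrite lexx ltW.
have S : setting O U T L F G kappa M mu u m.
  split => //.
  - by move=> x Ux m1 m2 P1 P2; apply: le_trans (D1 x Ux m1 m2 P1 P2); rewrite lerDl.
  - move=> m1 P1; have [CF _ gb] := D2 m1 P1; split => // x Ux.
    by apply: le_trans (gb x Ux); rewrite lerDl.
  - by have [_ [_ [C HC] _] _] := D2 _ (mP T hT); exists C.
split.
- exact: viscosity_sub S.
- exact: viscosity_super S.
- by move=> x cx; exact: (u_T S).
- move=> t x tT Ox sx; have tT' : 0 <= t <= T by case/andP: tT => a b; rewrite !ltW.
  have [g [f [ex gx]]] := supp_extremal S eq_eta tT' sx.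
  by rewrite -gx in Ox *; exact: (interior_regular S ex tT Ox).
- move=> t x tT bx sx; have tT' : 0 <= t <= T by case/andP: tT => a b; rewrite !ltW.
  have [g [f [ex gx]]] := supp_extremal S eq_eta tT' sx.
  by rewrite -gx in bx *; exact: (boundary_regular S ex tT bx (nuP _ bx)).
Qed.
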